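(* Let $v$ be an admissible weight on $\mathbb{R}^{2d}$ and let $\varphi\in\mathcal{S}(\mathbb{R}^d)$ be a non-zero window. For any $\tau\in[0,1]$, the following properties are equivalent: (i) $\sigma\in W(\mathcal{F}L^\infty,L^1_v)(\mathbb{R}^{2d})$. (ii) $\sigma\in\mathcal{S}'(\mathbb{R}^{2d})$ and there exists a function $H_\tau\in L^1_v(\mathbb{R}^{2d})$ such that $$|\langle\mathrm{Op}_\tau(\sigma)\pi(z)\varphi,\pi(w)\varphi\rangle|\le H_\tau(\mathcal{T}_\tau(w,z))\qquad\forall w,z\in\mathbb{R}^{2d},$$ where, for $w=(w_1,w_2)$, $z=(z_1,z_2)\in\mathbb{R}^{2d}$, $\mathcal{T}_\tau(w,z)=\big((1-\tau)w_1+\tau z_1,\ \tau w_2+(1-\tau)z_2\big)$.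
   Context: Admissible weight: a non-negative continuous function $v$ on $\mathbb{R}^{2d}$ with $v(0)=1$, even in each coordinate, submultiplicative ($v(w+z)\le v(w)v(z)$ for all $w,z$), and satisfying the GRS condition $\lim_{n\to\infty}v(nz)^{1/n}=1$ for all $z$. Time-frequency shifts: for $z=(x,\omega)\in\mathbb{R}^{2d}$, $\pi(z)f(t)=e^{2\pi i\omega\cdot t}f(t-x)$; analogously $\pi(z,\zeta)$, $z,\zeta\in\mathbb{R}^{2d}$, on $\mathbb{R}^{2d}$. The bracket $\langle f,g\rangle$ extends $\int f\overline{g}$ to $\mathcal{S}'\times\mathcal{S}$. Short-time Fourier transform on $\mathbb{R}^{2d}$: $V_G\sigma(z,\zeta)=\langle\sigma,\pi(z,\zeta)G\rangle$. $\tau$-Wigner distribution: $W_\tau(f,g)(x,\omega)=\int_{\mathbb{R}^d}e^{-2\pi i y\cdot\omega}f(x+\tau y)\overline{g(x-(1-\tau)y)}\,dy$. The $\tau$-pseudodifferential operator with symbol $\sigma\in\mathcal{S}'(\mathbb{R}^{2d})$ is $\mathrm{Op}_\tau(\sigma):\mathcal{S}(\mathbb{R}^d)\to\mathcal{S}'(\mathbb{R}^d)$, $\langle\mathrm{Op}_\tau(\sigma)f,g\rangle=\langle\sigma,W_\tau(g,f)\rangle$, $f,g\in\mathcal{S}(\mathbb{R}^d)$. Wiener amalgam space: $W(\mathcal{F}L^\infty,L^1_v)(\mathbb{R}^{2d})$ consists of $\sigma\in\mathcal{S}'(\mathbb{R}^{2d})$ with $\int_{\mathbb{R}^{2d}}\sup_{\zeta\in\mathbb{R}^{2d}}|V_G\sigma(z,\zeta)|\,v(z)\,dz<\infty$,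 where $G\in\mathcal{S}(\mathbb{R}^{2d})\setminus\{0\}$ is a fixed window; it is a standing convention that the space does not depend on the choice of $G$ (different choices give equivalent norms). $L^1_v(\mathbb{R}^{2d})$ has norm $\int|H|v$. *)

(* Defs.v *)
From HB Require Import structures.
From mathcomp Require Import all_boot all_order all_algebra.
From mathcomp Require Import complex.
From mathcomp Require Import all_classical all_reals all_analysis.

Set Implicit Arguments.
Unset Strict Implicit.
Unset Printing Implicit Defensive.

Import Order.TTheory GRing.Theory Num.Theory.
Import numFieldNormedType.Exports.

Local Open Scope classical_set_scope.
Local Open Scope ring_scope.

(** ** Lebesgue measure on R^n *)

(* R^n is ['rV[R]_n] with the sigma-algebra generated by the coordinate
   projections (equivalently, the Borel sigma-algebra of R^n). *)
Definition rV_coord (R : realType) (n : nat) (i : 'I_n) (x : 'rV[R]_n) : R :=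
  x ord0 i.

Section rV_measurable.
Context (R : realType) (n : nat).

Let coord0 : g_sigma_preimage (@rV_coord R n) set0.
Proof. exact: sigma_algebra0. Qed.

Let coordC A : g_sigma_preimage (@rV_coord R n) A ->
  g_sigma_preimage (@rV_coord R n) (~` A).
Proof. exact: sigma_algebraC. Qed.

Let coordU (F : (set 'rV[R]_n)^nat) :
  (forall i, g_sigma_preimage (@rV_coord R n) (F i)) ->
  g_sigma_preimage (@rV_coord R n) (\bigcup_i (F i)).
Proof. exact: sigma_algebra_bigcup. Qed.

HB.instance Definition _ := @isMeasurable.Build default_measure_display
  'rV[R]_n (g_sigma_preimage (@rV_coord R n)) coord0 coordC coordU.

End rV_measurable.

Definition rV_cons (R : realType) (n : nat) (p : R * 'rV[R]_n) : 'rV[R]_n.+1 :=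
  row_mx (p.1%:M : 'rV[R]_1) p.2.

Definition rV_uncons (R : realType) (n : nat) (x : 'rV[R]_n.+1) :
    R * 'rV[R]_n :=
  (rV_coord ord0 x, rsubmx (x : 'rV[R]_(1 + n))).

Lemma rV_consK (R : realType) (n : nat) :
  cancel (@rV_cons R n) (@rV_uncons R n).
Proof.
case=> a y; rewrite /rV_uncons /rV_cons /= row_mxKr /rV_coord; congr pair.
rewrite (_ : ord0 = lshift n (ord0 : 'I_1)); last exact/val_inj.
by rewrite (row_mxEl (a%:M : 'rV[R]_1)) mxE mulr1n.
Qed.

Lemma measurable_rV_coord (R : realType) (n : nat) (i : 'I_n) :
  measurable_fun setT (@rV_coord R n i).
Proof.
move=> _ Y mY; rewrite setTI; apply: sub_sigma_algebra => /=.
rewrite -bigcup_seq/=; exists i => /=; first by rewrite mem_index_enum.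
by exists Y => //; rewrite setTI.
Qed.

Lemma measurable_rV (d : measure_display) (T : measurableType d)
    (R : realType) (n : nat) (f : T -> 'rV[R]_n) :
  (forall i, measurable_fun setT (fun t => rV_coord i (f t))) ->
  measurable_fun setT f.
Proof.
move=> mcoord; apply: (measurability
  (\big[setU/set0]_(i < n)
     preimage_set_system setT (@rV_coord R n i) measurable)) => //.
move=> _ [B + <-]; rewrite -bigcup_seq => -[i _ [Y mY <-]].
by rewrite !setTI -comp_preimage -[X in measurable X]setTI; exact: mcoord.
Qed.

Lemma measurable_rV_cons (R : realType) (n : nat) :
  measurable_fun setT (@rV_cons R n).
Proof.
apply: measurable_rV => i; have [j ->|j ->] := @split_ordP 1 n i.
- rewrite (_ : (fun p => _) = fst); first exact: measurable_fst.
  apply/funext => p; rewrite /rV_coord /rV_cons.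
  by rewrite (row_mxEl (p.1%:M : 'rV[R]_1)) (ord1 j) mxE mulr1n.
- rewrite (_ : (fun p => _) = @rV_coord R n j \o snd).
    apply: measurableT_comp; first exact: measurable_rV_coord.
    exact: measurable_snd.
  apply/funext => p; rewrite /rV_coord /rV_cons /=.
  by rewrite (row_mxEr (p.1%:M : 'rV[R]_1)).
Qed.

Lemma measurable_rV_uncons (R : realType) (n : nat) :
  measurable_fun setT (@rV_uncons R n).
Proof.
apply/measurable_fun_pairP; split; first exact: measurable_rV_coord.
apply: measurable_rV => i.
rewrite (_ : (fun t => _) = @rV_coord R n.+1 (rshift 1 i)).
  exact: measurable_rV_coord.
by apply/funext => x; rewrite /rV_coord /rV_uncons /= mxE.
Qed.

Section lebesgue_rV_succ.
Context (R : realType) (n : nat).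
Variable mu : {sigma_finite_measure set 'rV[R]_n -> \bar R}.

Definition lebesgue_rV_succ : set 'rV[R]_n.+1 -> \bar R :=
  pushforward (@lebesgue_measure R \x mu)%E (@rV_cons R n).

Let succ0 : lebesgue_rV_succ set0 = 0%E.
Proof. by rewrite /lebesgue_rV_succ /pushforward preimage_set0 measure0. Qed.

Let succ_ge0 A : (0 <= lebesgue_rV_succ A)%E.
Proof. by rewrite /lebesgue_rV_succ /pushforward; exact: measure_ge0. Qed.

Let succ_sigma_additive : semi_sigma_additive lebesgue_rV_succ.
Proof.
have mpre A : measurable A -> measurable (@rV_cons R n @^-1` A).
  by move=> mA; rewrite -[X in measurable X]setTI; exact: measurable_rV_cons.
move=> F mF tF mUF; rewrite /lebesgue_rV_succ /pushforward preimage_bigcup.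
apply: measure_semi_sigma_additive => [k||]; first exact: mpre.
- apply/trivIsetP => i j _ _ ij; rewrite -preimage_setI.
  by move/trivIsetP : tF => /(_ _ _ _ _ ij) ->//; rewrite preimage_set0.
- by rewrite -preimage_bigcup; exact: mpre.
Qed.

HB.instance Definition _ := isMeasure.Build _ _ _ lebesgue_rV_succ
  succ0 succ_ge0 succ_sigma_additive.

Let succ_sigma_finite : sigma_finite setT lebesgue_rV_succ.
Proof.
have /sigma_finiteP[F [TF ndF Foo]] := sigma_finiteT (@lebesgue_measure R).
have /sigma_finiteP[G [TG ndG Goo]] := sigma_finiteT mu.
exists (fun k => @rV_uncons R n @^-1` (F k `*` G k)).
  rewrite -preimage_bigcup; apply/seteqP; split=> // x _.
  have [[k _ Fk] [l _ Gl]] : (\bigcup_i F i) (rV_uncons x).1 /\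
      (\bigcup_i G i) (rV_uncons x).2 by rewrite -TF -TG.
  exists (maxn k l) => //; split => /=.
  - by move: Fk; exact/subsetPset/ndF/leq_maxl.
  - by move: Gl; exact/subsetPset/ndG/leq_maxr.
move=> k; have [mF Fk] := Foo k; have [mG Gk] := Goo k; split.
  rewrite -[X in measurable X]setTI; apply: measurable_rV_uncons => //.
  exact: measurableX.
rewrite /lebesgue_rV_succ /pushforward -comp_preimage.
rewrite (_ : _ \o _ = id); last by apply/funext => p /=; rewrite rV_consK.
by rewrite preimage_id product_measure1E// lte_mul_pinfty// ge0_fin_numE.
Qed.

HB.instance Definition _ := Measure_isSigmaFinite.Build _ _ _
  lebesgue_rV_succ succ_sigma_finite.

End lebesgue_rV_succ.

Fixpoint lebesgue_rV (R : realType) (n : nat) :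
    {sigma_finite_measure set 'rV[R]_n -> \bar R} :=
  match n with
  | 0 => \d_(0 : 'rV[R]_0)
  | m.+1 => lebesgue_rV_succ (lebesgue_rV R m)
  end.

(** ** Complex-valued functions on R^n *)

Section complex_functions.
Context (R : realType) (n : nat).
Implicit Types (x y : 'rV[R]_n) (f : 'rV[R]_n -> R[i]).

Definition dot x y : R := \sum_(i < n) x ord0 i * y ord0 i.

(* e^{2 pi i t} *)
Definition cexp2pi (t : R) : R[i] :=
  Complex (cos (2%:R * pi * t)) (sin (2%:R * pi * t)).

Definition cintegral f : R[i] :=
  Complex (\int[lebesgue_rV R n]_(x in setT) complex.Re (f x))
          (\int[lebesgue_rV R n]_(x in setT) complex.Im (f x)).

(* [pderiv [:: i1; ...; ik] g] is d_{i1} ... d_{ik} g. *)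
Definition pderiv (s : seq 'I_n) (g : 'rV[R]_n -> R) : 'rV[R]_n -> R :=
  foldr (fun i h => 'D_(delta_mx ord0 i) h) g s.

Definition smooth (g : 'rV[R]_n -> R) : Prop :=
  forall s : seq 'I_n, continuous (pderiv s g) /\
    forall i x, derivable (pderiv s g) x (delta_mx ord0 i).

Definition cpderiv (s : seq 'I_n) f (x : 'rV[R]_n) : R[i] :=
  Complex (pderiv s (fun y => complex.Re (f y)) x)
          (pderiv s (fun y => complex.Im (f y)) x).

Definition monomial (a : {ffun 'I_n -> nat}) x : R :=
  \prod_(i < n) x ord0 i ^+ a i.

(* sup of |x^a D^b f(x)| over x in R^n and multi-indices |a|, |b| <= N; the
   multi-index b is given by a list of directions of length |b|. *)
Definition schwartz_seminorm (N : nat) f : \bar R :=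
  ereal_sup [set y | exists (a : {ffun 'I_n -> nat}) (s : seq 'I_n) x,
    [/\ (\sum_(i < n) a i <= N)%N, (size s <= N)%N &
        y = (`|monomial a x| * Normc.normc (cpderiv s f x))%:E]].

Definition schwartz f : Prop :=
  [/\ smooth (fun x => complex.Re (f x)), smooth (fun x => complex.Im (f x)) &
      forall N, (schwartz_seminorm N f < +oo)%E].

Definition nonzero_window f : Prop := schwartz f /\ exists x, f x != 0.

(* Since the bracket <sigma, g> extends \int f \bar{g}, it is conjugate-linear
   in g: a tempered distribution is represented by the functional
   g |-> <sigma, g>, whose values matter on Schwartz functions only. *)
Definition tempered (sigma : ('rV[R]_n -> R[i]) -> R[i]) : Prop :=
  (forall (a : R[i]) f g, schwartz f -> schwartz g ->
     sigma (fun x => a * f x + g x) = conjc a * sigma f + sigma g) /\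
  exists (C : R) (N : nat), forall f, schwartz f ->
     ((Normc.normc (sigma f))%:E <= C%:E * schwartz_seminorm N f)%E.

End complex_functions.

(** ** Time-frequency analysis *)

Section time_frequency.
Context (R : realType).

(* [z = row_mx x omega] *)
Definition tfshift (n : nat) (z : 'rV[R]_(n + n)) (f : 'rV[R]_n -> R[i])
    (t : 'rV[R]_n) : R[i] :=
  cexp2pi (dot (rsubmx z) t) * f (t - lsubmx z).

Definition stft (n : nat) (G : 'rV[R]_n -> R[i])
    (sigma : ('rV[R]_n -> R[i]) -> R[i]) (z zeta : 'rV[R]_n) : R[i] :=
  sigma (tfshift (row_mx z zeta) G).

Definition wigner (d : nat) (tau : R) (f g : 'rV[R]_d -> R[i])
    (u : 'rV[R]_(d + d)) : R[i] :=
  let x := lsubmx u in let omega := rsubmx u in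
  cintegral (fun y => cexp2pi (- dot y omega) * f (x + tau *: y) *
                      conjc (g (x - (1 - tau) *: y))).

(* [Op_tau tau sigma f] is the functional g |-> <Op_tau(sigma) f, g>. *)
Definition Op_tau (d : nat) (tau : R)
    (sigma : ('rV[R]_(d + d) -> R[i]) -> R[i])
    (f g : 'rV[R]_d -> R[i]) : R[i] :=
  sigma (wigner tau g f).

Definition T_tau (d : nat) (tau : R) (w z : 'rV[R]_(d + d)) : 'rV[R]_(d + d) :=
  row_mx ((1 - tau) *: lsubmx w + tau *: lsubmx z)
         (tau *: rsubmx w + (1 - tau) *: rsubmx z).

Definition flip_coord (n : nat) (i : 'I_n) (z : 'rV[R]_n) : 'rV[R]_n :=
  \row_j (if j == i then - z ord0 j else z ord0 j).

Record admissible (n : nat) (v : 'rV[R]_n -> R) : Prop := Admissible {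
  admissible_ge0 : forall z, 0 <= v z;
  admissible_cont : continuous v;
  admissible_at0 : v 0 = 1;
  admissible_even : forall i z, v (flip_coord i z) = v z;
  admissible_submul : forall w z, v (w + z) <= v w * v z;
  admissible_GRS : forall z,
    (fun k : nat => v (k%:R *: z) `^ (k%:R^-1)) @ \oo --> (1 : R)
}.

Definition in_L1 (n : nat) (v H : 'rV[R]_n -> R) : Prop :=
  measurable_fun setT H /\
  (\int[lebesgue_rV R n]_(z in setT) (`|H z| * v z)%:E < +oo)%E.

Definition amalgam_norm (n : nat) (v : 'rV[R]_n -> R) (G : 'rV[R]_n -> R[i])
    (sigma : ('rV[R]_n -> R[i]) -> R[i]) : \bar R :=
  (\int[lebesgue_rV R n]_(z in setT)
     (ereal_sup (range (fun zeta => (Normc.normc (stft G sigma z zeta))%:E))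
      * (v z)%:E))%E.

(* W(FL^oo, L^1_v) defined by means of the window G *)
Definition in_amalgam (n : nat) (v : 'rV[R]_n -> R) (G : 'rV[R]_n -> R[i])
    (sigma : ('rV[R]_n -> R[i]) -> R[i]) : Prop :=
  tempered sigma /\ (amalgam_norm v G sigma < +oo)%E.

(* The convention that W(FL^oo, L^1_v) does not depend on the window. It is a
   condition on v: it holds for polynomially growing weights, but an admissible
   v may grow faster than some Schwartz windows decay, such as
   v z = e^{|z|^{1/2}}, and then the space depends on G. *)
Definition window_independent (n : nat) (v : 'rV[R]_n -> R) : Prop :=
  forall G1 G2 : 'rV[R]_n -> R[i], nonzero_window G1 -> nonzero_window G2 ->
  forall sigma, in_amalgam v G1 sigma <-> in_amalgam v G2 sigma.

End time_frequency.

(* Main.v *)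
Require Import Defs.
From HB Require Import structures.
From mathcomp Require Import all_boot all_order all_algebra.
From mathcomp Require Import complex.
From mathcomp Require Import all_classical all_reals all_analysis.
From mathcomp Require Import measurable_realfun lebesgue_integral_under.
From mathcomp Require Import ring lra.

Set Implicit Arguments.
Unset Strict Implicit.
Unset Printing Implicit Defensive.

Import Order.TTheory GRing.Theory Num.Theory.
Import numFieldNormedType.Exports.

Local Open Scope classical_set_scope.
Local Open Scope ring_scope.

(** Put [G = wigner tau phi phi]. The covariance of the Wigner distribution under
    time-frequency shifts ([wigner_covariance]) gives
      [|<Op_tau(sigma) pi(z) phi, pi(w) phi>| = |V_G sigma (T_tau w z) zeta|]
    with [zeta = (w_2 - z_2, z_1 - w_1)], and every pair of a position and a
    modulation is of the form [(T_tau w z, zeta)] ([T_tau_surjective]). Hence the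
    almost diagonalization in (ii) says that [H] dominates
      [F_G z = sup_zeta |V_G sigma z zeta|],
    and (i), read with the window [G], says that [F_G] is integrable against [v].
    The theorem follows, provided that

    - [G] is an admissible window, that is, a non-zero Schwartz function;
    - in the direction from (i) to (ii), [F_G] is measurable and finite at every
      point, because (ii) is a bound by real numbers for all [w] and [z].

    [G] is Schwartz ([wigner_schwartz]) because it is a partial Fourier transform
    of [phi (x + tau y) * conj (phi (x - (1 - tau) y))]. It does not vanish
    ([wigner_nonzero]) because the Fourier transform is injective on Schwartz
    functions: the bounded functions by which one can multiply without leaving the
    functions of zero Fourier transform form an algebra which contains the cosines
    and is closed under bounded pointwise limits, hence contains bumps supported in
    small cubes ([multiplier_slab], [fourier_eq0_le0]).

    Measurability holds because [F_G] is a supremum of continuous functions of [z].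
    Finiteness at every point comes from the freedom in the choice of the window:
    the derivative of [V_G sigma z zeta] in the direction [z_i] is, up to the sign,
    the short-time Fourier transform with the window [d_i G] ([stft_is_derive]), so
    that one-dimensional calculus bounds [F_G z] by twice the integral of
    [F_G + F_(d_i G)] over a line through [z] ([stft_sup_le_integral]). As [v >= 1],
    window independence makes [F_K] integrable for all Schwartz windows [K], and
    these bounds can be integrated out one coordinate at a time
    ([finite_everywhere]).

    Schwartz functions are treated in families, with bounds uniform in a parameter. A family of difference quotients minus derivatives, divided by the
    step, is again uniformly Schwartz ([uschwartz_quotient_error]); this yields
    differentiability through tempered distributions and under integral signs
    without any limit theorem. *)

(** * Directional derivatives *)

Lemma is_derive_lineP {R : realType} {V : normedModType R} (f : V -> R) (x v : V)
    (l : R) :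
  is_derive x v f l <-> is_derive (0 : R) 1 (fun t => f (x + t *: v)) l.
Proof.
have E : (fun h : R => h^-1 *: ((f \o shift x) (h *: v) - f x)) =
  (fun h : R => h^-1 *: (((fun t => f (x + t *: v)) \o shift 0) (h *: 1) -
    (fun t => f (x + t *: v)) 0)).
  apply/funext => h /=.
  by rewrite addr0 scale0r addr0 [_%:A]mulr1 (addrC x).
by split=> -[D1 D2]; split; move: D1 D2; rewrite /derivable /derive E.
Qed.

Section directional.
Context {R : realType} {V : normedModType R}.
Implicit Types (f g : V -> R) (x v : V).

Lemma is_derive_add f g x v a b : is_derive x v f a -> is_derive x v g b ->
  is_derive x v (fun y => f y + g y) (a + b).
Proof. by move=> fa gb; exact: is_deriveD. Qed.

Lemma is_derive_mul f g x v a b : is_derive x v f a -> is_derive x v g b ->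
  is_derive x v (fun y => f y * g y) (a * g x + f x * b).
Proof.
move=> fa gb; have h := @is_deriveM _ _ f g x v a b fa gb.
by apply: (is_derive_eq h); rewrite /GRing.scale /= addrC (mulrC (g x)).
Qed.

Lemma is_derive_scale f x v c a : is_derive x v f a ->
  is_derive x v (fun y => c * f y) (c * a).
Proof. by move=> fa; exact: (@is_deriveZ _ _ _ f c x v a fa). Qed.

Lemma is_derive_line f x v t l :
  is_derive (x + t *: v) v f l -> is_derive t 1 (fun s => f (x + s *: v)) l.
Proof.
move=> /(is_derive_lineP _ _ _ _).1 H; apply/is_derive_lineP.
move: H; rewrite (_ : (fun _ => _) = (fun s => f (x + (t + s *: 1) *: v)))//.
by apply/funext => s; rewrite [_%:A]mulr1 scalerDl addrA.
Qed.

Lemma is_derive_comp1 (h : R -> R) f x v a b : is_derive (f x) 1 h b ->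
  is_derive x v f a -> is_derive x v (fun y => h (f y)) (a * b).
Proof.
move=> hb /(is_derive_lineP _ _ _ _).1 fa; apply/is_derive_lineP.
have hb' : is_derive (f (x + (0 : R) *: v)) 1 h b by rewrite scale0r addr0.
by have := @is_derive1_comp R h (fun t => f (x + t *: v)) 0 b a hb' fa; rewrite mulrC.
Qed.

(** Along a segment a function varies at most by the length times a bound of its
    derivative; this is the form of the mean value theorem used below. *)
Lemma line_lipschitz f (f' : V -> R) x v (h C : R) :
  (forall t : R, `|t| <= `|h| -> is_derive (x + t *: v) v f (f' (x + t *: v)) /\
    `|f' (x + t *: v)| <= C) ->
  `|f (x + h *: v) - f x| <= C * `|h|.
Proof.
move=> H.
pose F t := f (x + t *: v).
have dF (t : R) : `|t| <= `|h| -> is_derive t 1 F (f' (x + t *: v)).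
  by move=> /H[+ _]; exact: is_derive_line.
have C0 (t : R) : `|t| <= `|h| -> `|f' (x + t *: v)| <= C by move=> /H[].
have cF (i : interval R) : (forall t : R, t \in i -> `|t| <= `|h|) ->
    {within [set` i], continuous F}.
  by move=> ih; apply: derivable_within_continuous => t /ih /dF[].
have -> : f (x + h *: v) - f x = F h - F 0 by rewrite /F scale0r addr0.
have [h0|h0] := leP 0 h.
  have ih (t : R) : t \in `[0, h]%R -> `|t| <= `|h|.
    by rewrite in_itv/= => /andP[t0 th]; rewrite !ger0_norm.
  have [c ch ->] := MVT_segment h0 (fun t th => dF t (ih t (subset_itv_oo_cc th))) (cF _ ih).
  by rewrite normrM subr0 ler_pM// C0// ih.
have ih (t : R) : t \in `[h, 0]%R -> `|t| <= `|h|.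
  by rewrite in_itv/= => /andP[t0 th]; rewrite (ler0_norm (ltW h0)) ler0_norm// lerN2.
have [c ch] := MVT_segment (ltW h0) (fun t th => dF t (ih t (subset_itv_oo_cc th))) (cF _ ih).
move=> E; rewrite distrC E normrM sub0r normrN ler_pM// C0// ih//.
Qed.

End directional.

Lemma is_derive_affine {R : realType} {V W : normedModType R} (L : V -> W)
    (f : W -> R) x v w l :
  (forall t : R, L (x + t *: v) = L x + t *: w) ->
  is_derive (L x) w f l -> is_derive x v (fun y => f (L y)) l.
Proof.
move=> E /(is_derive_lineP _ _ _ _).1 H; apply/is_derive_lineP.
by move: H; rewrite (_ : (fun _ => _) = (fun t => f (L (x + t *: v))))//;
  apply/funext => t; rewrite E.
Qed.

Section coordinates.
Context {R : realType} {n : nat}.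
Implicit Types (x y : 'rV[R]_n) (i j : 'I_n).

Definition evec i : 'rV[R]_n := delta_mx ord0 i.

Lemma evecE i j : evec i ord0 j = (j == i)%:R.
Proof. by rewrite mxE eqxx. Qed.

Lemma is_derive_coord x i j :
  is_derive x (evec i) (fun y => y ord0 j) (j == i)%:R.
Proof.
apply/is_derive_lineP.
rewrite (_ : (fun _ => _) = (fun t : R => x ord0 j + (j == i)%:R * t)); last first.
  by apply/funext => t; rewrite !mxE eqxx mulrC.
have h := is_derive_add (is_derive_cst (x ord0 j) (0 : R) 1)
   (is_derive_scale (j == i)%:R (is_derive_id (0 : R) 1)).
by apply: (is_derive_eq h); rewrite add0r mulr1.
Qed.

(** One moves from [a] to [x] one coordinate at a time, which does not leave the
    cube. *)
Lemma cube_lipschitz (f : 'rV[R]_n -> R) (D : 'I_n -> 'rV[R]_n -> R)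
    (a : 'rV[R]_n) (C : R) :
  0 <= C ->
  (forall i y, (forall j, `|y ord0 j - a ord0 j| <= 1) ->
     is_derive y (evec i) f (D i y) /\ `|D i y| <= C) ->
  forall x, (forall j, `|x ord0 j - a ord0 j| <= 1) ->
  `|f x - f a| <= C * \sum_j `|x ord0 j - a ord0 j|.
Proof.
move=> C0 H x xa.
(* [p k] has the first [k] coordinates of [x] and the others of [a]. *)
pose p k := a + \sum_(j < n | (j < k)%N) (x ord0 j - a ord0 j) *: evec j.
have pE k j : p k ord0 j = if (j < k)%N then x ord0 j else a ord0 j.
  rewrite /p mxE summxE big_mkcond/=.
  rewrite (bigD1 j)//= big1 ?addr0; last first.
    move=> l lj; case: ifP => // _.
    by rewrite mxE evecE eq_sym (negbTE lj) mulr0.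
  case: ifP => _; last by rewrite addr0.
  by rewrite mxE evecE eqxx mulr1 addrC subrK.
have key k : `|f (p k) - f a| <= C * \sum_(j < n | (j < k)%N) `|x ord0 j - a ord0 j|.
  elim: k => [|k IH].
    by rewrite /p !big_pred0// addr0 subrr normr0 mulr0.
  have [kn|nk] := ltnP k n; last first.
    rewrite (_ : p k.+1 = p k); last first.
      apply/rowP => j; rewrite !pE !(leq_trans (ltn_ord j))//.
      exact: (leq_trans nk).
    apply: (le_trans IH); rewrite ler_wpM2l//.
    rewrite [leLHS]big_mkcond [leRHS]big_mkcond/=; apply: ler_sum => j _.
    by case: (ltnP j k) => [/ltnW jk|_]; [rewrite ltnS jk|case: ifP].
  pose i := Ordinal kn.
  have -> : p k.+1 = p k + (x ord0 i - a ord0 i) *: evec i.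
    rewrite /p -addrA; congr (_ + _).
    rewrite (bigD1 i)//= addrC; congr (_ + _); apply: eq_bigl => j.
    by rewrite ltnS -(inj_eq val_inj)/=; case: ltngtP.
  rewrite (bigD1 i)//=.
  rewrite (eq_bigl (fun j : 'I_n => (j < k)%N)); last first.
    by move=> j; rewrite ltnS -(inj_eq val_inj)/=; case: ltngtP.
  rewrite mulrDr -(subrK (f (p k)) (f (p k + _))) -addrA.
  apply: (le_trans (ler_normD _ _)); apply: lerD; last exact: IH.
  apply: (@line_lipschitz _ _ f (D i)) => t ti.
  apply: H => j; rewrite mxE pE mxE evecE; case: eqP => [->|_].
    by rewrite ltnn mulr1 addrC addrK (le_trans ti).
  by rewrite mulr0 addr0; case: ifP => // _; rewrite subrr normr0.
have := key n; rewrite (_ : p n = x); last by apply/rowP => j; rewrite pE ltn_ord.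
by rewrite (eq_bigl xpredT)// => j; rewrite ltn_ord.
Qed.

(** Local bounds of the partial derivatives give continuity, by the Lipschitz
    estimate above. *)
Lemma continuous_partial (f : 'rV[R]_n -> R) (D : 'I_n -> 'rV[R]_n -> R)
    (a : 'rV[R]_n) (C : R) :
  (forall i y, (forall j, `|y ord0 j - a ord0 j| <= 1) ->
     is_derive y (evec i) f (D i y) /\ `|D i y| <= C) ->
  {for a, continuous f}.
Proof.
move=> H.
have C0 : 0 <= Num.max C 0 by rewrite le_max lexx orbT.
have H' : forall i y, (forall j, `|y ord0 j - a ord0 j| <= 1) ->
     is_derive y (evec i) f (D i y) /\ `|D i y| <= Num.max C 0.
  by move=> i y /(H i)[? ?]; split=> //; rewrite le_max; apply/orP; left.
have L := cube_lipschitz C0 H'.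
apply/(@cvgrPdist_le _ _ _ (nbhs a)) => e e0.
pose M : R := Num.max C 0 * n%:R + 1.
have M0 : 0 < M by rewrite /M ltr_wpDl// mulr_ge0.
have d0 : 0 < Num.min 1 (e / M) by rewrite lt_min ltr01 divr_gt0.
near=> y.
have ya : forall j, `|y ord0 j - a ord0 j| <= Num.min 1 (e / M).
  have : ball a (Num.min 1 (e / M)) y by near: y; exact: nbhsx_ballx.
  by case=> _ b j; have := b ord0 j; rewrite /ball/= distrC => /ltW.
have ya1 j : `|y ord0 j - a ord0 j| <= 1 by have := ya j; rewrite le_min => /andP[].
rewrite distrC; apply: (le_trans (L y ya1)).
have : \sum_j `|y ord0 j - a ord0 j| <= \sum_(j < n) (e / M).
  by apply: ler_sum => j _; have := ya j; rewrite le_min => /andP[].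
rewrite sumr_const card_ord => S.
apply: (@le_trans _ _ (Num.max C 0 * (e / M *+ n))); first by rewrite ler_wpM2l.
rewrite -mulr_natl (mulrA (Num.max C 0)).
apply: (@le_trans _ _ (M * (e / M))); last by rewrite mulrC divfK ?gt_eqF.
by rewrite ler_wpM2r ?divr_ge0 ?ltW// ltrDl.
Unshelve. all: by end_near. Qed.

End coordinates.

(** * Uniformly Schwartz families *)

Section families.
Context {R : realType} {n : nat}.

Definition bounded_family (T X : Type) (F : T -> X -> R) :=
  exists C : R, forall t x, `|F t x| <= C.

Definition schwartz_class (T : Type) (P : (T -> 'rV[R]_n -> R) -> Prop) :=
  forall F, P F ->
  [/\ bounded_family F,
      forall i, exists2 F' : T -> 'rV[R]_n -> R, P F' &
        forall t x, is_derive x (evec i) (F t) (F' t x) &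
      forall i, P (fun t (x : 'rV[R]_n) => x ord0 i * F t x)].

(** The largest class stable under differentiation and under multiplication by
    coordinates and consisting of bounded families: a coinductive form of the
    definition of Schwartz functions, uniform in the parameter [t]; single
    functions are families indexed by [unit]. Membership is proved by exhibiting a
    stable class, so that iterated product rules never have to be written down. *)
Definition uschwartz (T : Type) (F : T -> 'rV[R]_n -> R) :=
  exists P, schwartz_class P /\ P F.

Lemma uschwartz_bounded T (F : T -> 'rV[R]_n -> R) :
  uschwartz F -> bounded_family F.
Proof. by case=> P [sP PF]; case: (sP F PF). Qed.

Lemma uschwartz_derive T (F : T -> 'rV[R]_n -> R) i : uschwartz F ->
  exists2 F' : T -> 'rV[R]_n -> R, uschwartz F' &
    forall t x, is_derive x (evec i) (F t) (F' t x).
Proof.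
case=> P [sP PF]; have [_ /(_ i)[F' PF' dF] _] := sP F PF.
by exists F' => //; exists P.
Qed.

Lemma uschwartz_coord T (F : T -> 'rV[R]_n -> R) i : uschwartz F ->
  uschwartz (fun t (x : 'rV[R]_n) => x ord0 i * F t x).
Proof. by case=> P [sP PF]; exists P; split=> //; case: (sP F PF). Qed.

Lemma eq_uschwartz T (F G : T -> 'rV[R]_n -> R) : (forall t x, F t x = G t x) ->
  uschwartz F -> uschwartz G.
Proof.
by move=> FG; rewrite (_ : F = G)//; apply/funext => t; apply/funext => x.
Qed.

(** The coefficients [c t] may depend on the parameter as long as they are
    bounded. *)
Inductive schwartz_span (T : Type) (B : (T -> 'rV[R]_n -> R) -> Prop) :
    (T -> 'rV[R]_n -> R) -> Prop :=
| span_base F : B F -> schwartz_span B F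
| span_schwartz F : uschwartz F -> schwartz_span B F
| span_add F G : schwartz_span B F -> schwartz_span B G ->
    schwartz_span B (fun t x => F t x + G t x)
| span_scale (c : T -> R) F : (exists M : R, forall t, `|c t| <= M) ->
    schwartz_span B F -> schwartz_span B (fun t x => c t * F t x).

Lemma span_const T (B : (T -> 'rV[R]_n -> R) -> Prop) (c : R) F :
  schwartz_span B F -> schwartz_span B (fun t x => c * F t x).
Proof. by apply: (@span_scale _ _ (fun=> c)); exists `|c|. Qed.

Lemma span_coord T (B : (T -> 'rV[R]_n -> R) -> Prop) i :
  (forall F, B F -> schwartz_span B (fun t (x : 'rV[R]_n) => x ord0 i * F t x)) ->
  forall F, schwartz_span B F -> schwartz_span B (fun t (x : 'rV[R]_n) => x ord0 i * F t x).
Proof.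
move=> HB F; elim=> {F}.
- exact: HB.
- by move=> F uF; apply/span_schwartz/uschwartz_coord.
- move=> F G _ IF _ IG.
  rewrite (_ : (fun _ _ => _) =
    (fun t (x : 'rV[R]_n) => x ord0 i * F t x + x ord0 i * G t x)); last first.
    by apply/funext => t; apply/funext => x; rewrite mulrDr.
  exact: span_add.
- move=> c F cM _ IF.
  rewrite (_ : (fun _ _ => _) = (fun t (x : 'rV[R]_n) => c t * (x ord0 i * F t x))); last first.
    by apply/funext => t; apply/funext => x; rewrite mulrCA.
  exact: span_scale.
Qed.

(** Coinduction up to linear combinations and up to known members. *)
Lemma uschwartz_upto T (B : (T -> 'rV[R]_n -> R) -> Prop) :
  (forall F, B F -> [/\ bounded_family F,
      forall i, exists2 F' : T -> 'rV[R]_n -> R, schwartz_span B F' &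
        forall t x, is_derive x (evec i) (F t) (F' t x) &
      forall i, schwartz_span B (fun t (x : 'rV[R]_n) => x ord0 i * F t x)]) ->
  forall F, schwartz_span B F -> uschwartz F.
Proof.
move=> HB F BF; exists (schwartz_span B); split=> // {F BF} F BF; split.
- elim: BF => {F} [F /HB[]//|F /uschwartz_bounded//|F G _ [C FC] _ [D GD]
    |c F [M cM] _ [C FC]].
    exists (C + D) => t x; rewrite (le_trans (ler_normD _ _))// lerD//.
  by exists (M * C) => t x; rewrite normrM ler_pM.
- move=> i; elim: BF => {F} [F /HB[]//|F uF|F G _ [F' uF' dF] _ [G' uG' dG]
    |c F cM _ [F' uF' dF]].
  + by have [F' ? ?] := uschwartz_derive i uF; exists F' => //; exact: span_schwartz.
  + exists (fun t x => F' t x + G' t x); first exact: span_add.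
    by move=> t x; exact: is_derive_add.
  + exists (fun t x => c t * F' t x); first exact: span_scale.
    by move=> t x; exact: is_derive_scale.
- by move=> i; apply: span_coord => // {BF}F /HB[].
Qed.

Lemma uschwartz_add T (F G : T -> 'rV[R]_n -> R) : uschwartz F -> uschwartz G ->
  uschwartz (fun t x => F t x + G t x).
Proof.
move=> uF uG; apply: (@uschwartz_upto _ (fun=> False)) => //.
by apply: span_add; exact: span_schwartz.
Qed.

Lemma uschwartz_scale T (c : T -> R) (F : T -> 'rV[R]_n -> R) :
  (exists M : R, forall t, `|c t| <= M) -> uschwartz F ->
  uschwartz (fun t x => c t * F t x).
Proof.
move=> cM uF; apply: (@uschwartz_upto _ (fun=> False)) => //.
by apply: span_scale => //; exact: span_schwartz.
Qed.

Lemma uschwartz_const T (c : R) (F : T -> 'rV[R]_n -> R) : uschwartz F ->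
  uschwartz (fun t x => c * F t x).
Proof. by apply: (@uschwartz_scale _ (fun=> c)); exists `|c|. Qed.

Lemma uschwartz_opp T (F : T -> 'rV[R]_n -> R) : uschwartz F ->
  uschwartz (fun t x => - F t x).
Proof.
move=> /(uschwartz_const (-1)); rewrite (_ : (fun _ _ => _) = (fun t x => - F t x))//.
by apply/funext => t; apply/funext => x; rewrite mulN1r.
Qed.

Lemma uschwartz_reindex T U (h : U -> T) (F : T -> 'rV[R]_n -> R) :
  uschwartz F -> uschwartz (fun u => F (h u)).
Proof.
move=> uF; pose B (G : U -> 'rV[R]_n -> R) := exists2 F, uschwartz F & G = fun u => F (h u).
apply: (@uschwartz_upto _ B); last by apply: span_base; exists F.
move=> _ [{uF}F uF ->]; split.
- by have [C FC] := uschwartz_bounded uF; exists C.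
- move=> i; have [F' uF' dF] := uschwartz_derive i uF.
  by exists (fun u => F' (h u)) => //; apply: span_base; exists F'.
- move=> i; apply: span_base.
  by exists (fun t (x : 'rV[R]_n) => x ord0 i * F t x) => //; exact: uschwartz_coord.
Qed.

(** Continuity is a consequence of stability: all partial derivatives are bounded. *)
Lemma uschwartz_continuous T (F : T -> 'rV[R]_n -> R) t :
  uschwartz F -> continuous (F t).
Proof.
move=> uF.
have /choice[F' /all_and2[uF' dF]] : forall i, exists F' : T -> 'rV[R]_n -> R,
    uschwartz F' /\ forall t x, is_derive x (evec i) (F t) (F' t x).
  by move=> i; have [F' ? ?] := uschwartz_derive i uF; exists F'.
have /choice[C FC] : forall i, exists C : R, forall t x, `|F' i t x| <= C.
  by move=> i; exact/uschwartz_bounded/uF'.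
move=> x; apply: (@continuous_partial _ _ (F t) (fun i => F' i t) x (\sum_i `|C i|)).
move=> i y _; split; first exact: dF.
rewrite (le_trans (FC i t y))// (le_trans (ler_norm _))//.
by rewrite (bigD1 i)//= lerDl sumr_ge0.
Qed.

Lemma pderiv_rcons (s : seq 'I_n) i (g g' : 'rV[R]_n -> R) :
  (forall x, is_derive x (evec i) g (g' x)) ->
  pderiv (rcons s i) g = pderiv s g'.
Proof.
move=> dg; rewrite /pderiv foldr_rcons; congr foldr.
by apply/funext => x; case: (dg x).
Qed.

Lemma uschwartz_pderiv T (F : T -> 'rV[R]_n -> R) s :
  uschwartz F -> uschwartz (fun t => pderiv s (F t)).
Proof.
elim/last_ind: s F => [//|s i IH] F uF.
have [F' uF' dF] := uschwartz_derive i uF.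
rewrite (_ : (fun _ => _) = (fun t => pderiv s (F' t))); first exact: IH.
by apply/funext => t; exact: pderiv_rcons.
Qed.

Lemma uschwartz_smooth T (F : T -> 'rV[R]_n -> R) t :
  uschwartz F -> smooth (F t).
Proof.
move=> /uschwartz_pderiv uF s; split; first exact: uschwartz_continuous (uF s).
by move=> i x; have [F' _ dF] := uschwartz_derive i (uF s); case: (dF t x).
Qed.

Lemma monomial_succ (a : {ffun 'I_n -> nat}) i (x : 'rV[R]_n) :
  monomial [ffun j => (j == i) + a j]%N x = x ord0 i * monomial a x.
Proof.
rewrite /monomial (eq_bigr (fun j => x ord0 j ^+ (j == i) * x ord0 j ^+ a j)).
  rewrite big_split/=; congr (_ * _).
  by rewrite (bigD1 i)//= eqxx expr1 big1 ?mulr1// => j /negbTE ->.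
by move=> j _; rewrite ffunE exprD.
Qed.

(** One constant serves all weights of degree at most [N]: a factor [x_i] of the
    monomial is absorbed into the family, and there are finitely many [i]. *)
Lemma uschwartz_weight_bound T (F : T -> 'rV[R]_n -> R) N : uschwartz F ->
  exists C : R, forall t (a : {ffun 'I_n -> nat}) x, (\sum_i a i <= N)%N ->
    `|monomial a x * F t x| <= C.
Proof.
elim: N F => [|N IH] F uF.
  have [C FC] := uschwartz_bounded uF; exists C => t a x.
  rewrite leqn0 sum_nat_eq0 => /forallP a0.
  rewrite /monomial big1 ?mul1r// => i _.
  by have /eqP -> := a0 i; rewrite expr0.
have [C0 FC0] := uschwartz_bounded uF.
have /choice[C FC] := fun i => IH _ (uschwartz_coord i uF).
exists (`|C0| + \sum_i `|C i|) => t a x aN.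
have [/forallP a0|] := boolP [forall i, a i == 0%N].
  rewrite /monomial big1 ?mul1r; last first.
    by move=> i _; have /eqP -> := a0 i; rewrite expr0.
  rewrite (le_trans (FC0 t x))// (le_trans (ler_norm _))//.
  by rewrite lerDl sumr_ge0.
rewrite negb_forall => /existsP[i ai].
pose b : {ffun 'I_n -> nat} := [ffun j => a j - (j == i)]%N.
have ab : a = [ffun j => (j == i) + b j]%N.
  apply/ffunP => j; rewrite !ffunE subnKC//.
  by case: eqP => // ->; rewrite lt0n.
have bN : (\sum_j b j <= N)%N.
  move: aN; rewrite ab (eq_bigr (fun j => (j == i) + b j)%N); last first.
    by move=> j _; rewrite ffunE.
  by rewrite big_split/= (bigD1 i)//= eqxx big1 ?addn0 ?add1n// => j /negbTE ->.
rewrite ab monomial_succ (mulrC (x ord0 i)) -mulrA.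
rewrite (le_trans (FC i t b x bN))// (le_trans (ler_norm _))//.
by rewrite (bigD1 i)//= addrA (addrC `|C0|) -addrA lerDl addr_ge0// sumr_ge0.
Qed.

Lemma uschwartz_seminorm_bound T (F : T -> 'rV[R]_n -> R) N N' : uschwartz F ->
  exists C : R, forall t (a : {ffun 'I_n -> nat}) s x, (\sum_i a i <= N)%N ->
    (size s <= N')%N -> `|monomial a x * pderiv s (F t) x| <= C.
Proof.
elim: N' F => [|N' IH] F uF.
  have [C FC] := uschwartz_weight_bound N uF; exists C => t a s x aN.
  by rewrite leqn0 size_eq0 => /eqP ->; exact: FC.
have [C0 FC0] := uschwartz_weight_bound N uF.
have /choice[F' /all_and2[uF' dF]] : forall i, exists F' : T -> 'rV[R]_n -> R,
    uschwartz F' /\ forall t x, is_derive x (evec i) (F t) (F' t x).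
  by move=> i; have [F' ? ?] := uschwartz_derive i uF; exists F'.
have /choice[C FC] := fun i => IH _ (uF' i).
exists (`|C0| + \sum_i `|C i|) => t a s x aN.
case: (lastP s) => [_|{}s i].
  rewrite (le_trans (FC0 t a x aN))// (le_trans (ler_norm _))//.
  by rewrite lerDl sumr_ge0.
rewrite size_rcons ltnS => sN.
rewrite (pderiv_rcons _ (dF i t)).
rewrite (le_trans (FC i t a s x aN sN))// (le_trans (ler_norm _))//.
by rewrite (bigD1 i)//= addrA (addrC `|C0|) -addrA lerDl addr_ge0// sumr_ge0.
Qed.

End families.

(** ** Complex-valued families *)

Section complex_families.
Context {R : realType}.
Implicit Types (z : R[i]).

Lemma normr_Re_le z : `|complex.Re z| <= Normc.normc z.
Proof.
case: z => a b /=; rewrite -sqrtr_sqr ler_wsqrtr// lerDl sqr_ge0//.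
Qed.

Lemma normr_Im_le z : `|complex.Im z| <= Normc.normc z.
Proof.
case: z => a b /=; rewrite -sqrtr_sqr ler_wsqrtr// lerDr sqr_ge0//.
Qed.

Lemma normc_le z : Normc.normc z <= `|complex.Re z| + `|complex.Im z|.
Proof.
case: z => a b /=.
rewrite -[leRHS]ger0_norm ?addr_ge0// -sqrtr_sqr ler_wsqrtr//.
rewrite sqrrD !real_normK ?num_real// addrAC lerDl.
by rewrite mulrn_wge0// mulr_ge0.
Qed.

Context {n : nat}.

Definition ucschwartz T (F : T -> 'rV[R]_n -> R[i]) :=
  uschwartz (fun t x => complex.Re (F t x)) /\
  uschwartz (fun t x => complex.Im (F t x)).

Lemma ucschwartz_seminorm T (F : T -> 'rV[R]_n -> R[i]) N : ucschwartz F ->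
  exists C : R, forall t, (schwartz_seminorm N (F t) <= C%:E)%E.
Proof.
case=> uR uI.
have [C FC] := uschwartz_seminorm_bound N N uR.
have [D FD] := uschwartz_seminorm_bound N N uI.
exists (C + D) => t; apply: ge_ereal_sup => _ [a [s [x [aN sN ->]]]].
rewrite lee_fin (le_trans (ler_wpM2l _ (normc_le _)))//.
rewrite mulrDr -!normrM lerD//; [exact: FC|exact: FD].
Qed.

Lemma ucschwartz_schwartz T (F : T -> 'rV[R]_n -> R[i]) t :
  ucschwartz F -> schwartz (F t).
Proof.
move=> uF; split; first exact: uschwartz_smooth uF.1.
  exact: uschwartz_smooth uF.2.
by move=> N; have [C FC] := ucschwartz_seminorm N uF; rewrite (le_lt_trans (FC t))// ltry.
Qed.

(** Conversely, the span of the products of a monomial and an iterated derivative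
    is a stable class. *)
Lemma smooth_uschwartz (g : 'rV[R]_n -> R) : smooth g ->
  (forall (a : {ffun 'I_n -> nat}) s, exists C : R, forall x,
    `|monomial a x * pderiv s g x| <= C) ->
  uschwartz (fun _ : unit => g).
Proof.
move=> sg bg.
pose B (F : unit -> 'rV[R]_n -> R) := exists a s,
  F = fun _ x => monomial a x * pderiv s g x.
have Bcoord F i : B F -> schwartz_span B (fun t (x : 'rV[R]_n) => x ord0 i * F t x).
  move=> [a [s ->]]; apply: span_base.
  exists [ffun j => (j == i) + a j]%N, s.
  by apply/funext => _; apply/funext => x; rewrite monomial_succ mulrA.
apply: (@uschwartz_upto _ _ _ B); last first.
  apply: span_base; exists [ffun=> 0%N], [::].
  apply/funext => _; apply/funext => x.
  by rewrite /monomial big1 ?mul1r// => i _; rewrite ffunE expr0.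
move=> F BF; split.
- by case: BF => a [s ->]; have [C gC] := bg a s; exists C => _ x; exact: gC.
- move=> i; case: BF => a [s ->] {F}.
  (* Induction on the degree: the product rule splits off one coordinate. *)
  have [N] := ubnP (\sum_j a j)%N.
  elim: N a => // N IH a; rewrite ltnS => aN.
  have dg x : is_derive x (evec i) (pderiv s g) (pderiv (i :: s) g x).
    by have [_ /(_ i x)] := sg s; exact: derivableP.
  have [/forallP a0|] := boolP [forall j, a j == 0%N].
    have a1 x : monomial a x = 1 :> R.
      by rewrite /monomial big1// => j _; have /eqP -> := a0 j; rewrite expr0.
    exists (fun _ x => monomial a x * pderiv (i :: s) g x).
      by apply: span_base; exists a, (i :: s).
    move=> _ x; rewrite a1 mul1r.
    rewrite (_ : (fun _ => _) = pderiv s g); first exact: dg.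
    by apply/funext => y; rewrite a1 mul1r.
  rewrite negb_forall => /existsP[j aj].
  pose b : {ffun 'I_n -> nat} := [ffun k => a k - (k == j)]%N.
  have ab : a = [ffun k => (k == j) + b k]%N.
    apply/ffunP => k; rewrite !ffunE subnKC//.
    by case: eqP => // ->; rewrite lt0n.
  have bN : (\sum_k b k < N)%N.
    move: aN; rewrite ab (eq_bigr (fun k => (k == j) + b k)%N); last first.
      by move=> k _; rewrite ffunE.
    by rewrite big_split/= (bigD1 j)//= eqxx big1 ?addn0 ?add1n// => k /negbTE ->.
  have [F' BF' dF'] := IH b bN.
  exists (fun t x => (j == i)%:R * (monomial b x * pderiv s g x) + x ord0 j * F' t x).
    apply: span_add; last by apply: span_coord => // F; exact: Bcoord.
    by apply: span_const; apply: span_base; exists b, s.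
  move=> t x.
  rewrite (_ : (fun _ => _) = (fun x : 'rV[R]_n => x ord0 j * (monomial b x * pderiv s g x))).
    by apply: is_derive_mul; exact: is_derive_coord.
  by apply/funext => y; rewrite ab monomial_succ mulrA.
- by move=> i; exact: Bcoord.
Qed.

Lemma schwartz_bound (f : 'rV[R]_n -> R[i]) a s : schwartz f ->
  exists C : R, forall x, `|monomial a x| * Normc.normc (cpderiv s f x) <= C.
Proof.
case=> _ _ sf.
pose N := maxn (\sum_i a i) (size s).
have := sf N; set S := schwartz_seminorm N f => SN.
have ub x : ((`|monomial a x| * Normc.normc (cpderiv s f x))%:E <= S)%E.
  apply: ereal_sup_ubound; exists a, s, x; split=> //.
    exact: leq_maxl.
  exact: leq_maxr.
move: SN ub; case: S => [r _ ub|//|_ ub]; last by have := ub 0; rewrite leeNy_eq.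
by exists r => x; rewrite -lee_fin.
Qed.

Lemma schwartzP (f : 'rV[R]_n -> R[i]) :
  schwartz f <-> ucschwartz (fun _ : unit => f).
Proof.
split=> [sf|]; last exact: (@ucschwartz_schwartz _ _ tt).
have [sR sI _] := sf.
split; apply: smooth_uschwartz => // a s; have [C fC] := schwartz_bound a s sf;
  exists C => x; rewrite normrM (le_trans _ (fC x))// ler_wpM2l//.
  exact: (normr_Re_le (cpderiv s f x)).
exact: (normr_Im_le (cpderiv s f x)).
Qed.

(** Tempered distributions see only the seminorms, hence they are bounded on
    uniformly Schwartz families. *)
Lemma tempered_bounded (sigma : ('rV[R]_n -> R[i]) -> R[i]) T
    (F : T -> 'rV[R]_n -> R[i]) : tempered sigma -> ucschwartz F ->
  exists C : R, forall t, Normc.normc (sigma (F t)) <= C.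
Proof.
case=> _ [C [N sC]] uF; have [D FD] := ucschwartz_seminorm N uF.
have D0 t : (0 <= schwartz_seminorm N (F t))%E.
  have : (0 <= (`|monomial [ffun=> 0%N] (0 : 'rV[R]_n)| *
      Normc.normc (cpderiv [::] (F t) 0))%:E)%E.
    by rewrite lee_fin mulr_ge0// (le_trans _ (normr_Re_le _)).
  move/le_trans; apply; apply: ereal_sup_ubound; exists [ffun=> 0%N], [::], 0.
  by split=> //; rewrite big1// => i _; rewrite ffunE.
exists (`|C| * D) => t; rewrite -lee_fin.
apply: (le_trans (sC _ (ucschwartz_schwartz t uF))).
apply: (@le_trans _ _ (`|C|%:E * schwartz_seminorm N (F t))%E).
  by rewrite lee_wpmul2r// lee_fin ler_norm.
by rewrite EFinM lee_wpmul2l// lee_fin.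
Qed.

End complex_families.

(** ** Modulations, translations and difference quotients *)
Section operations.
Context {R : realType} {n : nat}.
Implicit Types (i j : 'I_n).

Lemma is_derive_dir {V : normedModType R} (f : V -> R) x v (c l : R) :
  is_derive x v f l -> is_derive x (c *: v) f (c * l).
Proof.
move=> /(is_derive_lineP _ _ _ _).1 H; apply/is_derive_lineP.
have H' : is_derive (c * 0 : R) 1 (fun t => f (x + t *: v)) l by rewrite mulr0.
have S := is_derive_scale c (is_derive_id (0 : R) 1).
have := is_derive_comp1 H' S; rewrite mulr1.
rewrite (_ : (fun _ => _) = (fun t => f (x + t *: (c *: v))))//.
by apply/funext => t; rewrite scalerA mulrC.
Qed.

Lemma dotDr (z x y : 'rV[R]_n) : dot z (x + y) = dot z x + dot z y.
Proof.
by rewrite /dot -big_split/=; apply: eq_bigr => i _; rewrite mxE mulrDr.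
Qed.

Lemma dotDl (x y z : 'rV[R]_n) : dot (x + y) z = dot x z + dot y z.
Proof.
by rewrite /dot -big_split/=; apply: eq_bigr => i _; rewrite mxE mulrDl.
Qed.

Lemma dotZr (z x : 'rV[R]_n) c : dot z (c *: x) = c * dot z x.
Proof.
by rewrite /dot mulr_sumr; apply: eq_bigr => i _; rewrite mxE mulrCA.
Qed.

Lemma dotZl (z x : 'rV[R]_n) c : dot (c *: z) x = c * dot z x.
Proof.
by rewrite /dot mulr_sumr; apply: eq_bigr => i _; rewrite mxE mulrA.
Qed.

Lemma dot_evec (z : 'rV[R]_n) i : dot z (evec i) = z ord0 i.
Proof.
rewrite /dot (bigD1 i)//= evecE eqxx mulr1 big1 ?addr0// => j ji.
by rewrite evecE (negbTE ji) mulr0.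
Qed.

Lemma is_derive_dot (z x : 'rV[R]_n) i : is_derive x (evec i) (dot z) (z ord0 i).
Proof.
apply/is_derive_lineP.
rewrite (_ : (fun _ => _) = (fun t : R => dot z x + z ord0 i * t)); last first.
  by apply/funext => t; rewrite dotDr dotZr dot_evec mulrC.
have h := is_derive_add (is_derive_cst (dot z x) (0 : R) 1)
   (is_derive_scale (z ord0 i) (is_derive_id (0 : R) 1)).
by apply: (is_derive_eq h); rewrite add0r mulr1.
Qed.

Lemma is_derive_wave (z x : 'rV[R]_n) b i :
  is_derive x (evec i) (fun y => cos (2%:R * pi * dot z y + b))
    (- (2%:R * pi * z ord0 i) * sin (2%:R * pi * dot z x + b)) /\
  is_derive x (evec i) (fun y => sin (2%:R * pi * dot z y + b))
    (2%:R * pi * z ord0 i * cos (2%:R * pi * dot z x + b)).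
Proof.
have h := is_derive_add (is_derive_scale (2%:R * pi) (is_derive_dot z x i))
  (is_derive_cst b x (evec i)).
split.
  apply: (is_derive_eq (is_derive_comp1 (is_derive_cos _) h)).
  by rewrite addr0 mulrN mulNr.
by apply: (is_derive_eq (is_derive_comp1 (is_derive_sin _) h)); rewrite addr0.
Qed.

Lemma uschwartz_wave T (F : T -> 'rV[R]_n -> R) (z : 'rV[R]_n) (b : T -> R) :
  uschwartz F ->
  uschwartz (fun t x => cos (2%:R * pi * dot z x + b t) * F t x) /\
  uschwartz (fun t x => sin (2%:R * pi * dot z x + b t) * F t x).
Proof.
move=> uF.
pose B (G : T -> 'rV[R]_n -> R) := exists2 F, uschwartz F &
  G = (fun t x => cos (2%:R * pi * dot z x + b t) * F t x) \/
  G = (fun t x => sin (2%:R * pi * dot z x + b t) * F t x).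
suff HB G : schwartz_span B G -> uschwartz G.
    by split; apply: HB; apply: span_base; exists F => //; [left|right].
clear F uF; apply: uschwartz_upto => {}G [F uF FE]; split.
- have [C FC] := uschwartz_bounded uF.
  exists C => t x; case: FE => ->; rewrite normrM -[leRHS]mul1r ler_pM//.
    by rewrite ler_norml cos_geN1 cos_le1.
  by rewrite ler_norml sin_geN1 sin_le1.
- move=> i; have [F' uF' dF] := uschwartz_derive i uF.
  pose a := 2%:R * pi * z ord0 i.
  case: FE => ->.
    exists (fun t x => - a * (sin (2%:R * pi * dot z x + b t) * F t x) +
      cos (2%:R * pi * dot z x + b t) * F' t x).
      apply: span_add; last by apply: span_base; exists F' => //; left.
      by apply: span_const; apply: span_base; exists F => //; right.
    move=> t x; have [h _] := is_derive_wave z x (b t) i.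
    by apply: (is_derive_eq (is_derive_mul h (dF t x))); rewrite mulrA.
  exists (fun t x => a * (cos (2%:R * pi * dot z x + b t) * F t x) +
      sin (2%:R * pi * dot z x + b t) * F' t x).
    apply: span_add; last by apply: span_base; exists F' => //; right.
    by apply: span_const; apply: span_base; exists F => //; left.
  move=> t x; have [_ h] := is_derive_wave z x (b t) i.
  by apply: (is_derive_eq (is_derive_mul h (dF t x))); rewrite mulrA.
- move=> i; apply: span_base.
  exists (fun t (x : 'rV[R]_n) => x ord0 i * F t x); first exact: uschwartz_coord.
  by case: FE => ->; [left|right]; apply/funext => t; apply/funext => x;
    rewrite mulrCA.
Qed.

(** The translations have to be bounded, since [x_i * F (x - z)] is
    [(x_i F) (x - z) + z_i * F (x - z)]. *)
Lemma uschwartz_translate T (F : T -> 'rV[R]_n -> R) (z : T -> 'rV[R]_n) M :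
  (forall t j, `|z t ord0 j| <= M) ->
  uschwartz F -> uschwartz (fun t x => F t (x - z t)).
Proof.
move=> zM uF.
pose B (G : T -> 'rV[R]_n -> R) := exists2 F, uschwartz F &
  G = (fun t x => F t (x - z t)).
apply: (@uschwartz_upto _ _ _ B); last by apply: span_base; exists F.
move=> {uF}_ [{}F uF ->]; split.
- by have [C FC] := uschwartz_bounded uF; exists C.
- move=> i; have [F' uF' dF] := uschwartz_derive i uF.
  exists (fun t x => F' t (x - z t)); first by apply: span_base; exists F'.
  move=> t x; apply: (@is_derive_affine _ _ _ (fun y => y - z t) _ _ _ (evec i)) => //.
  by move=> s; rewrite addrAC.
- move=> i.
  rewrite (_ : (fun _ _ => _) = (fun t (x : 'rV[R]_n) =>
      (x - z t) ord0 i * F t (x - z t) + z t ord0 i * F t (x - z t))); last first.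
    by apply/funext => t; apply/funext => x; rewrite -mulrDl !mxE subrK.
  apply: span_add.
    apply: span_base; exists (fun t (x : 'rV[R]_n) => x ord0 i * F t x) => //.
    exact: uschwartz_coord.
  apply: (@span_scale _ _ _ _ (fun t => z t ord0 i)); first by exists M.
  by apply: span_base; exists F.
Qed.

(** The second difference of [f] along two coordinates approximates the mixed
    derivative; as it is symmetric, mixed derivatives commute. *)
Lemma mixed_difference (f fi fij : 'rV[R]_n -> R) i j (x : 'rV[R]_n) (C h : R) :
  0 <= C -> `|h| <= 2^-1 ->
  (forall y, is_derive y (evec i) f (fi y)) ->
  (forall y, is_derive y (evec j) fi (fij y)) ->
  (forall y : 'rV[R]_n, (forall k, `|y ord0 k - x ord0 k| <= 1) ->
    `|fij y - fij x| <= C * \sum_k `|y ord0 k - x ord0 k|) ->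
  `|f (x + h *: evec i + h *: evec j) - f (x + h *: evec i)
     - f (x + h *: evec j) + f x - h ^+ 2 * fij x| <= n%:R * C * `|h| ^+ 3 *+ 2.
Proof.
move=> C0 h1 df dfi Lf.
have fijC (s t : R) : `|s| <= `|h| -> `|t| <= `|h| ->
    `|fij (x + s *: evec i + t *: evec j) - fij x| <= n%:R * C * `|h| *+ 2.
  move=> sh th.
  have st k : `|(x + s *: evec i + t *: evec j) ord0 k - x ord0 k| <= `|h| *+ 2.
    rewrite !mxE eqxx/= [X in `|X|](_ : _ = s * (k == i)%:R + t * (k == j)%:R).
      rewrite (le_trans (ler_normD _ _))// mulr2n.
      by rewrite !normrM lerD// -[leRHS]mulr1 ler_pM// normr_nat lern1 leq_b1.
    by ring.
  have h2 : `|h| *+ 2 <= 1 by rewrite -mulr_natr -ler_pdivlMr// mul1r.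
  apply: (le_trans (Lf _ (fun k => le_trans (st k) h2))).
  rewrite -mulrnAr -mulrA mulrCA ler_wpM2l//.
  apply: (le_trans (ler_sum _ (fun k _ => st k))).
  by rewrite sumr_const card_ord mulr_natl.
pose k1 (y : 'rV[R]_n) := f (y + h *: evec j) - f y - h * fij x * y ord0 i.
have Hk1 : `|k1 (x + h *: evec i) - k1 x| <= (n%:R * C * `|h| *+ 2 * `|h|) * `|h|.
  apply: (@line_lipschitz _ _ _ (fun y : 'rV[R]_n =>
      fi (y + h *: evec j) - fi y - h * fij x)) => t th; split.
    rewrite /k1.
    apply: (is_derive_eq (is_derive_add (is_derive_add _ (is_deriveN (df _)))
      (is_deriveN (is_derive_scale _ (is_derive_coord _ _ _))))).
      apply: (@is_derive_affine _ _ _ (fun y => y + h *: evec j) _ _ _ (evec i)).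
      by move=> s; rewrite addrAC.
    by rewrite eqxx mulr1.
  pose k2 (y : 'rV[R]_n) := fi y - fij x * y ord0 j.
  have -> : fi (x + t *: evec i + h *: evec j) - fi (x + t *: evec i) - h * fij x =
      k2 (x + t *: evec i + h *: evec j) - k2 (x + t *: evec i).
    rewrite /k2 !mxE !eqxx/=; ring.
  apply: (@line_lipschitz _ _ _ (fun y => fij y - fij x)) => s sh; split.
    apply: (is_derive_eq (is_derive_add (dfi _)
      (is_deriveN (is_derive_scale _ (is_derive_coord _ _ _))))).
    by rewrite eqxx mulr1.
  exact: fijC.
move: Hk1; rewrite /k1 !mxE !eqxx/=.
rewrite [X in `|X| <= _ -> _](_ : _ = f (x + h *: evec i + h *: evec j) - f (x + h *: evec i)
     - f (x + h *: evec j) + f x - h ^+ 2 * fij x); last by ring.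
by move/le_trans; apply; rewrite !mulrnAl -mulrA -mulrA -expr2 -exprS.
Qed.

End operations.

Section difference_quotients.
Context {R : realType} {n : nat}.
Implicit Types (i j : 'I_n).

Lemma uschwartz_lipschitz T (F : T -> 'rV[R]_n -> R) : uschwartz F ->
  exists2 C : R, 0 <= C & forall t (x y : 'rV[R]_n),
    (forall k, `|y ord0 k - x ord0 k| <= 1) ->
    `|F t y - F t x| <= C * \sum_k `|y ord0 k - x ord0 k|.
Proof.
move=> uF.
have /choice[F' /all_and2[uF' dF]] : forall i, exists F' : T -> 'rV[R]_n -> R,
    uschwartz F' /\ forall t x, is_derive x (evec i) (F t) (F' t x).
  by move=> i; have [F' ? ?] := uschwartz_derive i uF; exists F'.
have /choice[C FC] : forall i, exists C : R, forall t x, `|F' i t x| <= C.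
  by move=> i; exact/uschwartz_bounded/uF'.
exists (\sum_i `|C i|); first by rewrite sumr_ge0.
move=> t x y; apply: (@cube_lipschitz _ _ (F t) (fun i => F' i t) x).
  by rewrite sumr_ge0.
move=> i z _; split; first exact: dF.
rewrite (le_trans (FC i t z))// (le_trans (ler_norm _))//.
by rewrite (bigD1 i)//= lerDl sumr_ge0.
Qed.

Lemma small_multiple_eq0 (a K : R) :
  (forall h : R, 0 < h -> h <= 2^-1 -> `|a| <= K * h) -> a = 0.
Proof.
move=> H; apply/eqP; rewrite -normr_le0 leNgt; apply/negP => a0.
have K1 : 0 < `|K| + 1 by rewrite ltr_wpDl.
pose h := Num.min 2^-1 (`|a| / (`|K| + 1) / 2).
have h0 : 0 < h by rewrite lt_min invr_gt0 ltr0n/= divr_gt0// divr_gt0.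
have h1 : h <= 2^-1 by rewrite ge_min lexx.
have := H h h0 h1; apply/negP; rewrite -ltNge.
apply: (@le_lt_trans _ _ ((`|K| + 1) * (`|a| / (`|K| + 1) / 2))).
  apply: (@le_trans _ _ ((`|K| + 1) * h)).
    by rewrite ler_wpM2r ?(ltW h0)// (le_trans (ler_norm K))// lerDl.
  by rewrite ler_wpM2l ?(ltW K1)// /h ge_min lexx orbT.
rewrite mulrA (mulrC (`|K| + 1)) divfK ?gt_eqF//.
by rewrite ltr_pdivrMr// ltr_pMr// ltr1n.
Qed.

(** Compare the two approximations at equal steps [h] along [i] and [j] and
    let [h] tend to 0. *)
Lemma uschwartz_mixed (f fi fj fij fji : 'rV[R]_n -> R) i j :
  uschwartz (fun _ : unit => fij) -> uschwartz (fun _ : unit => fji) ->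
  (forall y, is_derive y (evec i) f (fi y)) ->
  (forall y, is_derive y (evec j) f (fj y)) ->
  (forall y, is_derive y (evec j) fi (fij y)) ->
  (forall y, is_derive y (evec i) fj (fji y)) -> fij = fji.
Proof.
move=> /uschwartz_lipschitz[C C0 L] /uschwartz_lipschitz[C' C'0 L'] di dj dij dji.
apply/funext => x; apply/eqP; rewrite -subr_eq0; apply/eqP.
apply: (@small_multiple_eq0 _ (n%:R * C *+ 2 + n%:R * C' *+ 2)) => h h0 h1.
have nh : `|h| <= 2^-1 by rewrite gtr0_norm.
have A := mixed_difference C0 nh di dij (L tt x).
have A' := mixed_difference C'0 nh dj dji (L' tt x).
have h2 : 0 < h ^+ 2 by rewrite exprn_gt0.
rewrite -(ler_pM2r h2) -[X in _ * X <= _](gtr0_norm h2) -normrM.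
have -> : (fij x - fji x) * h ^+ 2 =
  (f (x + h *: evec j + h *: evec i) - f (x + h *: evec j)
     - f (x + h *: evec i) + f x - h ^+ 2 * fji x) -
  (f (x + h *: evec i + h *: evec j) - f (x + h *: evec i)
     - f (x + h *: evec j) + f x - h ^+ 2 * fij x).
  rewrite (addrAC x (h *: evec j)); ring.
rewrite (le_trans (ler_normB _ _))// (le_trans (lerD A' A))//.
by rewrite (gtr0_norm h0) le_eqVlt; apply/orP; left; apply/eqP; ring.
Qed.

Lemma uschwartz_derivative (f f' : 'rV[R]_n -> R) i :
  (forall x, is_derive x (evec i) f (f' x)) ->
  uschwartz (fun _ : unit => f) -> uschwartz (fun _ : unit => f').
Proof.
move=> df /(uschwartz_derive i)[F uF dF].
rewrite (_ : (fun _ => f') = F)//; apply/funext => -[]; apply/funext => x.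
by case: (df x) => _ <-; case: (dF tt x).
Qed.

Context {U : Type} (h : U -> R) (h_neq0 : forall u, h u != 0)
  (h_le1 : forall u, `|h u| <= 1).

Lemma uschwartz_shift i (f : 'rV[R]_n -> R) : uschwartz (fun _ : unit => f) ->
  uschwartz (fun u x => f (x - h u *: evec i)).
Proof.
move=> /(uschwartz_reindex (fun _ : U => tt)) uf.
apply: (@uschwartz_translate _ _ U (fun=> f) (fun u => h u *: evec i) 1) => // u j.
by rewrite mxE evecE normrM -[leRHS]mulr1 ler_pM// normr_nat lern1 leq_b1.
Qed.

Lemma shift_bound i (f f' : 'rV[R]_n -> R) (C : R) x u :
  (forall x, is_derive x (evec i) f (f' x)) -> (forall x, `|f' x| <= C) ->
  `|f (x - h u *: evec i) - f x| <= C * `|h u|.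
Proof.
move=> df f'C; rewrite -scaleNr -(normrN (h u)).
by apply: (@line_lipschitz _ _ _ f').
Qed.

(** Multiplication by [x_j] commutes with the difference quotient along [i] up to a
    translate of [f]; this is where the stable class closes. *)
Lemma uschwartz_quotient i (f : 'rV[R]_n -> R) : uschwartz (fun _ : unit => f) ->
  uschwartz (fun u x => (h u)^-1 * (f (x - h u *: evec i) - f x)).
Proof.
move=> uf.
pose B (G : U -> 'rV[R]_n -> R) := exists2 f, uschwartz (fun _ : unit => f) &
  G = (fun u x => (h u)^-1 * (f (x - h u *: evec i) - f x)).
apply: (@uschwartz_upto _ _ _ B); last by apply: span_base; exists f.
move=> {uf}_ [{}f uf ->]; split.
- have [f' uf' df] := uschwartz_derive i uf.
  have [C f'C] := uschwartz_bounded uf'.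
  exists C => u x; rewrite normrM normfV mulrC ler_pdivrMr ?normr_gt0//.
  by apply: (@shift_bound _ _ (f' tt)) => //; exact: (dF tt).
- move=> j; have [f' uf' df] := uschwartz_derive j uf.
  exists (fun u x => (h u)^-1 * (f' tt (x - h u *: evec i) - f' tt x)).
    apply: span_base; exists (f' tt) => //.
    by apply: uschwartz_derivative uf; exact: (df tt).
  move=> u x; apply/is_derive_scale/is_derive_add.
  apply: (@is_derive_affine _ _ _ (fun y => y - h u *: evec i) _ _ _ (evec j)).
  by move=> s; rewrite addrAC.
- move=> j.
  rewrite (_ : (fun _ _ => _) = (fun u (x : 'rV[R]_n) =>
    (h u)^-1 * ((x - h u *: evec i) ord0 j * f (x - h u *: evec i) - x ord0 j * f x) +
    (j == i)%:R * f (x - h u *: evec i))); last first.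
    apply/funext => u; apply/funext => x; rewrite !mxE eqxx/=.
    by field.
  apply: span_add.
    apply: span_base; exists (fun x : 'rV[R]_n => x ord0 j * f x) => //.
    exact: (uschwartz_coord j uf).
  by apply/span_const/span_schwartz/uschwartz_shift.
Qed.

(** Second-order Taylor bound: apply the mean value theorem to
    [f y - f' x * y_i] and then to [f']. *)
Lemma quotient_error_bound i (f f' f'' : 'rV[R]_n -> R) (C : R) x u :
  (forall x, is_derive x (evec i) f (f' x)) ->
  (forall x, is_derive x (evec i) f' (f'' x)) -> (forall x, `|f'' x| <= C) ->
  `|(h u)^-1 * ((h u)^-1 * (f (x - h u *: evec i) - f x) + f' x)| <= C.
Proof.
move=> df df' f''C.
have C0 : 0 <= C by rewrite (le_trans _ (f''C 0)).
pose k (y : 'rV[R]_n) := f y - f' x * y ord0 i.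
have kx : k (x - h u *: evec i) - k x = f (x - h u *: evec i) - f x + h u * f' x.
  by rewrite /k !mxE !eqxx/=; ring.
have : `|k (x - h u *: evec i) - k x| <= C * `|h u| * `|h u|.
  rewrite -scaleNr -(normrN (h u)).
  apply: (@line_lipschitz _ _ _ (fun y => f' y - f' x)) => t th; split.
    apply: (is_derive_eq (is_derive_add (df _)
      (is_deriveN (is_derive_scale _ (is_derive_coord _ _ _))))).
    by rewrite eqxx mulr1.
  apply: (@le_trans _ _ (C * `|t|)); last by rewrite ler_wpM2l.
  by apply: (@line_lipschitz _ _ _ f'').
rewrite kx => B.
have -> : (h u)^-1 * ((h u)^-1 * (f (x - h u *: evec i) - f x) + f' x) =
   (f (x - h u *: evec i) - f x + h u * f' x) / (h u * h u).
  by field.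
by rewrite normrM normfV ler_pdivrMr ?normr_gt0 ?mulf_neq0// normrM mulrA.
Qed.

(** Difference quotients converge to the derivative in the Schwartz topology at a
    linear rate. Since mixed derivatives commute, the partial derivative along [j]
    of the error for [f] is the error for the derivative of [f] along [j]. *)
Lemma uschwartz_quotient_error i (f f' : 'rV[R]_n -> R) :
  uschwartz (fun _ : unit => f) -> (forall x, is_derive x (evec i) f (f' x)) ->
  uschwartz (fun u x =>
    (h u)^-1 * ((h u)^-1 * (f (x - h u *: evec i) - f x) + f' x)).
Proof.
move=> uf df.
pose B (G : U -> 'rV[R]_n -> R) := exists f f', [/\ uschwartz (fun _ : unit => f),
  forall x, is_derive x (evec i) f (f' x) & G = (fun u x =>
    (h u)^-1 * ((h u)^-1 * (f (x - h u *: evec i) - f x) + f' x))].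
apply: (@uschwartz_upto _ _ _ B); last by apply: span_base; exists f, f'.
move=> {uf df f f'}_ [f [f' [uf df ->]]].
have uf' := uschwartz_derivative df uf.
split.
- have [f'' uf'' df'] := uschwartz_derive i uf'.
  have [C f''C] := uschwartz_bounded uf''.
  by exists C => u x; apply: (@quotient_error_bound _ _ _ (f'' tt)).
- move=> j; have [fj ufj dfj] := uschwartz_derive j uf.
  have [f'j uf'j df'j] := uschwartz_derive j uf'.
  have ufjt : uschwartz (fun _ : unit => fj tt).
    by apply: uschwartz_derivative uf; exact: (dfj tt).
  have uf'jt : uschwartz (fun _ : unit => f'j tt).
    by apply: uschwartz_derivative uf'; exact: (df'j tt).
  exists (fun u x => (h u)^-1 *
     ((h u)^-1 * (fj tt (x - h u *: evec i) - fj tt x) + f'j tt x)).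
    apply: span_base; exists (fj tt), (f'j tt); split=> //.
    have [fji ufji dfji] := uschwartz_derive i ufjt.
    have ufjit : uschwartz (fun _ : unit => fji tt).
      by apply: uschwartz_derivative ufjt; exact: (dfji tt).
    by rewrite (uschwartz_mixed uf'jt ufjit df (dfj tt) (df'j tt) (dfji tt)); exact: (dfji tt).
  move=> u x; apply/is_derive_scale/is_derive_add.
  apply/is_derive_scale/is_derive_add.
  apply: (@is_derive_affine _ _ _ (fun y => y - h u *: evec i) _ _ _ (evec j)).
  by move=> s; rewrite addrAC.
- move=> j.
  rewrite (_ : (fun _ _ => _) = (fun u (x : 'rV[R]_n) =>
    (h u)^-1 * ((h u)^-1 *
       ((x - h u *: evec i) ord0 j * f (x - h u *: evec i) - x ord0 j * f x) +
       ((j == i)%:R * f x + x ord0 j * f' x)) +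
    (j == i)%:R * ((h u)^-1 * (f (x - h u *: evec i) - f x)))); last first.
    apply/funext => u; apply/funext => x; rewrite !mxE eqxx/=.
    by field.
  apply: span_add.
    apply: span_base; exists (fun x : 'rV[R]_n => x ord0 j * f x),
      (fun x : 'rV[R]_n => (j == i)%:R * f x + x ord0 j * f' x).
    split=> //; first exact: (uschwartz_coord j uf).
    by move=> x; apply: is_derive_mul => //; exact: is_derive_coord.
  by apply/span_const/span_schwartz/uschwartz_quotient.
Qed.

End difference_quotients.

(** * The short-time Fourier transform as a function of position *)

Section complex_operations.
Context {R : realType} {n : nat}.
Implicit Types (f g : 'rV[R]_n -> R[i]) (sigma : ('rV[R]_n -> R[i]) -> R[i]).

Lemma ReM (z w : R[i]) : complex.Re (z * w) =
  complex.Re z * complex.Re w - complex.Im z * complex.Im w.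
Proof. by case: z w => a b [c e]. Qed.

Lemma ImM (z w : R[i]) : complex.Im (z * w) =
  complex.Re z * complex.Im w + complex.Im z * complex.Re w.
Proof. by case: z w => a b [c e]. Qed.

Lemma ReD (z w : R[i]) : complex.Re (z + w) = complex.Re z + complex.Re w.
Proof. by case: z w => a b [c e]. Qed.

Lemma ImD (z w : R[i]) : complex.Im (z + w) = complex.Im z + complex.Im w.
Proof. by case: z w => a b [c e]. Qed.

Lemma ucschwartz_wave T (F : T -> 'rV[R]_n -> R[i]) (zeta : 'rV[R]_n) :
  ucschwartz F -> ucschwartz (fun t x => cexp2pi (dot zeta x) * F t x).
Proof.
case=> uR uI.
have [cR sR] := uschwartz_wave zeta (fun=> 0) uR.
have [cI sI] := uschwartz_wave zeta (fun=> 0) uI.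
split.
  apply: eq_uschwartz (uschwartz_add cR (uschwartz_opp sI)) => t x.
  by rewrite ReM /= !addr0.
by apply: eq_uschwartz (uschwartz_add cI sR) => t x; rewrite ImM /= !addr0.
Qed.

Lemma ucschwartz_lin T (F G : T -> 'rV[R]_n -> R[i]) (a : R[i]) :
  ucschwartz F -> ucschwartz G -> ucschwartz (fun t x => a * F t x + G t x).
Proof.
case=> FR FI [GR GI]; split.
  apply: eq_uschwartz (uschwartz_add (uschwartz_add
    (uschwartz_const (complex.Re a) FR)
    (uschwartz_opp (uschwartz_const (complex.Im a) FI))) GR) => t x.
  by rewrite ReD ReM.
apply: eq_uschwartz (uschwartz_add (uschwartz_add
  (uschwartz_const (complex.Re a) FI) (uschwartz_const (complex.Im a) FR)) GI) => t x.
by rewrite ImD ImM.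
Qed.

Lemma schwartz_lin f g (a : R[i]) : schwartz f -> schwartz g ->
  schwartz (fun x => a * f x + g x).
Proof. by move=> /schwartzP uf /schwartzP ug; exact/schwartzP/ucschwartz_lin. Qed.

Lemma uschwartz0 T : uschwartz (fun (_ : T) (_ : 'rV[R]_n) => 0 : R).
Proof.
exists (fun F => F = fun _ _ => 0); split=> // _ ->; split.
- by exists 0 => t x; rewrite normr0.
- by move=> i; exists (fun _ _ => 0) => // t x; exact: is_derive_cst.
- by move=> i; apply/funext => t; apply/funext => x; rewrite mulr0.
Qed.

Lemma schwartz0 : schwartz (fun _ : 'rV[R]_n => 0 : R[i]).
Proof. by apply/schwartzP; split; exact: uschwartz0. Qed.

Lemma tempered0 sigma : tempered sigma -> sigma (fun=> 0) = 0.
Proof.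
case=> L _; have := L 1 _ _ schwartz0 schwartz0.
rewrite (_ : (fun x => _) = (fun=> 0)); last by apply/funext => x; rewrite mulr0 addr0.
by rewrite conjc1 mul1r => /esym/eqP; rewrite -subr_eq0 addrK => /eqP.
Qed.

Lemma temperedZ sigma a f : tempered sigma -> schwartz f ->
  sigma (fun x => a * f x) = conjc a * sigma f.
Proof.
move=> ts sf; have := ts.1 a _ _ sf schwartz0; rewrite tempered0// addr0.
by under [X in sigma X = _]eq_fun do rewrite addr0.
Qed.

Lemma schwartzZ a f : schwartz f -> schwartz (fun x => a * f x).
Proof.
move=> sf; have := schwartz_lin a sf schwartz0.
by under [X in schwartz X]eq_fun do rewrite addr0.
Qed.

Lemma tempered_real3 sigma (a b c : R) f g k : tempered sigma ->
  schwartz f -> schwartz g -> schwartz k ->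
  sigma (fun x => a%:C * f x + (b%:C * g x + c%:C * k x))%C =
  (a%:C * sigma f + (b%:C * sigma g + c%:C * sigma k))%C.
Proof.
move=> ts sf sg sk.
have sck := schwartzZ c%:C%C sk.
rewrite ts.1//; last exact: schwartz_lin.
by rewrite ts.1// temperedZ// !conjc_real.
Qed.

Lemma is_derive_quotient (f : 'rV[R]_n -> R) x v (l C : R) :
  (forall h : R, h != 0 -> `|h| <= 1 ->
    `|h^-1 * (f (x + h *: v) - f x) - l| <= C * `|h|) ->
  is_derive x v f l.
Proof.
move=> H.
have K : h^-1 *: ((f \o shift x) (h *: v) - f x) @[h --> (0 : R)^'] --> l.
  apply/cvgrPdist_le => e e0.
  have M0 : 0 < `|C| + 1 by rewrite ltr_wpDl.
  near=> h.
  have h0 : h != 0 by near: h; exact: nbhs_dnbhs_neq.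
  have h1 : `|h| <= Num.min 1 (e / (`|C| + 1)).
    near: h; apply: dnbhs0_le; rewrite lt_min ltr01 divr_gt0//.
  move: h1; rewrite le_min => /andP[h1 he].
  rewrite distrC /= (addrC _ x) (le_trans (H h h0 h1))//.
  apply: (@le_trans _ _ ((`|C| + 1) * `|h|)).
    by rewrite ler_wpM2r// (le_trans (ler_norm C))// lerDl.
  apply: (@le_trans _ _ ((`|C| + 1) * (e / (`|C| + 1)))).
    by rewrite ler_wpM2l// ltW.
  by rewrite mulrC divfK ?gt_eqF.
by split; [apply/cvg_ex; exists l|exact/cvg_lim].
Unshelve. all: by end_near. Qed.

End complex_operations.

Section stft_regularity.
Context {R : realType} {n : nat}.
Implicit Types (f g G : 'rV[R]_n -> R[i]) (sigma : ('rV[R]_n -> R[i]) -> R[i]).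
Implicit Types (z zeta : 'rV[R]_n).

Lemma tfshift_row z zeta G :
  tfshift (row_mx z zeta) G = fun t => cexp2pi (dot zeta t) * G (t - z).
Proof. by apply/funext => t; rewrite /tfshift row_mxKl row_mxKr. Qed.

Lemma ucschwartz_translate T (z : T -> 'rV[R]_n) M G :
  (forall t j, `|z t ord0 j| <= M) -> schwartz G ->
  ucschwartz (fun t x => G (x - z t)).
Proof.
move=> zM /schwartzP[uR uI].
split; first exact: (uschwartz_translate zM (uschwartz_reindex (fun=> tt) uR)).
exact: (uschwartz_translate zM (uschwartz_reindex (fun=> tt) uI)).
Qed.

Lemma coord_bounded z : exists M : R, forall j, `|z ord0 j| <= M.
Proof.
exists (\sum_j `|z ord0 j|) => j.
by rewrite (bigD1 j)//= lerDl sumr_ge0.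
Qed.

Lemma schwartz_translate z G : schwartz G -> schwartz (fun x => G (x - z)).
Proof.
move=> sG; have [M zM] := coord_bounded z.
by apply/schwartzP; exact: (@ucschwartz_translate unit (fun=> z) M).
Qed.

Lemma schwartz_wave zeta G : schwartz G ->
  schwartz (fun x => cexp2pi (dot zeta x) * G x).
Proof. by move=> /schwartzP uG; exact/schwartzP/ucschwartz_wave. Qed.

Lemma schwartz_tfshift (w : 'rV[R]_(n + n)) G : schwartz G -> schwartz (tfshift w G).
Proof. by move=> sG; apply: schwartz_wave; exact: schwartz_translate. Qed.

(** The windows translated by a bounded set form a uniformly Schwartz family. *)
Lemma stft_locally_bounded sigma G zeta (M : R) : tempered sigma -> schwartz G ->
  exists C : R, forall z, (forall j, `|z ord0 j| <= M) ->
    Normc.normc (stft G sigma z zeta) <= C.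
Proof.
move=> ts sG.
pose T := {z : 'rV[R]_n | forall j, `|z ord0 j| <= M}.
have u1 := @ucschwartz_translate T sval M G (fun t => svalP t) sG.
have [C sC] := tempered_bounded ts (ucschwartz_wave zeta u1).
by exists C => z zM; rewrite /stft tfshift_row; exact: (sC (exist _ z zM)).
Qed.

Definition cpartial i G : 'rV[R]_n -> R[i] := cpderiv [:: i] G.

Lemma schwartz_is_derive i G x : schwartz G ->
  is_derive x (evec i) (fun y => complex.Re (G y)) (complex.Re (cpartial i G x)) /\
  is_derive x (evec i) (fun y => complex.Im (G y)) (complex.Im (cpartial i G x)).
Proof.
case=> sR sI _; split; apply: derivableP.
  by have [_ /(_ i x)] := sR [::].
by have [_ /(_ i x)] := sI [::].
Qed.

Lemma schwartz_cpartial i G : schwartz G -> schwartz (cpartial i G).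
Proof.
move=> sG; have /schwartzP[uR uI] := sG; apply/schwartzP; split.
  by apply: uschwartz_derivative uR => x; exact: (schwartz_is_derive i x sG).1.
by apply: uschwartz_derivative uI => x; exact: (schwartz_is_derive i x sG).2.
Qed.

(** The error of the difference quotient, written as a linear combination of three
    windows to which a distribution can be applied term by term. *)
Lemma ucschwartz_quotient_error (T : Type) (h : T -> R) z i G :
  (forall t, h t != 0) -> (forall t, `|h t| <= 1) -> schwartz G ->
  ucschwartz (fun t x =>
    ((h t)^-1 ^+ 2)%:C%C * G (x - (z + h t *: evec i)) +
    ((- ((h t)^-1 ^+ 2))%:C%C * G (x - z) + (h t)^-1%:C%C * cpartial i G (x - z))).
Proof.
move=> h0 h1 sG.
have d x := schwartz_is_derive i (x - z) sG.
have tr (x : 'rV[R]_n) (s : R) : x + s *: evec i - z = x - z + s *: evec i.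
  by rewrite addrAC.
have /schwartzP[uR uI] := schwartz_translate z sG.
split.
  have dR x : is_derive x (evec i) (fun y => complex.Re (G (y - z)))
      (complex.Re (cpartial i G (x - z))).
    apply: (@is_derive_affine _ _ _ (fun y => y - z) _ _ _ _ _ _ (d x).1).
    exact: tr.
  apply: eq_uschwartz (uschwartz_quotient_error h0 h1 uR dR) => t x.
  rewrite !(ReD, ReM)/= (_ : x - (z + _) = x - h t *: evec i - z); [ring|by rewrite opprD addrA addrAC].
have dI x : is_derive x (evec i) (fun y => complex.Im (G (y - z)))
    (complex.Im (cpartial i G (x - z))).
  apply: (@is_derive_affine _ _ _ (fun y => y - z) _ _ _ _ _ _ (d x).2).
  exact: tr.
apply: eq_uschwartz (uschwartz_quotient_error h0 h1 uI dI) => t x.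
rewrite !(ImD, ImM)/= (_ : x - (z + _) = x - h t *: evec i - z); [ring|by rewrite opprD addrA addrAC].
Qed.

(** Differentiating in the position variable amounts to differentiating the
    window, because the translates of a Schwartz function depend smoothly on
    the translation in the Schwartz topology. *)
Lemma stft_is_derive sigma G zeta z i : tempered sigma -> schwartz G ->
  is_derive z (evec i) (fun y => complex.Re (stft G sigma y zeta))
    (- complex.Re (stft (cpartial i G) sigma z zeta)) /\
  is_derive z (evec i) (fun y => complex.Im (stft G sigma y zeta))
    (- complex.Im (stft (cpartial i G) sigma z zeta)).
Proof.
move=> ts sG.
pose T := {h : R | h != 0 /\ `|h| <= 1}.
have u1 := @ucschwartz_quotient_error T sval z i G (fun t => (svalP t).1)
  (fun t => (svalP t).2) sG.
have [C sC] := tempered_bounded ts (ucschwartz_wave zeta u1).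
pose u := stft G sigma ^~ zeta; pose u' := stft (cpartial i G) sigma z zeta.
have key (h : R) : h != 0 -> `|h| <= 1 ->
  Normc.normc ((h^-1 ^+ 2)%:C%C * u (z + h *: evec i) +
    ((- (h^-1 ^+ 2))%:C%C * u z + h^-1%:C%C * u')) <= C.
  move=> h0 h1.
  have := sC (exist _ h (conj h0 h1)); rewrite /= /u /u' /stft !tfshift_row.
  rewrite -tempered_real3//; last 3 first.
  - by rewrite -tfshift_row; exact: schwartz_tfshift.
  - by rewrite -tfshift_row; exact: schwartz_tfshift.
  - by rewrite -tfshift_row; exact/schwartz_tfshift/schwartz_cpartial.
  move=> H; apply: le_trans H; rewrite le_eqVlt; apply/orP; left; apply/eqP.
  congr (Normc.normc (sigma _)); apply/funext => x.
  by rewrite !mulrDr !(mulrCA (cexp2pi _)).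
have fin (a b c h : R) : h != 0 ->
    `|h^-1 ^+ 2 * a + (- (h^-1 ^+ 2) * b + h^-1 * c)| <= C ->
    `|h^-1 * (a - b) - - c| <= C * `|h|.
  move=> h0; rewrite -ler_pdivrMr ?normr_gt0// -normfV -normrM.
  by rewrite (_ : (_ - - _) / h = h^-1 ^+ 2 * a + (- (h^-1 ^+ 2) * b + h^-1 * c))//; field.
split; apply: (@is_derive_quotient _ _ _ _ _ _ C) => h h0 h1; apply: fin => //.
  apply: le_trans (key h h0 h1); apply: le_trans (normr_Re_le _).
  by rewrite !(ReD, ReM)/= !mul0r !subr0.
apply: le_trans (key h h0 h1); apply: le_trans (normr_Im_le _).
by rewrite !(ImD, ImM)/= !mul0r !addr0.
Qed.

Lemma stft_continuous sigma G zeta : tempered sigma -> schwartz G ->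
  continuous (fun z => complex.Re (stft G sigma z zeta)) /\
  continuous (fun z => complex.Im (stft G sigma z zeta)).
Proof.
move=> ts sG.
have H z : exists C : R, forall i (y : 'rV[R]_n), (forall j, `|y ord0 j - z ord0 j| <= 1) ->
    Normc.normc (stft (cpartial i G) sigma y zeta) <= C.
  have [M zM] := coord_bounded z.
  have /choice[C CP] : forall i, exists C : R, forall y : 'rV[R]_n,
      (forall j, `|y ord0 j| <= M + 1) ->
      Normc.normc (stft (cpartial i G) sigma y zeta) <= C.
    by move=> i; apply: stft_locally_bounded => //; exact: schwartz_cpartial.
  exists (\sum_i `|C i|) => i y yz.
  apply: (@le_trans _ _ (C i)).
    apply: CP => j; rewrite -(subrK (z ord0 j) (y ord0 j)) addrC.
    by rewrite (le_trans (ler_normD _ _))// lerD.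
  by rewrite (le_trans (ler_norm _))// (bigD1 i)//= lerDl sumr_ge0.
split=> z; have [C HC] := H z.
  apply: (@continuous_partial _ _ _
    (fun i y => - complex.Re (stft (cpartial i G) sigma y zeta)) _ C) => i y yz.
  split; first exact: (stft_is_derive zeta y i ts sG).1.
  by rewrite normrN (le_trans (normr_Re_le _))// HC.
apply: (@continuous_partial _ _ _
    (fun i y => - complex.Im (stft (cpartial i G) sigma y zeta)) _ C) => i y yz.
split; first exact: (stft_is_derive zeta y i ts sG).2.
by rewrite normrN (le_trans (normr_Im_le _))// HC.
Qed.

End stft_regularity.

(** * Lebesgue measure on R^n *)

Section measurability.
Context {R : realType} {n : nat}.

Lemma rat_approx (x e : R) : 0 < e -> exists q : rat, `|x - ratr q| < e.
Proof.
move=> e0; have /rat_in_itvoo[q] : x - e < x + e by rewrite ltrBlDr -addrA ltrDl addr_gt0.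
rewrite in_itv/= => /andP[xq qx]; exists q.
by rewrite ltr_norml ltrBrDr ltrBlDr; apply/andP; split; lra.
Qed.

(** An open set is the countable union of the cubes of rational centre and inverse
    integral half-width which it contains. *)
Lemma open_measurable_rV (A : set 'rV[R]_n) : open A -> measurable A.
Proof.
move=> oA.
pose box (p : 'rV[rat]_n * nat) := [set x : 'rV[R]_n |
  forall i, `|x ord0 i - ratr (p.1 ord0 i)| < p.2.+1%:R^-1].
pose F p := [set x | box p `<=` A /\ box p x].
have mbox p : measurable (box p).
  rewrite (_ : box p = \bigcap_(i in [set: 'I_n]) (@rV_coord R n i @^-1`
    [set r | `|r - ratr (p.1 ord0 i)| < p.2.+1%:R^-1])); last first.
    by apply/seteqP; split=> x /= H i; have := H i; [|exact].
  apply: fin_bigcap_measurable; first exact: finite_finset.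
  move=> i _; rewrite -[X in measurable X]setTI; apply: measurable_rV_coord => //.
  rewrite (_ : mkset _ = ball (ratr (p.1 ord0 i) : R) p.2.+1%:R^-1).
    exact: measurable_ball.
  by apply/seteqP; split=> r /=; rewrite /ball/= distrC.
have -> : A = \bigcup_p F p.
  apply/seteqP; split=> [x Ax|x [p _ [pA px]]]; last exact: pA.
  have /nbhs_ballP[e /= e0 xA] : nbhs x A by exact: open_nbhs_nbhs.
  have [k ke] : exists k : nat, k.+1%:R^-1 < e / 2.
    have e2 : 0 < e / 2 by rewrite divr_gt0.
    have [N _ H] := near_infty_natSinv_lt (PosNum e2).
    by exists N; exact: (H N (leqnn N)).
  have k0 : 0 < k.+1%:R^-1 :> R by rewrite invr_gt0.
  have /choice[q qP] := fun i => rat_approx (x ord0 i) k0.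
  exists (\row_i q i, k) => //; split; last by move=> i /=; rewrite mxE.
  move=> y /= yq; apply: xA; split=> // i j; rewrite (ord1 i) /ball/=.
  have := yq j; have := qP j; rewrite mxE => a b.
  rewrite -(subrK (ratr (q j)) (x ord0 j)) -addrA.
  rewrite (le_lt_trans (ler_normD _ _))// (splitr e) ltrD//.
    exact: lt_trans ke.
  by rewrite distrC; exact: lt_trans ke.
apply: countable_bigcupT_measurable; first exact: countableP.
move=> p; have [pA|pA] := pselect (box p `<=` A).
  rewrite (_ : F p = box p)//; by apply/seteqP; split=> [x []|x].
by rewrite (_ : F p = set0)//; apply/seteqP; split=> [x []|x].
Qed.

Lemma continuous_measurable_rV (f : 'rV[R]_n -> R) :
  continuous f -> measurable_fun setT f.
Proof.
move=> cf; apply: (measurability _ (RGenOpens.measurableE R)) => //.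
move=> _ [_ [a [b ->] <-]]; rewrite setTI; apply: open_measurable_rV.
by move/continuousP : cf; apply; exact: interval_open.
Qed.

Lemma lsc_measurable_rV (f : 'rV[R]_n -> \bar R) :
  (forall a : R, open [set x | (a%:E < f x)%E]) -> measurable_fun setT f.
Proof.
move=> of_; apply: (measurability _ (ErealGenOInfty.measurableE R)) => //.
move=> _ [_ [a ->] <-]; rewrite setTI; apply: open_measurable_rV.
by rewrite preimage_itvoy; exact: of_.
Qed.

(** Tonelli's theorem for the first coordinate. *)
Lemma ge0_integral_rV_succ (f : 'rV[R]_n.+1 -> \bar R) :
  measurable_fun setT f -> (forall x, (0 <= f x)%E) ->
  (\int[lebesgue_rV R n.+1]_x f x =
   \int[@lebesgue_measure R]_a \int[lebesgue_rV R n]_y f (rV_cons (a, y)))%E.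
Proof.
move=> mf f0.
have mc := @measurable_rV_cons R n.
rewrite (@eq_measure_integral _ _ _ setT (pushforward (@lebesgue_measure R \x lebesgue_rV R n)%E (@rV_cons R n))); last by [].
rewrite ge0_integral_pushforward//.
rewrite preimage_setT fubini_tonelli1//; first exact: measurableT_comp.
by move=> x; exact: f0.
Qed.

Lemma measurable_integral_rV (f : 'rV[R]_n.+1 -> \bar R) :
  measurable_fun setT f -> (forall x, (0 <= f x)%E) ->
  measurable_fun setT (fun a : R => \int[lebesgue_rV R n]_y f (rV_cons (a, y)))%E.
Proof.
move=> mf f0.
apply: (@measurable_fun_fubini_tonelli_F _ _ _ _ _ _ (f \o @rV_cons R n)).
  by apply: measurableT_comp => //; exact: measurable_rV_cons.
by move=> x; exact: f0.
Qed.

End measurability.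

(** * Pointwise finiteness from integrability *)

Section finiteness.
Context {R : realType}.
Local Open Scope ereal_scope.

Definition update (n : nat) (x : 'rV[R]_n) (i : 'I_n) (a : R) : 'rV[R]_n :=
  \row_j if j == i then a else x ord0 j.

Lemma measurable_update n (x : 'rV[R]_n) i : measurable_fun setT (update x i).
Proof.
apply: measurable_rV => j; rewrite /rV_coord/=.
under eq_fun do rewrite mxE.
by case: (j == i); [exact: measurable_id|exact: measurable_cst].
Qed.

Lemma rV_consE0 n (a : R) (y : 'rV[R]_n) : rV_cons (a, y) ord0 ord0 = a.
Proof. by have /(congr1 fst) := rV_consK (a, y). Qed.

Lemma rV_consES n (a : R) (y : 'rV[R]_n) i : rV_cons (a, y) ord0 (lift ord0 i) = y ord0 i.
Proof.
rewrite /rV_cons (_ : lift ord0 i = rshift 1 i); last exact/val_inj.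
by rewrite (row_mxEr (a%:M : 'rV[R]_1)).
Qed.

Lemma rV_uncons_eq n (x : 'rV[R]_n.+1) : exists a y, x = rV_cons (a, y).
Proof.
exists (x ord0 ord0), (\row_i x ord0 (lift ord0 i)).
apply/rowP => j; case: (unliftP ord0 j) => [k|] ->.
  by rewrite rV_consES mxE.
by rewrite rV_consE0.
Qed.

Lemma update_cons0 n (a b : R) (y : 'rV[R]_n) :
  update (rV_cons (a, y)) ord0 b = rV_cons (b, y).
Proof.
apply/rowP => j; rewrite mxE; case: (unliftP ord0 j) => [k|] ->.
  by rewrite eq_sym (negbTE (neq_lift _ _)) !rV_consES.
by rewrite eqxx rV_consE0.
Qed.

Lemma update_consS n (a b : R) (y : 'rV[R]_n) i :
  update (rV_cons (a, y)) (lift ord0 i) b = rV_cons (a, update y i b).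
Proof.
apply/rowP => j; rewrite mxE; case: (unliftP ord0 j) => [k|] ->.
  by rewrite !rV_consES mxE (inj_eq lift_inj).
by rewrite (negbTE (neq_lift _ _)) !rV_consE0.
Qed.

(** A Sobolev-type embedding of W^{n,1} into bounded functions, for a family
    [F] closed under abstract partial derivatives [D]: a pointwise bound by
    one-dimensional integrals in each direction is integrated out one
    coordinate at a time. *)
Lemma finite_everywhere (S : Type) n (F : S -> 'rV[R]_n -> \bar R)
    (D : 'I_n -> S -> S) :
  (forall s, measurable_fun setT (F s)) -> (forall s x, 0 <= F s x) ->
  (forall i s x, F s x <= 2%:E *
    (\int[@lebesgue_measure R]_a F s (update x i a) +
     \int[@lebesgue_measure R]_a F (D i s) (update x i a))) ->
  (forall s, \int[lebesgue_rV R n]_x F s x < +oo) ->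
  forall s x, F s x < +oo.
Proof.
elim: n F D => [F D mF F0 _ iF s x|n IH F D mF F0 FD iF s x].
  have := iF s; rewrite /= integral_dirac// diracT mul1e.
  by rewrite (_ : 0%R = x)//; apply/rowP => -[].
have [a [y ->]] := rV_uncons_eq x.
apply: (IH (fun s y => F s (rV_cons (a, y))) (fun i => D (lift ord0 i))) => //.
- move=> {}s; apply: measurableT_comp => //.
  apply: measurableT_comp; first exact: measurable_rV_cons.
  exact: measurable_pair1.
- by move=> i {}s {}y; rewrite (le_trans (FD (lift ord0 i) s _))//;
    under eq_integral do rewrite update_consS;
    under [X in _ + X]eq_integral do rewrite update_consS.
- move=> {}s.
  have mFc t : measurable_fun setT (fun p : R * 'rV[R]_n => F t (rV_cons p)).
    by apply: measurableT_comp => //; exact: measurable_rV_cons.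
  have mG t : measurable_fun setT
      (fun y : 'rV[R]_n => \int[@lebesgue_measure R]_a F t (rV_cons (a, y))).
    exact: (@measurable_fun_fubini_tonelli_G _ _ _ _ _ (@lebesgue_measure R)
      (fun p => F t (rV_cons p)) (mFc t) (fun p => F0 t _)).
  have G0 t (z : 'rV[R]_n) : 0 <= \int[@lebesgue_measure R]_a F t (rV_cons (a, z)).
    exact: integral_ge0.
  apply: (@le_lt_trans _ _ (\int[lebesgue_rV R n]_y (2%:E *
      (\int[@lebesgue_measure R]_a F s (rV_cons (a, y)) +
       \int[@lebesgue_measure R]_a F (D ord0 s) (rV_cons (a, y)))))).
    apply: ge0_le_integral => //.
    - apply: measurableT_comp => //.
      apply: measurableT_comp; first exact: measurable_rV_cons.
      exact: measurable_pair1.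
    - by apply: measurable_funeM; exact: emeasurable_funD.
    move=> z _; rewrite (le_trans (FD ord0 s _))//.
    by under eq_integral do rewrite update_cons0;
      under [X in _ + X]eq_integral do rewrite update_cons0.
  rewrite ge0_integralZl//; last first.
  - by move=> z _; rewrite adde_ge0.
  - exact: emeasurable_funD.
  rewrite ge0_integralD//.
  have E t : \int[lebesgue_rV R n]_y \int[@lebesgue_measure R]_a F t (rV_cons (a, y)) < +oo.
    have := iF t; rewrite ge0_integral_rV_succ//.
    by rewrite (@fubini_tonelli _ _ _ _ _ (@lebesgue_measure R) (lebesgue_rV R n)
      (fun p => F t (rV_cons p)) (mFc t) (fun p => F0 t _)).
  by rewrite lte_mul_pinfty// lte_add_pinfty.
Qed.

End finiteness.

Section one_dimensional.
Context {R : realType}.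

(** The value at [b] is the boundary term of the integral of the derivative of
    [(b + 1 - a) * h a] over [a] between [b] and [b + 1]. *)
Lemma value_le_integral (h h' : R -> R) b :
  (forall a : R, is_derive a 1 h (h' a)) -> continuous h' ->
  (`|h b|%:E <= \int[@lebesgue_measure R]_(a in `[b, (b + 1)%R]) `|h a|%:E +
    \int[@lebesgue_measure R]_(a in `[b, (b + 1)%R]) `|h' a|%:E)%E.
Proof.
move=> dh ch'.
have ch : continuous h.
  by move=> a; apply/differentiable_continuous/derivable1_diffP; case: (dh a).
pose phi a := ((b + 1 - a) * h a)%R.
pose phi' a := ((b + 1 - a) * h' a - h a)%R.
have dphi (a : R) : is_derive a 1 phi (phi' a).
  have d1 := is_derive_add (is_derive_cst (b + 1)%R a 1) (is_deriveN (is_derive_id a 1)).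
  apply: (is_derive_eq (is_derive_mul d1 (dh a))).
  by rewrite /phi' add0r mulN1r addrC.
have cphi : continuous phi.
  by move=> a; apply/differentiable_continuous/derivable1_diffP; case: (dphi a).
have cphi' : continuous phi'.
  move=> a; apply: cvgB; last exact: ch.
  apply: cvgM; last exact: ch'.
  by apply: cvgB; [exact: cvg_cst|exact: cvg_id].
have b1 : (b < b + 1)%R by rewrite ltrDl.
have FTC : (\int[@lebesgue_measure R]_(a in `[b, (b + 1)%R]) (phi' a)%:E = (- h b)%:E)%E.
  rewrite (@continuous_FTC2 _ phi' phi)//.
  - have -> : phi b = h b by rewrite /phi addrAC subrr add0r mul1r.
    by rewrite /phi subrr mul0r sub0e.
  - exact: continuous_subspaceT.
  - split.
    + by move=> a _; case: (dphi a).
    + exact/cvg_at_right_filter/cphi.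
    + exact/cvg_at_left_filter/cphi.
  - by move=> a _; rewrite derive1E; case: (dphi a).
have mE (g : R -> R) : continuous g -> measurable_fun `[b, (b + 1)%R] (EFin \o g).
  move=> cg; apply/measurable_EFinP/measurable_funTS; apply: continuous_measurable_fun.
  exact: cg.
have mN (g : R -> R) : continuous g ->
    measurable_fun `[b, (b + 1)%R] (fun a => `|g a|%:E).
  move=> cg; apply/measurable_EFinP; apply: measurableT_comp => //.
  apply/measurable_funTS; apply: continuous_measurable_fun.
  exact: cg.
have -> : (`|h b|%:E = `| \int[@lebesgue_measure R]_(a in `[b, (b + 1)%R]) (phi' a)%:E |)%E.
  by rewrite FTC/= normrN.
apply: (le_trans (le_abse_integral _ _ _)) => //; first exact: mE.
rewrite -ge0_integralD//; last 2 first.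
- exact: mN.
- exact: mN.
apply: ge0_le_integral => //.
- by apply: measurableT_comp => //; exact: mE.
- apply: emeasurable_funD.
  + exact: mN.
  + exact: mN.
move=> a; rewrite /= in_itv/= => /andP[ba ab].
rewrite -EFinD lee_fin /phi' (le_trans (ler_normB _ _))// addrC lerD2l normrM.
rewrite ger0_norm ?subr_ge0// -[leRHS]mul1r ler_wpM2r//.
by rewrite lerBlDr addrC lerD2l.
Qed.

End one_dimensional.

Section stft_sup.
Context {R : realType} {n : nat}.
Implicit Types (G : 'rV[R]_n -> R[i]) (sigma : ('rV[R]_n -> R[i]) -> R[i]).
Implicit Types (z zeta : 'rV[R]_n).

(** This is the norm in FL^oo of the localization of [sigma] by [G] at [z]. *)
Definition stft_sup G sigma z : \bar R :=
  ereal_sup (range (fun zeta => (Normc.normc (stft G sigma z zeta))%:E)).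

Lemma stft_sup_ub G sigma z zeta :
  ((Normc.normc (stft G sigma z zeta))%:E <= stft_sup G sigma z)%E.
Proof. by apply: ereal_sup_ubound; exists zeta. Qed.

Lemma normc_ge0 (w : R[i]) : 0 <= Normc.normc w.
Proof. exact: le_trans (normr_Re_le w). Qed.

Lemma stft_sup_ge0 G sigma z : (0 <= stft_sup G sigma z)%E.
Proof. by apply: le_trans (stft_sup_ub G sigma z 0); rewrite lee_fin normc_ge0. Qed.

(** A supremum of continuous functions, over whatever index set, is lower
    semicontinuous. *)
Lemma measurable_stft_sup G sigma : tempered sigma -> schwartz G ->
  measurable_fun setT (stft_sup G sigma).
Proof.
move=> ts sG; apply: lsc_measurable_rV => a.
have -> : [set z | (a%:E < stft_sup G sigma z)%E] =
  \bigcup_zeta [set z | a < Normc.normc (stft G sigma z zeta)].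
  apply/seteqP; split=> [z /ereal_sup_gt[_ [zeta _ <-]]|z [zeta _ /=]].
    by rewrite lte_fin => az; exists zeta.
  by rewrite -lte_fin => /lt_le_trans; apply; exact: stft_sup_ub.
apply: bigcup_open => zeta _.
have [cR cI] := stft_continuous zeta ts sG.
have cN : continuous (fun z => Normc.normc (stft G sigma z zeta)).
  rewrite (_ : (fun _ => _) = (fun z => Num.sqrt
    (complex.Re (stft G sigma z zeta) * complex.Re (stft G sigma z zeta) +
     complex.Im (stft G sigma z zeta) * complex.Im (stft G sigma z zeta)))).
    move=> z; apply: (@continuous_comp _ _ _ (fun z =>
      complex.Re (stft G sigma z zeta) * complex.Re (stft G sigma z zeta) +
      complex.Im (stft G sigma z zeta) * complex.Im (stft G sigma z zeta)) Num.sqrt z);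
      last exact: sqrt_continuous.
    exact: (cvgD (cvgM (cR z) (cR z)) (cvgM (cI z) (cI z))).
  by apply/funext => z; case: (stft G sigma z zeta) => x y /=; rewrite !expr2.
rewrite -[mkset _]/((fun z => Normc.normc (stft G sigma z zeta)) @^-1` [set x | a < x]).
by move/continuousP : cN; apply; exact: open_gt.
Qed.

Lemma updateE z i (a : R) : update z i a = z + (a - z ord0 i) *: evec i.
Proof.
apply/rowP => j; rewrite !mxE eqxx/=; case: eqP => [->|_].
  by rewrite mulr1 addrC subrK.
by rewrite mulr0 addr0.
Qed.

(** For fixed [zeta] the real and the imaginary part of the short-time Fourier
    transform are C^1 on the line through [z] in the direction [i], with derivative
    given by the window [cpartial i G]; then [value_le_integral] applies. *)
Lemma stft_sup_le_integral G sigma i z : tempered sigma -> schwartz G ->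
  (stft_sup G sigma z <= 2%:E *
    (\int[@lebesgue_measure R]_a stft_sup G sigma (update z i a) +
     \int[@lebesgue_measure R]_a stft_sup (cpartial i G) sigma (update z i a)))%E.
Proof.
move=> ts sG; have sG' := schwartz_cpartial i sG.
apply: ge_ereal_sup => _ [zeta _ <-].
pose J := (\int[@lebesgue_measure R]_a stft_sup G sigma (update z i a) +
     \int[@lebesgue_measure R]_a stft_sup (cpartial i G) sigma (update z i a))%E.
pose shift_i (a : R) := a - z ord0 i.
have mS F : schwartz F -> measurable_fun setT (fun a => stft_sup F sigma (update z i a)).
  move=> sF; apply: measurableT_comp; first exact: measurable_stft_sup.
  exact: measurable_update.
have le_int (part : R[i] -> R) F : schwartz F ->
    continuous (fun a => part (stft F sigma (update z i a) zeta)) ->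
    (forall w, `|part w| <= Normc.normc w) -> forall b,
    (\int[@lebesgue_measure R]_(a in `[b, (b + 1)%R])
       `|part (stft F sigma (update z i a) zeta)|%:E <=
     \int[@lebesgue_measure R]_a stft_sup F sigma (update z i a))%E.
  move=> sF cF pn b.
  apply: (@le_trans _ _ (\int[@lebesgue_measure R]_(a in `[b, (b + 1)%R])
     stft_sup F sigma (update z i a))%E).
    apply: ge0_le_integral => //.
    - apply/measurable_EFinP; apply: measurableT_comp => //.
      by apply: measurable_funTS; apply: continuous_measurable_fun; exact: cF.
    - by apply: measurable_funTS; exact: mS.
    move=> a _; apply: le_trans (stft_sup_ub _ _ _ zeta).
    by rewrite lee_fin.
  apply: ge0_subset_integral => //; first exact: mS.
  by move=> a _; exact: stft_sup_ge0.
have updz : update z i (z ord0 i) = z by rewrite updateE subrr scale0r addr0.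
have cu : continuous (update z i).
  rewrite (_ : update z i = fun a => z + (a - z ord0 i) *: evec i).
    move=> a; apply: cvgD; first exact: cvg_cst.
    by apply: cvgZr_tmp; apply: cvgB; [exact: cvg_id|exact: cvg_cst].
  by apply/funext => a; rewrite updateE.
have cup (f : 'rV[R]_n -> R) : continuous f -> continuous (fun a => f (update z i a)).
  by move=> cf a; exact: (@continuous_comp _ _ _ (update z i) f a (cu a) (cf _)).
have bound (part : R[i] -> R) :
    (forall w, `|part w| <= Normc.normc w) ->
    (forall F, schwartz F -> continuous (fun z => part (stft F sigma z zeta))) ->
    (forall y, is_derive y (evec i) (fun y => part (stft G sigma y zeta))
      (- part (stft (cpartial i G) sigma y zeta))) ->
    (`|part (stft G sigma z zeta)|%:E <= J)%E.
  move=> pn pc pd.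
  pose h a := part (stft G sigma (update z i a) zeta).
  pose h' a := - part (stft (cpartial i G) sigma (update z i a) zeta).
  have dh (a : R) : is_derive a 1 h (h' a).
    have E : h = (fun a => part (stft G sigma (z - z ord0 i *: evec i + a *: evec i) zeta)).
      apply/funext => b; rewrite /h updateE scalerBl (addrC (b *: _)) addrA//.
    rewrite E; apply: (@is_derive_line _ _ (fun y => part (stft G sigma y zeta))); rewrite /h'.
    rewrite (_ : update z i a = z - z ord0 i *: evec i + a *: evec i); last first.
      by rewrite updateE scalerBl (addrC (a *: _)) addrA.
    exact: pd.
  have ch' : continuous h'.
    move=> a; apply: cvgN.
    by apply: (cup (fun y => part (stft (cpartial i G) sigma y zeta))); exact: pc.
  have := value_le_integral (z ord0 i) dh ch'.
  rewrite /h updz => /le_trans; apply; apply: leeD.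
    apply: le_int => //.
    by apply: (cup (fun y => part (stft G sigma y zeta))); exact: pc.
  under eq_integral do rewrite normrN.
  apply: le_int => //.
  by apply: (cup (fun y => part (stft (cpartial i G) sigma y zeta))); exact: pc.
have bR : (`|complex.Re (stft G sigma z zeta)|%:E <= J)%E.
  apply: bound; first exact: normr_Re_le.
    by move=> F sF; exact: (stft_continuous zeta ts sF).1.
  by move=> y; exact: (stft_is_derive zeta y i ts sG).1.
have bI : (`|complex.Im (stft G sigma z zeta)|%:E <= J)%E.
  apply: bound; first exact: normr_Im_le.
    by move=> F sF; exact: (stft_continuous zeta ts sF).2.
  by move=> y; exact: (stft_is_derive zeta y i ts sG).2.
apply: (@le_trans _ _ (J + J)%E).
  apply: le_trans (leeD bR bI).
  by rewrite -EFinD lee_fin normc_le.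
by rewrite -/J mule_natl.
Qed.

Lemma stft_sup_finite sigma : tempered sigma ->
  (forall G, schwartz G -> (\int[lebesgue_rV R n]_z stft_sup G sigma z < +oo)%E) ->
  forall G z, schwartz G -> (stft_sup G sigma z < +oo)%E.
Proof.
move=> ts iS G z sG.
pose S := {G : 'rV[R]_n -> R[i] | schwartz G}.
pose F (s : S) := stft_sup (sval s) sigma.
pose D i (s : S) : S := exist _ (cpartial i (sval s)) (schwartz_cpartial i (svalP s)).
apply: (@finite_everywhere R S n F D _ _ _ _ (exist _ G sG)).
- by move=> s; apply: measurable_stft_sup => //; exact: svalP.
- by move=> s x; exact: stft_sup_ge0.
- by move=> i s x; apply: stft_sup_le_integral => //; exact: svalP.
- by move=> s; apply: iS; exact: svalP.
Qed.

End stft_sup.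

Section admissible_weights.
Context {R : realType} {n : nat}.
Implicit Types (v : 'rV[R]_n -> R).

Lemma admissible_opp v z : admissible v -> v (- z) = v z.
Proof.
move=> av.
pose flips (s : seq 'I_n) (y : 'rV[R]_n) := foldr (@flip_coord R n) y s.
have flipsE s y j : uniq s ->
    flips s y ord0 j = if j \in s then - y ord0 j else y ord0 j.
  elim: s => [|i s IH]//= /andP[si us].
  rewrite mxE inE IH//; case: eqP => [ji|_] //=.
  by rewrite ji (negbTE si).
have -> : - z = flips (enum 'I_n) z.
  by apply/rowP => j; rewrite flipsE ?enum_uniq// mem_enum inE mxE.
by elim: (enum 'I_n) => //= i s IH; rewrite (admissible_even av).
Qed.

(** [1 = v (z - z) <= v z * v (- z) = v z ^ 2]. *)
Lemma admissible_ge1 v z : admissible v -> 1 <= v z.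
Proof.
move=> av; have v0 := admissible_ge0 av z.
have := admissible_submul av z (- z).
rewrite subrr (admissible_at0 av) admissible_opp// -expr2.
by rewrite -[X in X <= _ -> _](expr1n _ 2) ler_pXn2r// nnegrE.
Qed.

(** If [G'] is a non-zero window, use window independence and [v >= 1]. The case
    [G' = 0] has to be included because a derivative of a window may vanish. *)
Lemma amalgam_integrable v G sigma : admissible v -> window_independent v ->
  nonzero_window G -> in_amalgam v G sigma ->
  forall G', schwartz G' -> (\int[lebesgue_rV R n]_z stft_sup G' sigma z < +oo)%E.
Proof.
move=> av wv nG sG G' sG'; have [ts _] := sG.
have [[x Gx]|nx] := pselect (exists x, G' x != 0).
  have nG' : nonzero_window G' by split=> //; exists x.
  have [_] := (wv _ _ nG nG' sigma).1 sG.
  apply: le_lt_trans; apply: ge0_le_integral => //.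
  - by move=> z _; exact: stft_sup_ge0.
  - exact: measurable_stft_sup.
  - apply: emeasurable_funM; first exact: measurable_stft_sup.
    apply/measurable_EFinP; apply: continuous_measurable_rV.
    exact: (admissible_cont av).
  - move=> z _; rewrite -[leLHS]mule1; apply: lee_wpmul2l.
      exact: stft_sup_ge0.
    by rewrite lee_fin admissible_ge1.
have G0 : G' = (fun=> 0).
  by apply/funext => y; apply/eqP; apply: contra_notT nx => ?; exists y.
rewrite (eq_integral (cst 0%E)) ?integral0 ?ltry// => z _.
rewrite /stft_sup (_ : (fun _ => _) = cst 0%E).
  rewrite (_ : range _ = [set 0%E]) ?ereal_sup1//.
  by apply/seteqP; split=> [_ [? _ <-]|_ ->]//; exists 0.
apply/funext => zeta; rewrite /stft tfshift_row G0.
rewrite (_ : (fun _ => _) = (fun=> 0)); last by apply/funext => t; rewrite mulr0.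
by rewrite tempered0//= expr0n/= addr0 sqrtr0.
Qed.

End admissible_weights.

(** * Integration of Schwartz functions *)

Section translation_invariance.
Context {R : realType}.

Lemma ge0_integral_shift (f : R -> \bar R) (a : R) :
  measurable_fun setT f -> (forall x, (0 <= f x)%E) ->
  (\int[@lebesgue_measure R]_x f (x + a)%R = \int[@lebesgue_measure R]_x f x)%E.
Proof.
move=> mf f0.
have mT : measurable_fun setT (fun x : R => x + a).
  by apply: measurable_funD => //; exact: measurable_cst.
rewrite [RHS](@eq_measure_integral _ _ _ setT
    (pushforward (@lebesgue_measure R)
      (fun x : measurableTypeR R => (x + a)%R : measurableTypeR R))).
  by rewrite ge0_integral_pushforward.
move=> A mA _; apply: lebesgue_measure_unique => // _ [[u v] _ <-]/=.
rewrite /pushforward (_ : _ @^-1` _ = `]u - a, v - a]%classic).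
  by rewrite !lebesgue_measure_itv/= !lte_fin ltrD2r -!EFinB opprB addrA subrK.
by apply/seteqP; split=> x /=; rewrite !in_itv/= ltrBlDr lerBrDr.
Qed.

Lemma rV_consD n (a b : R) (x y : 'rV[R]_n) :
  rV_cons (a, x) + rV_cons (b, y) = rV_cons (a + b, x + y).
Proof.
apply/rowP => j; rewrite mxE; case: (unliftP ord0 j) => [k|] ->.
  by rewrite !rV_consES mxE.
by rewrite !rV_consE0.
Qed.

(** Induction on the dimension through Tonelli's theorem. *)
Lemma ge0_integral_rV_shift n (f : 'rV[R]_n -> \bar R) a :
  measurable_fun setT f -> (forall x, (0 <= f x)%E) ->
  (\int[lebesgue_rV R n]_x f (x + a)%R = \int[lebesgue_rV R n]_x f x)%E.
Proof.
elim: n f a => [f a mf f0|n IH f x mf f0].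
  by apply: eq_integral => x _; congr f; apply/rowP => -[].
have [a [y ->]] := rV_uncons_eq x.
have mS b : measurable_fun setT (fun z => f (rV_cons (b, z))).
  apply: measurableT_comp => //.
  apply: measurableT_comp; first exact: measurable_rV_cons.
  exact: measurable_pair1.
rewrite ge0_integral_rV_succ//; last first.
  apply: measurableT_comp => //; apply: measurable_rV => i.
  rewrite /rV_coord; under eq_fun do rewrite mxE.
  apply: measurable_funD; last exact: measurable_cst.
  exact: (measurable_rV_coord i).
rewrite [RHS]ge0_integral_rV_succ//.
rewrite -[RHS](@ge0_integral_shift _ a); last 2 first.
- exact: measurable_integral_rV.
- by move=> b; exact: integral_ge0.
apply: eq_integral => b _.
under eq_integral do rewrite rV_consD.
exact: (IH (fun z => f (rV_cons (b + a, z)))).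
Qed.

Lemma Rintegral_rV_shift n (f : 'rV[R]_n -> R) a : measurable_fun setT f ->
  \int[lebesgue_rV R n]_x f (x + a) = \int[lebesgue_rV R n]_x f x.
Proof.
move=> mf; rewrite /Rintegral; congr fine.
have mEf : measurable_fun setT (EFin \o f) by exact/measurable_EFinP.
rewrite integralE [in RHS]integralE; congr (_ - _)%E.
  rewrite -[RHS](@ge0_integral_rV_shift _ ((EFin \o f)^\+)%E a)//.
    by apply: eq_integral => x _; rewrite !unlock.
  exact: measurable_funepos.
rewrite -[RHS](@ge0_integral_rV_shift _ ((EFin \o f)^\-)%E a)//.
  by apply: eq_integral => x _; rewrite !unlock.
exact: measurable_funeneg.
Qed.

End translation_invariance.

Section decay_weight.
Context {R : realType}.

(** An integrable function which dominates, up to constants, all uniformly Schwartz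
    families. *)
Definition decay n (x : 'rV[R]_n) : R := \prod_(i < n) (oneDsqr (x ord0 i))^-1.

Lemma decay_gt0 n (x : 'rV[R]_n) : 0 < decay x.
Proof.
by rewrite prodr_gt0// => i _; rewrite invr_gt0 (lt_le_trans _ (oneDsqr_ge1 _)).
Qed.

Lemma decay_cons n (a : R) (y : 'rV[R]_n) :
  decay (rV_cons (a, y)) = (oneDsqr a)^-1 * decay y.
Proof.
rewrite /decay big_ord_recl rV_consE0; congr (_ * _).
by apply: eq_bigr => i _; rewrite rV_consES.
Qed.

Lemma measurable_decay n : measurable_fun setT (@decay n).
Proof.
apply: measurable_prod => i _ /=.
rewrite (_ : (fun _ => _) = (fun a : R => (oneDsqr a)^-1) \o @rV_coord R n i)//.
apply: measurableT_comp; last exact: measurable_rV_coord.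
by apply: continuous_measurable_fun; exact: continuous_oneDsqrV.
Qed.

Lemma integral_decay n : (\int[lebesgue_rV R n]_x (decay x)%:E < +oo)%E.
Proof.
elim: n => [|n IH].
  rewrite /= integral_dirac//; first by rewrite diracT mul1e ltry.
  by apply/measurable_EFinP; exact: measurable_decay.
have md k : measurable_fun setT (EFin \o @decay k).
  by apply/measurable_EFinP; exact: measurable_decay.
rewrite ge0_integral_rV_succ; last 2 first.
- exact: md.
- by move=> x; rewrite lee_fin ltW// decay_gt0.
have m1 : measurable_fun setT (fun a : R => (oneDsqr a)^-1%:E).
  apply/measurable_EFinP; apply: continuous_measurable_fun.
  exact: continuous_oneDsqrV.
have p1 (a : R) : 0 <= (oneDsqr a)^-1.
  by rewrite invr_ge0 (le_trans _ (oneDsqr_ge1 _)).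
under eq_integral do under eq_integral do rewrite decay_cons EFinM.
under eq_integral => a _.
  rewrite ge0_integralZl//; last 2 first.
  - exact: md.
  - by move=> x _; rewrite lee_fin ltW// decay_gt0.
  over.
rewrite ge0_integralZr//; last first.
  by apply: integral_ge0 => x _; rewrite lee_fin ltW// decay_gt0.
rewrite lte_mul_pinfty//; first exact: integral_ge0.
  rewrite (@ge0_symfun_integralT R (fun a => (oneDsqr a)^-1))//.
  - rewrite -set_itvcy integral0y_oneDsqr//.
  - exact: continuous_oneDsqrV.
  - by move=> a /=; rewrite /oneDsqr sqrrN.
Qed.

Lemma integrable_decay n : (lebesgue_rV R n).-integrable setT (EFin \o @decay n).
Proof.
apply/integrableP; split; first by apply/measurable_EFinP; exact: measurable_decay.
under eq_integral do rewrite /= ger0_norm ?(ltW (decay_gt0 _))//.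
exact: integral_decay.
Qed.

(** Multiply [F] by the polynomial [1 + x_i ^ 2] for each of the selected
    coordinates. Selecting only some coordinates gives decay in half of the
    variables of phase space, uniformly in the other half. *)
Lemma uschwartz_decay T m n (iota : 'I_m -> 'I_n) (F : T -> 'rV[R]_n -> R) :
  uschwartz F ->
  exists2 C : R, 0 <= C & forall t x,
    `|F t x| <= C * decay (\row_i x ord0 (iota i) : 'rV[R]_m).
Proof.
move=> uF.
have : uschwartz (fun t x => (\prod_(i < m) oneDsqr (x ord0 (iota i))) * F t x).
  elim: (index_enum _) => [|i s IH].
    by apply: eq_uschwartz uF => t x; rewrite big_nil mul1r.
  have := uschwartz_add IH (uschwartz_coord (iota i) (uschwartz_coord (iota i) IH)).
  by apply: eq_uschwartz => t x; rewrite big_cons /oneDsqr; ring.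
move=> /uschwartz_bounded[C FC]; exists `|C| => // t x.
have w0 : 0 < \prod_(i < m) oneDsqr (x ord0 (iota i)).
  by rewrite prodr_gt0// => i _; rewrite (lt_le_trans _ (oneDsqr_ge1 _)).
have -> : decay (\row_i x ord0 (iota i) : 'rV[R]_m) =
    (\prod_(i < m) oneDsqr (x ord0 (iota i)))^-1.
  by rewrite /decay -prodfV; apply: eq_bigr => i _; rewrite mxE.
rewrite ler_pdivlMr// mulrC -[X in X * _](gtr0_norm w0) -normrM.
by rewrite (le_trans (FC t x))// ler_norm.
Qed.

Lemma dominated_integrable n (f : 'rV[R]_n -> R) (C : R) :
  measurable_fun setT f -> (forall x, `|f x| <= C * decay x) ->
  (lebesgue_rV R n).-integrable setT (EFin \o f).
Proof.
move=> mf fC.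
have iC : (lebesgue_rV R n).-integrable setT (EFin \o (fun x => C * decay x)).
  rewrite (_ : _ \o _ = fun x => (C%:E * (EFin \o @decay n) x)%E)//.
  by apply: integrableZl => //; exact: integrable_decay.
apply: (le_integrable _ _ _ iC) => //; first exact/measurable_EFinP.
by move=> x _; rewrite /= lee_fin (le_trans (fC x))// ler_norm.
Qed.

Lemma dominated_Rintegral n (f : 'rV[R]_n -> R) (C : R) :
  measurable_fun setT f -> (forall x, `|f x| <= C * decay x) ->
  `|\int[lebesgue_rV R n]_x f x| <= C * \int[lebesgue_rV R n]_x decay x.
Proof.
move=> mf fC; have iF := dominated_integrable mf fC.
rewrite (le_trans (le_normr_Rintegral measurableT iF))//.
rewrite -RintegralZl//; last exact: integrable_decay.
apply: le_Rintegral => //.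
- by apply: (integrable_norm iF).
- rewrite (_ : _ \o _ = fun x => (C%:E * (EFin \o @decay n) x)%E)//.
  by apply: integrableZl => //; exact: integrable_decay.
Qed.

Lemma row_id n (x : 'rV[R]_n) : \row_i x ord0 i = x.
Proof. by apply/rowP => i; rewrite mxE. Qed.

Lemma uschwartz_measurable T n (F : T -> 'rV[R]_n -> R) t : uschwartz F ->
  measurable_fun setT (F t).
Proof.
by move=> uF; apply: continuous_measurable_rV; exact: uschwartz_continuous.
Qed.

Lemma uschwartz_integrable T n (F : T -> 'rV[R]_n -> R) t : uschwartz F ->
  (lebesgue_rV R n).-integrable setT (EFin \o F t).
Proof.
move=> uF; have [C _ FC] := uschwartz_decay id uF.
apply: (@dominated_integrable _ _ C); first exact: uschwartz_measurable.
by move=> x; have := FC t x; rewrite row_id.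
Qed.

(** Difference quotients have integral zero by translation invariance. *)
Lemma integral_derivative n (f f' : 'rV[R]_n -> R) i :
  uschwartz (fun _ : unit => f) ->
  (forall x, is_derive x (evec i) f (f' x)) ->
  \int[lebesgue_rV R n]_x f' x = 0.
Proof.
move=> uf df.
have uf' := uschwartz_derivative df uf.
pose T := {h : R | h != 0 /\ `|h| <= 1}.
have := @uschwartz_quotient_error R n T sval (fun t => (svalP t).1)
  (fun t => (svalP t).2) i f f' uf df.
move=> /(uschwartz_decay id)[C C0 FC].
apply: (@small_multiple_eq0 _ _ (C * \int[lebesgue_rV R n]_x decay x)) => h h0 h12.
have h1 : `|h| <= 1 by rewrite gtr0_norm// (le_trans h12)// invf_le1// ler1n.
have hn0 : h != 0 by rewrite gt_eqF.
have mf := uschwartz_measurable tt uf.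
have mf' := uschwartz_measurable tt uf'.
have mfh : measurable_fun setT (fun x : 'rV[R]_n => f (x - h *: evec i)).
  have [M hM] := coord_bounded (h *: evec i).
  exact: (uschwartz_measurable tt (@uschwartz_translate _ _ unit (fun=> f)
    (fun=> h *: evec i) M (fun=> hM) uf)).
have if_ := uschwartz_integrable tt uf.
have if' := uschwartz_integrable tt uf'.
have ifh : (lebesgue_rV R n).-integrable setT (EFin \o (fun x : 'rV[R]_n => f (x - h *: evec i))).
  have [M hM] := coord_bounded (h *: evec i).
  exact: (uschwartz_integrable tt (@uschwartz_translate _ _ unit (fun=> f)
    (fun=> h *: evec i) M (fun=> hM) uf)).
have E : \int[lebesgue_rV R n]_x f' x = \int[lebesgue_rV R n]_x
    (h * (h^-1 * (h^-1 * (f (x - h *: evec i) - f x) + f' x))).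
  under [RHS]eq_Rintegral do rewrite mulrA divff// mul1r.
  have iB : (lebesgue_rV R n).-integrable setT
      (EFin \o (fun x : 'rV[R]_n => f (x - h *: evec i) - f x)).
    exact: (integrableB measurableT ifh if_).
  have iZ : (lebesgue_rV R n).-integrable setT
      (EFin \o (fun x : 'rV[R]_n => h^-1 * (f (x - h *: evec i) - f x))).
    exact: (integrableZl measurableT h^-1 iB).
  rewrite RintegralD// RintegralZl// RintegralB//.
  by rewrite (Rintegral_rV_shift (- (h *: evec i)))// subrr mulr0 add0r.
rewrite E.
apply: (@le_trans _ _ ((C * h) * \int[lebesgue_rV R n]_x decay x)).
  apply: dominated_Rintegral.
    apply: measurable_funM => //; apply: measurable_funM => //.
    apply: measurable_funD => //; apply: measurable_funM => //.
    exact: measurable_funB.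
  move=> x; rewrite normrM (gtr0_norm h0) mulrC mulrAC ler_wpM2r ?(ltW h0)//.
  by have := FC (exist _ h (conj hn0 h1)) x; rewrite row_id.
by rewrite mulrAC.
Qed.

End decay_weight.

(** * The Wigner distribution of Schwartz functions is a Schwartz function *)

Section phase_space.
Context {R : realType} {d : nat}.
Implicit Types (u : 'rV[R]_(d + d)) (x y : 'rV[R]_d).

Lemma dotC n (a b : 'rV[R]_n) : dot a b = dot b a.
Proof. by apply: eq_bigr => i _; rewrite mulrC. Qed.

Lemma lsub_lshift u i (t : R) :
  lsubmx (u + t *: evec (lshift d i)) = lsubmx u + t *: evec i.
Proof.
by apply/rowP => j; rewrite !mxE; congr (_ + _ * _); rewrite (inj_eq (@lshift_inj _ _)).
Qed.

Lemma rsub_lshift u i (t : R) : rsubmx (u + t *: evec (lshift d i)) = rsubmx u.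
Proof. by apply/rowP => j; rewrite !mxE/= eq_rlshift mulr0 addr0. Qed.

Lemma lsub_rshift u i (t : R) : lsubmx (u + t *: evec (rshift d i)) = lsubmx u.
Proof. by apply/rowP => j; rewrite !mxE/= eq_lrshift mulr0 addr0. Qed.

Lemma rsub_rshift u i (t : R) :
  rsubmx (u + t *: evec (rshift d i)) = rsubmx u + t *: evec i.
Proof.
by apply/rowP => j; rewrite !mxE; congr (_ + _ * _); rewrite (inj_eq (@rshift_inj _ _)).
Qed.

Lemma row_mx_rshift x y i (t : R) :
  row_mx x (y + t *: evec i) = row_mx x y + t *: evec (rshift d i).
Proof. by rewrite -[RHS]hsubmxK lsub_rshift rsub_rshift row_mxKl row_mxKr. Qed.

Lemma row_mx_lshift x y i (t : R) :
  row_mx (x + t *: evec i) y = row_mx x y + t *: evec (lshift d i).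
Proof. by rewrite -[RHS]hsubmxK lsub_lshift rsub_lshift row_mxKl row_mxKr. Qed.

(** Multiplying by a coordinate and differentiating are traded between the two
    factors through the linear change of variables
    [p = x + tau y], [q = x - (1 - tau) y], whose inverse is
    [x = (1 - tau) p + tau q], [y = p - q]. *)
Lemma uschwartz_bilinear (f g : 'rV[R]_d -> R) tau :
  uschwartz (fun _ : unit => f) -> uschwartz (fun _ : unit => g) ->
  uschwartz (fun (_ : unit) u => f (lsubmx u + tau *: rsubmx u) *
    g (lsubmx u - (1 - tau) *: rsubmx u)).
Proof.
move=> uf ug.
pose p u := lsubmx u + tau *: rsubmx u.
pose q u := lsubmx u - (1 - tau) *: rsubmx u.
pose B (F : unit -> 'rV[R]_(d + d) -> R) := exists f g,
  [/\ uschwartz (fun _ : unit => f), uschwartz (fun _ : unit => g) &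
      F = fun _ u => f (p u) * g (q u)].
apply: (@uschwartz_upto _ _ _ B); last by apply: span_base; exists f, g.
move=> {uf ug f g}_ [f [g [uf ug ->]]]; split.
- have [C fC] := uschwartz_bounded uf; have [D gD] := uschwartz_bounded ug.
  by exists (C * D) => t u; rewrite normrM ler_pM//; [exact: (fC tt)|exact: (gD tt)].
- move=> k.
  have [a [b [i [Hp Hq]]]] : exists a b i,
     (forall u t, p (u + t *: evec k) = p u + t *: (a *: evec i)) /\
     (forall u t, q (u + t *: evec k) = q u + t *: (b *: evec i)).
    have [i ->|i ->] := split_ordP k.
      exists 1, 1, i; split=> u t; rewrite scale1r /p /q lsub_lshift rsub_lshift;
        by rewrite addrAC.
    exists tau, (- (1 - tau)), i; split=> u t; rewrite /p /q lsub_rshift rsub_rshift.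
      by apply/rowP => j; rewrite !mxE; ring.
    by apply/rowP => j; rewrite !mxE; ring.
  have [f' uf' df] := uschwartz_derive i uf.
  have [g' ug' dg] := uschwartz_derive i ug.
  have uf't : uschwartz (fun _ : unit => f' tt).
    by apply: uschwartz_derivative uf; exact: (df tt).
  have ug't : uschwartz (fun _ : unit => g' tt).
    by apply: uschwartz_derivative ug; exact: (dg tt).
  exists (fun t u => a * (f' tt (p u) * g (q u)) + b * (f (p u) * g' tt (q u))).
    apply: span_add; apply: span_const; apply: span_base.
      by exists (f' tt), g.
    by exists f, (g' tt).
  move=> t u.
  have df' : is_derive u (evec k) (fun u => f (p u)) (a * f' tt (p u)).
    apply: (@is_derive_affine _ _ _ p f u _ _ _ (Hp u)).
    by apply: is_derive_dir.
  have dg' : is_derive u (evec k) (fun u => g (q u)) (b * g' tt (q u)).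
    apply: (@is_derive_affine _ _ _ q g u _ _ _ (Hq u)).
    by apply: is_derive_dir.
  apply: (is_derive_eq (is_derive_mul df' dg')).
  by ring.
- move=> k.
  have [a [b [i H]]] : exists a b i, forall u,
      u ord0 k = a * p u ord0 i + b * q u ord0 i.
    have [i ->|i ->] := split_ordP k.
      exists (1 - tau), tau, i => u; rewrite !mxE; ring.
    exists 1, (- 1), i => u; rewrite !mxE; ring.
  rewrite (_ : (fun _ _ => _) = (fun t u => a * (p u ord0 i * f (p u) * g (q u)) +
     b * (f (p u) * (q u ord0 i * g (q u))))); last first.
    by apply/funext => t; apply/funext => u; rewrite H; ring.
  apply: span_add; apply: span_const; apply: span_base.
    by exists (fun x => x ord0 i * f x), g; split=> //; exact: (uschwartz_coord i uf).
  by exists f, (fun x => x ord0 i * g x); split=> //; exact: (uschwartz_coord i ug).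
Qed.

Lemma uschwartz_restrict T (F : T -> 'rV[R]_(d + d) -> R) x :
  uschwartz F -> uschwartz (fun t y => F t (row_mx x y)).
Proof.
move=> uF.
pose B (G : T -> 'rV[R]_d -> R) := exists2 F, uschwartz F &
  G = fun t y => F t (row_mx x y).
apply: (@uschwartz_upto _ _ _ B); last by apply: span_base; exists F.
move=> {uF F}_ [F uF ->]; split.
- by have [C FC] := uschwartz_bounded uF; exists C.
- move=> i; have [F' uF' dF] := uschwartz_derive (rshift d i) uF.
  exists (fun t y => F' t (row_mx x y)); first by apply: span_base; exists F'.
  move=> t y; apply: (@is_derive_affine _ _ _ (row_mx x) _ _ _ _ _ _ (dF t _)).
  by move=> s; exact: row_mx_rshift.
- move=> i; apply: span_base.
  exists (fun t u => u ord0 (rshift d i) * F t u); first exact: uschwartz_coord.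
  by apply/funext => t; apply/funext => y; rewrite row_mxEr.
Qed.

End phase_space.

Section parametric_integral.
Context {R : realType} {d : nat}.
Notation mu := (lebesgue_rV R d).

(** Differentiation under the integral sign, in the quantitative form in which
    difference quotients converge at a linear rate with an integrable constant. *)
Lemma is_derive_integral m (f : 'rV[R]_m -> 'rV[R]_d -> R) (f' : 'rV[R]_d -> R)
    u v (C : R) :
  (forall u, mu.-integrable setT (EFin \o f u)) ->
  mu.-integrable setT (EFin \o f') ->
  (forall h : R, h != 0 -> `|h| <= 1 -> forall y,
     `|h^-1 * (f (u + h *: v) y - f u y) - f' y| <= C * `|h| * decay y) ->
  is_derive u v (fun u => \int[mu]_y f u y) (\int[mu]_y f' y).
Proof.
move=> if_ if' H.
apply: (@is_derive_quotient _ _ _ _ _ _ (C * \int[mu]_y decay y)) => h h0 h1.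
have iB : mu.-integrable setT (EFin \o (fun y => f (u + h *: v) y - f u y)).
  exact: (integrableB measurableT (if_ _) (if_ _)).
have iZ : mu.-integrable setT (EFin \o (fun y => h^-1 * (f (u + h *: v) y - f u y))).
  exact: (integrableZl measurableT h^-1 iB).
have iD : mu.-integrable setT
    (EFin \o (fun y => h^-1 * (f (u + h *: v) y - f u y) - f' y)).
  exact: (integrableB measurableT iZ if').
rewrite /= -RintegralB// -RintegralZl// -RintegralB//.
rewrite (mulrAC C); apply: dominated_Rintegral; last exact: H.
by apply/measurable_EFinP; exact: (measurable_int _ iD).
Qed.

End parametric_integral.

Section partial_fourier.
Context {R : realType} {d : nat}.
Implicit Types (Phi : 'rV[R]_(d + d) -> R) (u : 'rV[R]_(d + d)).
Notation mu := (lebesgue_rV R d).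

(** Real partial Fourier transform in the second half of the variables; the
    phase [c] allows to treat the cosine and the sine transform together. *)
Definition pft Phi (c : R) u : R :=
  \int[mu]_y (cos (2%:R * pi * dot (rsubmx u) y + c) *
              Phi (row_mx (lsubmx u) y)).

Lemma cosD_pihalf (a : R) : cos (a + pi / 2) = - sin a.
Proof. by rewrite cosD cos_pihalf sin_pihalf mulr0 mulr1 sub0r. Qed.

Lemma pft_integrable Phi c u : uschwartz (fun _ : unit => Phi) ->
  mu.-integrable setT (EFin \o (fun y => cos (2%:R * pi * dot (rsubmx u) y + c) *
              Phi (row_mx (lsubmx u) y))).
Proof.
move=> uP.
have [uc _] := uschwartz_wave (rsubmx u) (fun _ : unit => c)
  (uschwartz_restrict (lsubmx u) uP).
exact: (uschwartz_integrable tt uc).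
Qed.

Lemma uschwartz_decay_rsub T (F : T -> 'rV[R]_(d + d) -> R) : uschwartz F ->
  exists2 C : R, 0 <= C & forall t x y, `|F t (row_mx x y)| <= C * decay y.
Proof.
move=> uF; have [C C0 FC] := uschwartz_decay (@rshift d d) uF.
exists C => // t x y; have := FC t (row_mx x y).
rewrite (_ : \row_i _ = y)//; apply/rowP => i.
by rewrite mxE row_mxEr.
Qed.

Lemma pft_bounded Phi c : uschwartz (fun _ : unit => Phi) ->
  exists C : R, forall u, `|pft Phi c u| <= C.
Proof.
move=> uP; have [C C0 PC] := uschwartz_decay_rsub uP.
exists (C * \int[mu]_y decay y) => u; apply: dominated_Rintegral.
  by apply/measurable_EFinP; exact: (measurable_int _ (pft_integrable c u uP)).
move=> y; rewrite normrM -[leRHS]mul1r ler_pM//; last exact: (PC tt).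
by rewrite ler_norml cos_geN1 cos_le1.
Qed.

Lemma pft_derive_position Phi Phi' c u i : uschwartz (fun _ : unit => Phi) ->
  (forall u, is_derive u (evec (lshift d i)) Phi (Phi' u)) ->
  is_derive u (evec (lshift d i)) (pft Phi c) (pft Phi' c u).
Proof.
move=> uP dP; have uP' := uschwartz_derivative dP uP.
pose T := {h : R | h != 0 /\ `|h| <= 1}.
have hN0 (t : T) : - sval t != 0 by rewrite oppr_eq0; exact: (svalP t).1.
have hN1 (t : T) : `|- sval t| <= 1 by rewrite normrN; exact: (svalP t).2.
have [C C0 HC] := uschwartz_decay_rsub (uschwartz_quotient_error hN0 hN1 uP dP).
apply: (@is_derive_integral R d (d + d) (fun u y =>
  cos (2%:R * pi * dot (rsubmx u) y + c) * Phi (row_mx (lsubmx u) y)) _ _ _ C).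
- by move=> w; exact: pft_integrable.
- exact: pft_integrable.
move=> h h0 h1 y; rewrite rsub_lshift lsub_lshift.
have := HC (exist _ h (conj h0 h1)) (lsubmx u) y; rewrite /= scaleNr opprK.
rewrite row_mx_lshift; set P1 := Phi (_ + _); set P0 := Phi _; set P' := Phi' _.
set w := cos _ => HC1.
have -> : h^-1 * (w * P1 - w * P0) - w * P' =
   w * h * ((- h)^-1 * ((- h)^-1 * (P1 - P0) + P')).
  by field.
rewrite normrM (mulrAC C) [leRHS]mulrC ler_pM//.
rewrite normrM -[leRHS]mul1r ler_pM//.
by rewrite ler_norml cos_geN1 cos_le1.
Qed.

Lemma cos_taylor (a b : R) : `|cos (a + b) - cos a + b * sin a| <= b ^+ 2.
Proof.
have lip_sin (s : R) : `|sin (a + s) - sin a| <= `|s|.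
  have := @line_lipschitz _ R^o (@sin R) (@cos R) a 1 s 1.
  rewrite [_%:A]mulr1 mul1r; apply => t _; split; first exact: is_derive_sin.
  by rewrite ler_norml cos_geN1 cos_le1.
pose k (t : R) := cos t + t * sin a.
have := @line_lipschitz _ R^o k (fun t => - sin t + sin a) a 1 b `|b|.
rewrite [_%:A]mulr1 /k.
rewrite (_ : _ - _ = cos (a + b) - cos a + b * sin a); last by ring.
rewrite -expr2 real_normK ?num_real//; apply => t tb; split.
  apply: (is_derive_eq (is_derive_add (is_derive_cos _)
    (is_derive_mul (is_derive_id _ _) (is_derive_cst _ _ _)))).
  by rewrite mul1r mulr0 addr0.
by rewrite addrC distrC [_%:A]mulr1 (le_trans (lip_sin _)).
Qed.

Lemma pft_derive_frequency Phi c u i : uschwartz (fun _ : unit => Phi) ->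
  is_derive u (evec (rshift d i)) (pft Phi c)
    (pft (fun w => 2%:R * pi * (w ord0 (rshift d i) * Phi w)) (c + pi / 2) u).
Proof.
move=> uP; have uP1 := uschwartz_coord (rshift d i) uP.
have uP' := uschwartz_const (2%:R * pi) uP1.
have [C C0 HC] := uschwartz_decay_rsub
  (uschwartz_const ((2%:R * pi) ^+ 2) (uschwartz_coord (rshift d i) uP1)).
apply: (@is_derive_integral R d (d + d) (fun u y =>
  cos (2%:R * pi * dot (rsubmx u) y + c) * Phi (row_mx (lsubmx u) y)) _ _ _ C).
- by move=> w; exact: pft_integrable.
- exact: (pft_integrable (c + pi / 2) u uP').
move=> h h0 h1 y; rewrite rsub_rshift lsub_rshift.
have := HC tt (lsubmx u) y; rewrite row_mxEr; set P := Phi _ => HC1.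
rewrite addrA cosD_pihalf.
set th := 2%:R * pi * dot (rsubmx u) y + c.
have -> : 2%:R * pi * dot (rsubmx u + h *: evec i) y + c =
    th + h * (2%:R * pi * y ord0 i).
  by rewrite dotDl dotZl (dotC (evec i)) dot_evec /th; ring.
set b := 2%:R * pi * y ord0 i.
have -> : h^-1 * (cos (th + h * b) * P - cos th * P) -
    - sin th * (2%:R * pi * (y ord0 i * P)) =
    (cos (th + h * b) - cos th + h * b * sin th) * (h^-1 * P).
  by rewrite /b; field.
rewrite normrM.
apply: (@le_trans _ _ ((h * b) ^+ 2 * `|h^-1 * P|)).
  by rewrite ler_wpM2r// cos_taylor.
rewrite -(ger0_norm (sqr_ge0 (h * b))) -normrM.
have -> : (h * b) ^+ 2 * (h^-1 * P) =
    h * ((2%:R * pi) ^+ 2 * (y ord0 i * (y ord0 i * P))).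
  by rewrite /b; field.
by rewrite normrM (mulrAC C) [leRHS]mulrC ler_wpM2l.
Qed.

(** Integration by parts: the derivative of [sin (2 pi omega.y + c) * Phi (x, y)] in
    the direction [y_i] has integral zero. *)
Lemma pft_frequency Phi Phi' c u i : uschwartz (fun _ : unit => Phi) ->
  (forall u, is_derive u (evec (rshift d i)) Phi (Phi' u)) ->
  rsubmx u ord0 i * pft Phi c u =
    pft (fun w => (2%:R * pi)^-1 * Phi' w) (c + pi / 2) u.
Proof.
move=> uP dP; have uP' := uschwartz_derivative dP uP.
pose om := rsubmx u; pose x := lsubmx u.
have pi0 : 2%:R * pi != 0 :> R by rewrite mulf_neq0 ?pnatr_eq0// gt_eqF// pi_gt0.
pose g y := sin (2%:R * pi * dot om y + c) * Phi (row_mx x y).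
pose g' y := 2%:R * pi * om ord0 i * (cos (2%:R * pi * dot om y + c) * Phi (row_mx x y)) -
  2%:R * pi * (cos (2%:R * pi * dot om y + (c + pi / 2)) * ((2%:R * pi)^-1 * Phi' (row_mx x y))).
have [_ ug] := uschwartz_wave om (fun _ : unit => c) (uschwartz_restrict x uP).
have dg y : is_derive y (evec i) g (g' y).
  have [_ ds] := is_derive_wave om y c i.
  have dr : is_derive y (evec i) (fun y => Phi (row_mx x y)) (Phi' (row_mx x y)).
    apply: (@is_derive_affine _ _ _ (row_mx x) _ _ _ _ _ _ (dP _)).
    by move=> s; exact: row_mx_rshift.
  apply: (is_derive_eq (is_derive_mul ds dr)).
  by rewrite /g' addrA cosD_pihalf; move: pi0; move: (2%:R * pi : R) => k k0; field.
have := integral_derivative ug dg.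
have i1 := pft_integrable c u uP.
have i2 := pft_integrable (c + pi / 2) u (uschwartz_const (2%:R * pi)^-1 uP').
rewrite RintegralB//; last 2 first.
- exact: (integrableZl measurableT _ i1).
- exact: (integrableZl measurableT _ i2).
rewrite !RintegralZl// -/(pft Phi c u).
rewrite -/(pft (fun w => (2%:R * pi)^-1 * Phi' w) (c + pi / 2) u) => /eqP.
by rewrite subr_eq0 -mulrA => /eqP /(mulfI pi0).
Qed.

(** The partial Fourier transform exchanges, up to constants and shifts of the
    phase, differentiation and multiplication by a coordinate in the transformed
    variables and commutes with both in the others. *)
Lemma uschwartz_pft Phi c : uschwartz (fun _ : unit => Phi) ->
  uschwartz (fun _ : unit => pft Phi c).
Proof.
move=> uP.
pose B (G : unit -> 'rV[R]_(d + d) -> R) := exists Phi c,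
  uschwartz (fun _ : unit => Phi) /\ G = fun _ => pft Phi c.
apply: (@uschwartz_upto _ _ _ B); last by apply: span_base; exists Phi, c.
move=> {uP Phi c}_ [Phi [c [uP ->]]]; split.
- by have [C PC] := pft_bounded c uP; exists C.
- move=> k; have [i ->|i ->] := split_ordP k.
    have [P' uP' dP] := uschwartz_derive (lshift d i) uP.
    exists (fun _ => pft (P' tt) c); last first.
      by move=> _ u; apply: pft_derive_position => //; exact: (dP tt).
    apply: span_base; exists (P' tt), c; split=> //.
    by apply: uschwartz_derivative uP; exact: (dP tt).
  exists (fun _ => pft (fun w => 2%:R * pi * (w ord0 (rshift d i) * Phi w)) (c + pi / 2)).
    apply: span_base; eexists; eexists; split; last by [].
    exact: (uschwartz_const (2%:R * pi) (uschwartz_coord (rshift d i) uP)).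
  by move=> _ u; exact: pft_derive_frequency.
- move=> k; apply: span_base; have [i ->|i ->] := split_ordP k.
    exists (fun w : 'rV[R]_(d + d) => w ord0 (lshift d i) * Phi w), c; split.
      exact: (uschwartz_coord (lshift d i) uP).
    apply/funext => _; apply/funext => u; rewrite /pft.
    rewrite -RintegralZl//; last exact: pft_integrable.
    by apply: eq_Rintegral => y _; rewrite row_mxEl mxE mulrCA.
  have [P' uP' dP] := uschwartz_derive (rshift d i) uP.
  have uP't : uschwartz (fun _ : unit => P' tt).
    by apply: uschwartz_derivative uP; exact: (dP tt).
  exists (fun w => (2%:R * pi)^-1 * P' tt w), (c + pi / 2); split.
    exact: (uschwartz_const (2%:R * pi)^-1 uP't).
  apply/funext => _; apply/funext => u.
  by rewrite -(pft_frequency c u uP (dP tt)) mxE.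
Qed.

End partial_fourier.

Section wigner_distribution.
Context {R : realType} {d : nat}.
Implicit Types (f g phi : 'rV[R]_d -> R[i]) (u : 'rV[R]_(d + d)).
Notation mu := (lebesgue_rV R d).

Definition wigner_integrand (tau : R) f g u (y : 'rV[R]_d) : R[i] :=
  cexp2pi (- dot y (rsubmx u)) * f (lsubmx u + tau *: y) *
  conjc (g (lsubmx u - (1 - tau) *: y)).

Definition wigner_kernel (tau : R) f g u : R[i] :=
  f (lsubmx u + tau *: rsubmx u) * conjc (g (lsubmx u - (1 - tau) *: rsubmx u)).

Lemma Re_conjc (w : R[i]) : complex.Re (conjc w) = complex.Re w.
Proof. by case: w. Qed.

Lemma Im_conjc (w : R[i]) : complex.Im (conjc w) = - complex.Im w.
Proof. by case: w. Qed.

Lemma wigner_kernel_schwartz tau f g : schwartz f -> schwartz g ->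
  schwartz (wigner_kernel tau f g).
Proof.
move=> /schwartzP[fR fI] /schwartzP[gR gI]; apply/schwartzP; split.
  apply: eq_uschwartz (uschwartz_add (uschwartz_bilinear tau fR gR)
    (uschwartz_bilinear tau fI gI)) => t u.
  by rewrite /wigner_kernel ReM Re_conjc Im_conjc mulrN opprK.
apply: eq_uschwartz (uschwartz_add (uschwartz_bilinear tau fI gR)
    (uschwartz_opp (uschwartz_bilinear tau fR gI))) => t u.
by rewrite /wigner_kernel ImM Re_conjc Im_conjc mulrN addrC.
Qed.

Lemma cosB_pihalf (a : R) : cos (a + - (pi / 2)) = sin a.
Proof. by rewrite cosB cos_pihalf sin_pihalf mulr0 mulr1 add0r. Qed.

Definition wave (u : 'rV[R]_(d + d)) (c : R) (y : 'rV[R]_d) : R :=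
  cos (2%:R * pi * dot (rsubmx u) y + c).

Lemma wigner_integrandE tau f g u y :
  let K := wigner_kernel tau f g (row_mx (lsubmx u) y) in
  complex.Re (wigner_integrand tau f g u y) =
    wave u 0 y * complex.Re K + wave u (- (pi / 2)) y * complex.Im K /\
  complex.Im (wigner_integrand tau f g u y) =
    wave u 0 y * complex.Im K + wave u (pi / 2) y * complex.Re K.
Proof.
rewrite /wigner_integrand /wigner_kernel row_mxKl row_mxKr /wave cosB_pihalf.
rewrite cosD_pihalf addr0 -mulrA (dotC y).
move: (f _ * conjc _) => K; rewrite ReM ImM /cexp2pi /= mulrN cosN sinN; split; ring.
Qed.

Lemma wigner_integrable tau f g u : schwartz f -> schwartz g ->
  mu.-integrable setT (EFin \o (fun y => complex.Re (wigner_integrand tau f g u y))) /\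
  mu.-integrable setT (EFin \o (fun y => complex.Im (wigner_integrand tau f g u y))).
Proof.
move=> sf sg; have /schwartzP[uR uI] := wigner_kernel_schwartz tau sf sg.
split.
  rewrite (_ : (fun _ => _) = (fun y =>
    wave u 0 y * complex.Re (wigner_kernel tau f g (row_mx (lsubmx u) y)) +
    wave u (- (pi / 2)) y * complex.Im (wigner_kernel tau f g (row_mx (lsubmx u) y)))).
    exact: (integrableD measurableT (pft_integrable _ u uR) (pft_integrable _ u uI)).
  by apply/funext => y; case: (wigner_integrandE tau f g u y).
rewrite (_ : (fun _ => _) = (fun y =>
    wave u 0 y * complex.Im (wigner_kernel tau f g (row_mx (lsubmx u) y)) +
    wave u (pi / 2) y * complex.Re (wigner_kernel tau f g (row_mx (lsubmx u) y)))).
  exact: (integrableD measurableT (pft_integrable _ u uI) (pft_integrable _ u uR)).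
by apply/funext => y; case: (wigner_integrandE tau f g u y).
Qed.

(** The Wigner distribution is the partial Fourier transform of its kernel, the
    imaginary exponential being split into cosines of phases [0] and [+-pi/2]. *)
Lemma wigner_pft tau f g u : schwartz f -> schwartz g ->
  let KR w := complex.Re (wigner_kernel tau f g w) in
  let KI w := complex.Im (wigner_kernel tau f g w) in
  wigner tau f g u = Complex (pft KR 0 u + pft KI (- (pi / 2)) u)
    (pft KI 0 u + pft KR (pi / 2) u).
Proof.
move=> sf sg KR KI.
have /schwartzP[uR uI] := wigner_kernel_schwartz tau sf sg.
rewrite /wigner /cintegral; congr Complex.
  rewrite /pft -RintegralD//; [|exact: pft_integrable..].
  by apply: eq_Rintegral => y _; case: (wigner_integrandE tau f g u y).
rewrite /pft -RintegralD//; [|exact: pft_integrable..].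
by apply: eq_Rintegral => y _; case: (wigner_integrandE tau f g u y).
Qed.

Lemma wigner_schwartz tau f g : schwartz f -> schwartz g ->
  schwartz (wigner tau f g).
Proof.
move=> sf sg; have /schwartzP[uR uI] := wigner_kernel_schwartz tau sf sg.
apply/schwartzP; split.
  apply: eq_uschwartz (uschwartz_add (uschwartz_pft 0 uR)
    (uschwartz_pft (- (pi / 2)) uI)) => t u.
  by rewrite wigner_pft.
apply: eq_uschwartz (uschwartz_add (uschwartz_pft 0 uI)
    (uschwartz_pft (pi / 2) uR)) => t u.
by rewrite wigner_pft.
Qed.

(** ** Covariance *)

Lemma cexp2piD (a b : R) : cexp2pi (a + b) = cexp2pi a * cexp2pi b.
Proof.
rewrite /cexp2pi mulrDr cosD sinD; apply/eqP; rewrite eq_complex /=.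
by rewrite eqxx/= addrC mulrC (mulrC (sin _)) eqxx.
Qed.

Lemma conjc_cexp2pi (a : R) : conjc (cexp2pi a) = cexp2pi (- a).
Proof. by rewrite /cexp2pi mulrN cosN sinN. Qed.

Lemma conjcM (a b : R[i]) : conjc (a * b) = conjc a * conjc b.
Proof. exact: (rmorphM (@conjc R)). Qed.

Lemma normc_cexp2pi (a : R) : Normc.normc (cexp2pi a) = 1.
Proof. by rewrite /= cos2Dsin2 sqrtr1. Qed.

Lemma cintegral_shift (F : 'rV[R]_d -> R[i]) a :
  mu.-integrable setT (EFin \o (fun y => complex.Re (F y))) ->
  mu.-integrable setT (EFin \o (fun y => complex.Im (F y))) ->
  cintegral (fun y => F (y + a)) = cintegral F.
Proof.
move=> iR iI; rewrite /cintegral; congr Complex.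
  rewrite (@Rintegral_rV_shift _ _ (fun y => complex.Re (F y)))//.
  by apply/measurable_EFinP; exact: (measurable_int _ iR).
rewrite (@Rintegral_rV_shift _ _ (fun y => complex.Im (F y)))//.
by apply/measurable_EFinP; exact: (measurable_int _ iI).
Qed.

Lemma cintegralZ (F : 'rV[R]_d -> R[i]) c :
  mu.-integrable setT (EFin \o (fun y => complex.Re (F y))) ->
  mu.-integrable setT (EFin \o (fun y => complex.Im (F y))) ->
  cintegral (fun y => c * F y) = c * cintegral F.
Proof.
move=> iR iI; case: c => a b; rewrite /cintegral; apply/eqP; rewrite eq_complex /=.
have iZ (r : R) G : mu.-integrable setT (EFin \o G) ->
    mu.-integrable setT (EFin \o (fun y => r * G y)).
  by move=> iG; exact: (integrableZl measurableT r iG).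
rewrite -!RintegralZl// -RintegralB//; [|exact: iZ..].
rewrite -RintegralD//; [|exact: iZ..].
apply/andP; split; apply/eqP; apply: eq_Rintegral => y _.
  by rewrite ReM.
by rewrite ImM.
Qed.

Lemma dot_row_mx (a b x y : 'rV[R]_d) :
  dot (row_mx a b) (row_mx x y) = dot a x + dot b y.
Proof.
rewrite /dot big_split_ord/=; congr (_ + _); apply: eq_bigr => i _.
  by rewrite !row_mxEl.
by rewrite !row_mxEr.
Qed.

Definition modulation_of (w z : 'rV[R]_(d + d)) : 'rV[R]_(d + d) :=
  row_mx (rsubmx w - rsubmx z) (lsubmx z - lsubmx w).

(** Time-frequency shifts of the two arguments become one time-frequency shift
    of the Wigner distribution, up to a phase; the translation invariance of
    the integral absorbs the difference of the two positions. *)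
Lemma wigner_covariance tau phi (w z : 'rV[R]_(d + d)) : schwartz phi ->
  exists a : R, wigner tau (tfshift w phi) (tfshift z phi) =
    fun u => cexp2pi a *
      tfshift (row_mx (T_tau tau w z) (modulation_of w z)) (wigner tau phi phi) u.
Proof.
move=> sphi.
pose a := lsubmx w - lsubmx z; pose U := T_tau tau w z.
exists (dot a (rsubmx U)); apply/funext => u.
pose C := cexp2pi (dot a (rsubmx U)) * cexp2pi (dot (modulation_of w z) u).
have [iR iI] := wigner_integrable tau u (schwartz_tfshift w sphi)
  (schwartz_tfshift z sphi).
have [jR jI] := wigner_integrable tau (u - U) sphi sphi.
rewrite tfshift_row mulrA -/C.
transitivity (cintegral (fun y => C * wigner_integrand tau phi phi (u - U) y));
  last exact: cintegralZ.
rewrite -[LHS](cintegral_shift a iR iI); congr cintegral; apply/funext => y.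
rewrite /wigner_integrand /tfshift conjcM.
have -> : lsubmx u + tau *: (y + a) - lsubmx w = lsubmx (u - U) + tau *: y.
  by apply/rowP => i; rewrite !mxE (unsplitK (inl i)) !mxE; ring.
have -> : lsubmx u - (1 - tau) *: (y + a) - lsubmx z = lsubmx (u - U) - (1 - tau) *: y.
  by apply/rowP => i; rewrite !mxE (unsplitK (inl i)) !mxE; ring.
set f1 := phi _; set f2 := conjc (phi _); rewrite conjc_cexp2pi.
transitivity ((cexp2pi (- dot (y + a) (rsubmx u)) *
    cexp2pi (dot (rsubmx w) (lsubmx u + tau *: (y + a))) *
    cexp2pi (- dot (rsubmx z) (lsubmx u - (1 - tau) *: (y + a)))) * (f1 * f2)).
  by ring.
transitivity ((C * cexp2pi (- dot y (rsubmx (u - U)))) * (f1 * f2)); last by ring.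
congr (_ * _); rewrite /C -!cexp2piD; congr cexp2pi.
have -> : rsubmx (u - U) = rsubmx u + (-1) *: rsubmx U.
  by apply/rowP => i; rewrite !mxE mulN1r.
have -> : rsubmx U = tau *: rsubmx w + (1 - tau) *: rsubmx z by rewrite row_mxKr.
have -> : dot (modulation_of w z) u =
    dot (rsubmx w) (lsubmx u) - dot (rsubmx z) (lsubmx u) - dot a (rsubmx u).
  rewrite -{1}(hsubmxK u) dot_row_mx /a -[rsubmx w - _]scale1r.
  rewrite (_ : rsubmx w - rsubmx z = rsubmx w + (-1) *: rsubmx z); last by rewrite scaleN1r.
  rewrite (_ : lsubmx z - lsubmx w = (-1) *: (lsubmx w - lsubmx z)); last first.
    by rewrite scaleN1r opprB.
  by rewrite dotZl mul1r dotDl !dotZl; ring.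
rewrite (_ : lsubmx u - (1 - tau) *: (y + a) = lsubmx u + (- (1 - tau)) *: (y + a)); last first.
  by rewrite scaleNr.
clearbody a; rewrite !(dotDr, dotDl, dotZr, dotZl) !(dotC (rsubmx w) y) !(dotC (rsubmx z) y).
rewrite ?(dotC (rsubmx w) a) ?(dotC (rsubmx z) a); ring.
Qed.

Lemma normc_Op_tau sigma tau phi (w z : 'rV[R]_(d + d)) :
  tempered sigma -> schwartz phi ->
  Normc.normc (Op_tau tau sigma (tfshift z phi) (tfshift w phi)) =
  Normc.normc (stft (wigner tau phi phi) sigma (T_tau tau w z) (modulation_of w z)).
Proof.
move=> ts sphi; have [a aE] := wigner_covariance tau w z sphi.
rewrite /Op_tau aE temperedZ//; last exact/schwartz_tfshift/wigner_schwartz.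
by rewrite Normc.normcM conjc_cexp2pi normc_cexp2pi mul1r.
Qed.

Lemma T_tau_surjective tau (u zeta : 'rV[R]_(d + d)) :
  exists w z, T_tau tau w z = u /\ modulation_of w z = zeta.
Proof.
exists (row_mx (lsubmx u - tau *: rsubmx zeta) (rsubmx u + (1 - tau) *: lsubmx zeta)),
  (row_mx (lsubmx u + (1 - tau) *: rsubmx zeta) (rsubmx u - tau *: lsubmx zeta)).
rewrite /T_tau /modulation_of !row_mxKl !row_mxKr; split.
  rewrite -[RHS]hsubmxK; congr row_mx; apply/rowP => i; rewrite !mxE; ring.
by rewrite -[RHS]hsubmxK; congr row_mx; apply/rowP => i; rewrite !mxE; ring.
Qed.

End wigner_distribution.

(** * Injectivity of the Fourier transform *)

Section fourier_uniqueness.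
Context {R : realType} {d : nat}.
Notation mu := (lebesgue_rV R d).
Context (f : 'rV[R]_d -> R) (uf : uschwartz (fun _ : unit => f)).

Definition bounded_measurable (m : 'rV[R]_d -> R) :=
  measurable_fun setT m /\ exists K : R, forall y, `|m y| <= K.

(** The Fourier transform of [m * f] vanishes. *)
Definition annihilates (m : 'rV[R]_d -> R) :=
  forall (om : 'rV[R]_d) (b : R),
    \int[mu]_y (m y * (cos (2%:R * pi * dot om y + b) * f y)) = 0.

(** Multipliers form an algebra closed under bounded pointwise limits; starting from
    cosines, this leads to all the functions needed to localize [f]. *)
Definition multiplier (m : 'rV[R]_d -> R) :=
  bounded_measurable m /\ forall m', bounded_measurable m' ->
    annihilates m' -> annihilates (fun y => m y * m' y).

Lemma measurable_wave_f (om : 'rV[R]_d) (b : R) :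
  measurable_fun setT (fun y => cos (2%:R * pi * dot om y + b) * f y).
Proof.
have [uc _] := uschwartz_wave om (fun _ : unit => b) uf.
exact: (uschwartz_measurable tt uc).
Qed.

Lemma annihilates_dominated m : bounded_measurable m ->
  exists C : R, forall om b y,
    `|m y * (cos (2%:R * pi * dot om y + b) * f y)| <= C * decay y.
Proof.
case=> mm [K mK]; have [C C0 fC] := uschwartz_decay id uf.
exists (K * C) => om b y; rewrite normrM -(mulrA K) ler_pM//.
rewrite normrM -[leRHS]mul1r ler_pM//.
  by rewrite ler_norml cos_geN1 cos_le1.
by have := fC tt y; rewrite row_id.
Qed.

Lemma annihilates_integrable m om b : bounded_measurable m ->
  mu.-integrable setT
    (EFin \o (fun y => m y * (cos (2%:R * pi * dot om y + b) * f y))).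
Proof.
move=> bm; have [C mC] := annihilates_dominated bm.
apply: (@dominated_integrable _ _ _ C) => //.
by apply: measurable_funM; [exact: bm.1|exact: measurable_wave_f].
Qed.

Lemma bounded_measurableM m m' : bounded_measurable m -> bounded_measurable m' ->
  bounded_measurable (fun y => m y * m' y).
Proof.
move=> [mm [K mK]] [mm' [K' mK']]; split; first exact: measurable_funM.
by exists (K * K') => y; rewrite normrM ler_pM.
Qed.

Lemma bounded_measurableD m m' : bounded_measurable m -> bounded_measurable m' ->
  bounded_measurable (fun y => m y + m' y).
Proof.
move=> [mm [K mK]] [mm' [K' mK']]; split; first exact: measurable_funD.
by exists (K + K') => y; rewrite (le_trans (ler_normD _ _))// lerD.
Qed.

Lemma bounded_measurableZ (c : R) m : bounded_measurable m ->
  bounded_measurable (fun y => c * m y).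
Proof.
move=> [mm [K mK]]; split.
  by apply: measurable_funM => //; exact: measurable_cst.
by exists (`|c| * K) => y; rewrite normrM ler_wpM2l.
Qed.

Lemma annihilatesD m m' : bounded_measurable m -> bounded_measurable m' ->
  annihilates m -> annihilates m' -> annihilates (fun y => m y + m' y).
Proof.
move=> bm bm' am am' om b.
under eq_Rintegral do rewrite mulrDl.
by rewrite RintegralD ?am ?am' ?addr0//; exact: annihilates_integrable.
Qed.

Lemma annihilatesZ (c : R) m : bounded_measurable m ->
  annihilates m -> annihilates (fun y => c * m y).
Proof.
move=> bm am om b.
under eq_Rintegral do rewrite -mulrA.
by rewrite RintegralZl ?am ?mulr0//; exact: annihilates_integrable.
Qed.

Lemma multiplier1 : multiplier (fun=> 1).
Proof.
split; first by split; [exact: measurable_cst|exists 1 => y; rewrite normr1].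
move=> m _ am om b; rewrite -[RHS](am om b).
by apply: eq_Rintegral => y _; rewrite mul1r.
Qed.

Lemma multiplierM m m' : multiplier m -> multiplier m' ->
  multiplier (fun y => m y * m' y).
Proof.
move=> [bm am] [bm' am']; split; first exact: bounded_measurableM.
move=> k bk ak om b.
rewrite -[RHS](am _ (bounded_measurableM bm' bk) (am' _ bk ak) om b).
by apply: eq_Rintegral => y _; rewrite !mulrA.
Qed.

Lemma multiplierD m m' : multiplier m -> multiplier m' ->
  multiplier (fun y => m y + m' y).
Proof.
move=> [bm am] [bm' am']; split; first exact: bounded_measurableD.
move=> k bk ak om b.
rewrite -[RHS](annihilatesD (bounded_measurableM bm bk) (bounded_measurableM bm' bk)
  (am _ bk ak) (am' _ bk ak) om b).
by apply: eq_Rintegral => y _; rewrite -mulrDl.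
Qed.

Lemma multiplierZ (c : R) m : multiplier m -> multiplier (fun y => c * m y).
Proof.
move=> [bm am]; split; first exact: bounded_measurableZ.
move=> k bk ak om b.
rewrite -[RHS](annihilatesZ c (bounded_measurableM bm bk) (am _ bk ak) om b).
by apply: eq_Rintegral => y _; rewrite !mulrA.
Qed.

Lemma multiplierX m k : multiplier m -> multiplier (fun y => m y ^+ k).
Proof.
move=> mm; elim: k => [|k IH].
  by under eq_fun do rewrite expr0; exact: multiplier1.
by under eq_fun do rewrite exprS; exact: multiplierM.
Qed.

Lemma multiplier_sum (m : nat -> 'rV[R]_d -> R) k : (forall j, multiplier (m j)) ->
  multiplier (fun y => \sum_(0 <= j < k) m j y).
Proof.
move=> mm; elim: k => [|k IH].
  under eq_fun do rewrite big_geq//.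
  have := multiplierZ 0 multiplier1.
  by under eq_fun do rewrite mul0r.
under eq_fun do rewrite big_nat_recr//=.
exact: multiplierD.
Qed.

Lemma multiplier_prod (I : Type) (s : seq I) (m : I -> 'rV[R]_d -> R) :
  (forall j, multiplier (m j)) -> multiplier (fun y => \prod_(j <- s) m j y).
Proof.
move=> mm; elim: s => [|i s IH].
  by under eq_fun do rewrite big_nil; exact: multiplier1.
by under eq_fun do rewrite big_cons; exact: multiplierM.
Qed.

(** By the product-to-sum formula, multiplication by a cosine shifts the frequency. *)
Lemma multiplier_cos (eta : 'rV[R]_d) :
  multiplier (fun y => cos (2%:R * pi * dot eta y)).
Proof.
have bc : bounded_measurable (fun y => cos (2%:R * pi * dot eta y)).
  split; last by exists 1 => y; rewrite ler_norml cos_geN1 cos_le1.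
  apply: (measurableT_comp (f := @cos R)).
    by apply: continuous_measurable_fun; exact: continuous_cos.
  apply: measurable_funM; first exact: measurable_cst.
  apply: measurable_sum => i; apply: measurable_funM; first exact: measurable_cst.
  exact: (measurable_rV_coord i).
split=> // k bk ak om b.
transitivity (2^-1 * (\int[mu]_y (k y * (cos (2%:R * pi * dot (om + eta) y + b) * f y)) +
  \int[mu]_y (k y * (cos (2%:R * pi * dot (om + (-1) *: eta) y + b) * f y)))).
  have i1 := annihilates_integrable (om + eta) b bk.
  have i2 := annihilates_integrable (om + (-1) *: eta) b bk.
  rewrite -RintegralD// -RintegralZl//; last exact: (integrableD measurableT i1 i2).
  apply: eq_Rintegral => y _.
  have -> : 2%:R * pi * dot (om + eta) y + b =
     (2%:R * pi * dot om y + b) + 2%:R * pi * dot eta y by rewrite dotDl; ring.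
  have -> : 2%:R * pi * dot (om + (-1) *: eta) y + b =
     (2%:R * pi * dot om y + b) - 2%:R * pi * dot eta y by rewrite dotDl dotZl; ring.
  by move: (_ + b) => th; rewrite cosD cosB; field.
by rewrite !ak addr0 mulr0.
Qed.

(** Dominated convergence. *)
Lemma multiplier_cvg (m_ : nat -> 'rV[R]_d -> R) (m : 'rV[R]_d -> R) (K : R) :
  (forall k, multiplier (m_ k)) -> (forall k y, `|m_ k y| <= K) ->
  (forall y, (m_ k y @[k --> \oo] --> m y)) -> multiplier m.
Proof.
move=> mm mK mcvg.
have meas_m : measurable_fun setT m.
  by apply: (@measurable_fun_cvg _ _ _ _ m_) => [k|y _]; [exact: (mm k).1.1|exact: mcvg].
have mKl y : `|m y| <= K.
  have c : `|m_ k y| @[k --> \oo] --> `|m y| by apply: cvg_norm; exact: mcvg.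
  rewrite -(cvg_lim _ c)//; apply: limr_le; first by apply/cvg_ex; exists `|m y|.
  exact: nearW.
have bm : bounded_measurable m by split=> //; exists K.
split=> // k bk ak om b.
pose g y := k y * (cos (2%:R * pi * dot om y + b) * f y).
have [C gC] := annihilates_dominated bk.
have K0 : 0 <= K by rewrite (le_trans _ (mKl 0)).
have ig : mu.-integrable setT (EFin \o (fun y => K * C * decay y)).
  exact: (integrableZl measurableT (K * C) (integrable_decay d)).
have mg : measurable_fun setT g.
  by apply: measurable_funM; [exact: bk.1|exact: measurable_wave_f].
have z j : (\int[mu]_y (m_ j y * g y)%:E = 0)%E.
  have H := (mm j).2 _ bk ak om b.
  have i1 := annihilates_integrable om b (bounded_measurableM (mm j).1 bk).
  have E : (\int[mu]_y (m_ j y * g y)%:E)%E =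
     (\int[mu]_y (m_ j y * k y * (cos (2%:R * pi * dot om y + b) * f y))%:E)%E.
    by apply: eq_integral => y _; rewrite /g !mulrA.
  have fin : (\int[mu]_y (m_ j y * g y)%:E)%E \is a fin_num.
    by rewrite E; exact: (integrable_fin_num measurableT i1).
  by rewrite -(fineK fin) E -[fine _]/(Rintegral _ _ _) H.
have := @dominated_cvg _ _ R mu setT measurableT (fun j y => (m_ j y * g y)%:E)
  (fun y => (m y * g y)%:E) (fun y => (K * C * decay y)%:E).
rewrite /Rintegral; move=> /(_ _ _ _ ig).
have -> : (fun n => \int[mu]_y (m_ n y * g y)%:E)%E = cst 0%E.
  by apply/funext => j; rewrite z.
move=> H.
have E : (\int[mu]_y (m y * k y * (cos (2%:R * pi * dot om y + b) * f y))%:E)%E =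
   (\int[mu]_y (m y * g y)%:E)%E.
  by apply: eq_integral => y _; rewrite /g !mulrA.
rewrite E; suff -> : (\int[mu]_y (m y * g y)%:E = 0)%E by [].
apply: (@cvg_unique _ _ (cst (0 : \bar R)%E @ \oo)); first exact: ereal_hausdorff.
  apply: H => //.
  - move=> j; apply/measurable_EFinP; apply: measurable_funM => //.
    exact: (mm j).1.1.
  - move=> y _; apply: cvg_EFin; first exact: nearW.
    by apply: cvgM; [exact: mcvg|exact: cvg_cst].
  - move=> j y _; rewrite /= lee_fin normrM -(mulrA K) ler_pM//.
    exact: gC.
exact: cvg_cst.
Qed.

(** The exponential series converges boundedly on the range of [m]. *)
Lemma multiplier_exp m : multiplier m -> multiplier (fun y => expR (m y)).
Proof.
move=> mm; have [[_ [K mK]] _] := mm.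
apply: (@multiplier_cvg (fun k y => series (exp_coeff (m y)) k) _ (expR K)).
- move=> k; apply: multiplier_sum => j.
  have := multiplierZ (j`!%:R^-1) (multiplierX j mm).
  by under eq_fun do rewrite mulrC.
- move=> k y; apply: (@le_trans _ _ (series (exp_coeff K) k)).
    rewrite (le_trans (ler_norm_sum _ _ _))//; apply: ler_sum => j _.
    rewrite /exp_coeff/= normrM normrX normfV normr_nat ler_wpM2r//.
    by rewrite lerXn2r// nnegrE (le_trans _ (mK y)).
  apply: nondecreasing_cvgn_le; last exact: is_cvg_series_exp_coeff.
  apply/nondecreasing_seqP => j; rewrite /series/= big_nat_recr//= lerDl.
  by rewrite exp_coeff_ge0// (le_trans _ (mK 0)).
- by move=> y; exact: is_cvg_series_exp_coeff.
Qed.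

End fourier_uniqueness.

Section cutoff.
Context {R : realType}.
Implicit Types (t a delta : R).

(** The limit of [1 - exp (- t ^ k)] for [k] tending to infinity; this dictates the
    value at [t = 1]. *)
Definition cutoff (t : R) : R :=
  if t < 1 then 0 else if t == 1 then 1 - expR (- 1) else 1.

Lemma expRN_bounds t : 0 <= t -> 0 <= 1 - expR (- t) <= 1.
Proof.
move=> t0; rewrite subr_ge0 lerBlDr lerDl expR_ge0 andbT.
by rewrite -[leRHS]expR0 ler_expR oppr_le0.
Qed.

Lemma cutoff_bounds t : 0 <= cutoff t <= 1.
Proof.
rewrite /cutoff; case: ifP => _; first by rewrite lexx ler01.
by case: ifP => _; [exact: expRN_bounds|rewrite ler01 lexx].
Qed.

Lemma cvg_cutoff t : 0 <= t -> 1 - expR (- (t ^+ k)) @[k --> \oo] --> cutoff t.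
Proof.
move=> t0; rewrite /cutoff; have [t1|t1|->] := ltgtP t 1.
- rewrite -[X in _ --> X](subrr 1) -[X in _ --> _ - X](expR0) -[X in expR X]oppr0.
  apply: cvgB; first exact: cvg_cst.
  apply: (@cvg_comp _ _ _ (fun k => - t ^+ k) (@expR R) _ (nbhs (- 0))); last first.
    exact: continuous_expR.
  by apply: cvgN; apply: cvg_expr; rewrite ger0_norm.
- rewrite -[X in _ --> X](subr0 1); apply: cvgB; first exact: cvg_cst.
  have tV : `|t^-1| < 1 by rewrite ger0_norm ?invr_ge0// invf_lt1// (lt_trans _ t1).
  apply: (squeeze_cvgr _ (cvg_cst (0 : R)) (cvg_expr tV)); apply: nearW => k.
  rewrite expR_ge0/= expRN exprVn lef_pV2 ?posrE ?expR_gt0 ?exprn_gt0 ?(lt_trans _ t1)//.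
  by rewrite (le_trans _ (expR_ge1Dx _))// lerDr.
- under eq_fun do rewrite expr1n; exact: cvg_cst.
Qed.

Lemma cos_normr a : cos `|a| = cos a.
Proof. by have [a0|a0] := leP 0 a; [rewrite ger0_norm|rewrite ltr0_norm// cosN]. Qed.

Lemma cos_gt0_le1 a : 0 <= a <= 1 -> 0 < cos a.
Proof.
move=> /andP[a0 a1]; apply: cos_gt0_pihalf; apply/andP; split.
  by rewrite (lt_le_trans _ a0)// oppr_lt0 divr_gt0// pi_gt0.
apply: (le_lt_trans a1); rewrite ltr_pdivlMr// mul1r.
have := @pihalf_ge1 R; rewrite ler_pdivlMr// mul1r le_eqVlt => /orP[/eqP p2|//].
by have := @cos_pihalf R; rewrite -p2 divff// => c1; have := @cos1_gt0 R; rewrite c1 ltxx.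
Qed.

Lemma cutoff_cos (a delta : R) : `|a| <= 1 -> 0 <= delta <= 1 ->
  cutoff ((cos a / cos delta) ^+ 2) =
    if delta < `|a| then 0 else if delta == `|a| then 1 - expR (- 1) else 1.
Proof.
move=> a1 d1; rewrite -(cos_normr a).
have a01 : 0 <= `|a| <= 1 by rewrite normr_ge0.
have ca := cos_gt0_le1 a01; have cd := cos_gt0_le1 d1.
have pi1 : 1 <= pi :> R by rewrite (le_trans _ (pi_ge2 R))// ler1n.
have dI : delta \in `[0, pi].
  by rewrite in_itv/=; case/andP: d1 => -> /le_trans ->.
have aI : `|a| \in `[0, pi] by rewrite in_itv/= normr_ge0/= (le_trans a1).
have r0 : 0 <= cos `|a| / cos delta by rewrite divr_ge0 ?ltW.
rewrite /cutoff -[X in _ < X](expr1n _ 2) -[X in _ == X](expr1n _ 2).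
rewrite ltr_pXn2r ?nnegrE// eqrXn2// ltr_pdivrMr// mul1r ltr_cos//.
suff -> : (cos `|a| / cos delta == 1) = (delta == `|a|) by [].
apply/eqP/eqP => [E|->]; last by rewrite divff// gt_eqF.
by apply/esym/cos_inj => //; rewrite -[LHS](divfK (lt0r_neq0 cd)) E mul1r.
Qed.

End cutoff.

Section fourier_injectivity.
Context {R : realType} {d : nat}.
Notation mu := (lebesgue_rV R d).

Definition cube_indicator n (delta : R) (y : 'rV[R]_n) : R :=
  \prod_(i < n) \1_(`]- delta, delta[%classic) (y ord0 i).

Lemma measurable_cube_indicator n delta :
  measurable_fun setT (@cube_indicator n delta).
Proof.
apply: measurable_prod => i _ /=.
apply: (measurableT_comp (f := \1_(`]- delta, delta[%classic) : R -> R));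
  last exact: (measurable_rV_coord i).
exact: measurable_indic.
Qed.

Lemma cube_indicator_ge0 n delta (y : 'rV[R]_n) : 0 <= cube_indicator delta y.
Proof. by apply: prodr_ge0 => i _; rewrite indicE. Qed.

Lemma cube_integral_gt0 n (delta : R) : 0 < delta ->
  (0 < \int[lebesgue_rV R n]_y (cube_indicator delta y)%:E)%E.
Proof.
move=> d0; elim: n => [|n IH].
  rewrite /= integral_dirac//.
    by rewrite diracT mul1e lte_fin /cube_indicator big_ord0.
  by apply/measurable_EFinP; exact: measurable_cube_indicator.
have mc k : measurable_fun setT (EFin \o @cube_indicator k delta).
  by apply/measurable_EFinP; exact: measurable_cube_indicator.
have c0 k (y : 'rV[R]_k) : (0 <= (cube_indicator delta y)%:E)%E.
  by rewrite lee_fin cube_indicator_ge0.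
rewrite ge0_integral_rV_succ; last 2 first.
- exact: mc.
- by move=> x.
have E (a : R) (y : 'rV[R]_n) : cube_indicator delta (rV_cons (a, y)) =
    \1_(`]- delta, delta[%classic) a * cube_indicator delta y.
  rewrite /cube_indicator big_ord_recl rV_consE0; congr (_ * _).
  by apply: eq_bigr => i _; rewrite rV_consES.
under eq_integral do under eq_integral do rewrite E EFinM.
under eq_integral => a _.
  rewrite ge0_integralZl//; last exact: mc.
  over.
rewrite ge0_integralZr//; last 2 first.
- by apply/measurable_EFinP; exact: measurable_indic.
- exact: integral_ge0.
rewrite mule_gt0// integral_indic// setIT.
rewrite [X in (_ < X)%E](lebesgue_measure_itv `]- delta, delta[)/= lte_fin.
by rewrite gtrN// -EFinB lte_fin opprK addr_gt0.
Qed.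

Context (f : 'rV[R]_d -> R) (uf : uschwartz (fun _ : unit => f)).

(** An indicator function, except on [|y_i| = delta], where the value is the one
    inherited from [cutoff]. *)
Definition slab (delta : R) (i : 'I_d) (y : 'rV[R]_d) : R :=
  if delta < `|y ord0 i| then 0 else
  if delta == `|y ord0 i| then 1 - expR (- 1) else 1.

(** Powers of the ratio of [cos (y_i / L)] to [cos (delta / L)] separate the two
    sides of [|y_i| = delta] modulo [pi L]; letting [L] grow removes the
    periodicity. *)
Lemma multiplier_slab delta i : 0 < delta <= 1 -> multiplier f (slab delta i).
Proof.
move=> /andP[d0 d1].
pose L (k : nat) : R := k.+1%:R.
have L1 k : 1 <= L k by rewrite ler1n.
have L0 k : 0 < L k by rewrite ltr0n.
pose r k (y : 'rV[R]_d) := cos (y ord0 i / L k) / cos (delta / L k).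
have pi0 : 2%:R * pi != 0 :> R by rewrite mulf_neq0 ?pnatr_eq0// gt_eqF// pi_gt0.
have mr k : multiplier f (r k).
  have := multiplierZ uf (cos (delta / L k))^-1
    (multiplier_cos uf ((2%:R * pi)^-1 * (L k)^-1 *: evec i)).
  congr multiplier; apply/funext => y; rewrite mulrC; congr (cos _ / _).
  by rewrite dotZl (dotC (evec i)) dot_evec -(mulrA _ (L k)^-1) (mulVKf pi0) mulrC.
have mstep k : multiplier f (fun y => cutoff (r k y ^+ 2)).
  apply: (@multiplier_cvg _ _ _ uf
    (fun j y => 1 + (-1) * expR ((-1) * (r k y ^+ 2) ^+ j)) _ 1).
  - move=> j; apply: (multiplierD uf); first exact: multiplier1.
    apply: (multiplierZ uf); apply: (multiplier_exp uf); apply: (multiplierZ uf).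
    by apply: (multiplierX j); exact: (multiplierX 2 (mr k)).
  - move=> j y; rewrite !mulN1r.
    have /andP[h0 h1] := expRN_bounds (exprn_ge0 j (sqr_ge0 (r k y))).
    by rewrite ger0_norm.
  - move=> y; under eq_fun do rewrite !mulN1r.
    exact: cvg_cutoff (sqr_ge0 (r k y)).
apply: (@multiplier_cvg _ _ _ uf (fun k y => cutoff (r k y ^+ 2)) _ 1).
- exact: mstep.
- by move=> k y; have /andP[h0 h1] := cutoff_bounds (r k y ^+ 2); rewrite ger0_norm.
move=> y.
apply: cvg_near_cst; near=> k.
have yL : `|y ord0 i| <= L k.
  apply: (@le_trans _ _ k%:R); last by rewrite ler_nat.
  near: k; exact: nbhs_infty_ger.
rewrite /r cutoff_cos.
- rewrite /slab normrM normfV (gtr0_norm (L0 k)) ltr_pM2r ?invr_gt0//.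
  by rewrite (inj_eq (mulIf _))// invr_eq0 gt_eqF.
- by rewrite normrM normfV (gtr0_norm (L0 k)) ler_pdivrMr// mul1r.
- apply/andP; split; first by rewrite divr_ge0 ?(ltW d0) ?(ltW (L0 k)).
  by rewrite ler_pdivrMr// mul1r (le_trans d1).
Unshelve. all: by end_near. Qed.

Lemma slab_bounds delta i y : 0 <= slab delta i y <= 1.
Proof.
rewrite /slab; case: ifP => _; first by rewrite lexx ler01.
by case: ifP => _; [exact: expRN_bounds|rewrite ler01 lexx].
Qed.

(** A Schwartz function with zero Fourier transform integrates to zero against a
    bump concentrated near the origin, so it is not positive there. *)
Lemma fourier_eq0_le0 :
  (forall om b, \int[mu]_y (cos (2%:R * pi * dot om y + b) * f y) = 0) -> f 0 <= 0.
Proof.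
move=> H; rewrite leNgt; apply/negP => f0.
have [C C0 fC] := uschwartz_lipschitz uf.
have M0 : 0 < C * d%:R + 1 by rewrite ltr_wpDl// mulr_ge0.
pose delta := Num.min 1 (f 0 / 2 / (C * d%:R + 1)).
have d0 : 0 < delta by rewrite lt_min ltr01/= divr_gt0// divr_gt0.
have d1 : delta <= 1 by rewrite ge_min lexx.
have f2 (y : 'rV[R]_d) : (forall j, `|y ord0 j| <= delta) -> f 0 / 2 <= f y.
  move=> yd.
  have : `|f y - f 0| <= f 0 / 2.
    apply: (@le_trans _ _ (C * \sum_(j < d) `|y ord0 j - (0 : 'rV[R]_d) ord0 j|)).
      by apply: (fC tt) => j; rewrite mxE subr0 (le_trans (yd j)).
    apply: (@le_trans _ _ (C * \sum_(j < d) delta)).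
      by rewrite ler_wpM2l// ler_sum// => j _; rewrite mxE subr0.
    rewrite sumr_const card_ord -[delta *+ d]mulr_natl (mulrA C).
    apply: (@le_trans _ _ ((C * d%:R + 1) * delta)).
      by rewrite ler_wpM2r ?(ltW d0)// lerDl.
    apply: (@le_trans _ _ ((C * d%:R + 1) * (f 0 / 2 / (C * d%:R + 1)))).
      by rewrite ler_wpM2l ?(ltW M0)// /delta ge_min lexx orbT.
    by rewrite mulrC divfK ?gt_eqF.
  by rewrite ler_norml => /andP[+ _]; lra.
pose chi (y : 'rV[R]_d) := \prod_(i < d) slab delta i y.
have mchi : multiplier f chi.
  by apply: multiplier_prod => i; apply: multiplier_slab; rewrite d0.
have chi0 y : 0 <= chi y.
  by apply: prodr_ge0 => i _; have /andP[] := slab_bounds delta i y.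
have a1 : annihilates f (fun=> 1).
  by move=> om b; rewrite -[RHS](H om b); apply: eq_Rintegral => y _; rewrite mul1r.
have b1 := (multiplier1 f).1.
have dot0 (y : 'rV[R]_d) : 2%:R * pi * dot 0 y + 0 = 0.
  by rewrite /dot big1 ?mulr0 ?addr0// => i _; rewrite mxE mul0r.
have I0 : \int[mu]_y (chi y * f y) = 0.
  rewrite -[RHS](mchi.2 _ b1 a1 0 0); apply: eq_Rintegral => y _.
  by rewrite dot0 cos0 mulr1 mul1r.
have ichi : mu.-integrable setT (EFin \o (fun y => chi y * f y)).
  have := annihilates_integrable uf 0 0 mchi.1.
  by under [X in mu.-integrable _ (_ \o X)]eq_fun do rewrite dot0 cos0 mul1r.
have lower y : f 0 / 2 * cube_indicator delta y <= chi y * f y.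
  have [/forallP yd|] := boolP [forall j, `|y ord0 j| <= delta].
    have cle : cube_indicator delta y <= chi y.
      apply: ler_prod => i _; rewrite indicE ler0n/= /slab.
      rewrite (ltNge delta) yd/=; case: ifPn => [/eqP yE|_]; last by rewrite lern1 leq_b1.
      rewrite memNset /=; first by have /andP[] := @expRN_bounds R 1 ler01.
      by rewrite in_itv/= -ltr_norml yE; apply/negP; rewrite ltxx.
    rewrite (mulrC (chi y)); apply: ler_pM => //; last exact: f2.
      by rewrite ltW// divr_gt0.
    exact: cube_indicator_ge0.
  rewrite negb_forall => /existsP[j]; rewrite -ltNge => yj.
  rewrite /cube_indicator /chi (bigD1 j)//= [X in _ <= X * _](bigD1 j)//=.
  rewrite indicE /slab yj !mul0r memNset ?mul0r ?mulr0//= in_itv/= -ltr_norml.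
  by apply/negP; rewrite -leNgt ltW.
have icube : mu.-integrable setT (EFin \o @cube_indicator d delta).
  have i2 : mu.-integrable setT (EFin \o (fun y => (f 0 / 2)^-1 * (chi y * f y))).
    exact: (integrableZl measurableT (f 0 / 2)^-1 ichi).
  apply: (le_integrable _ _ _ i2) => //.
    by apply/measurable_EFinP; exact: measurable_cube_indicator.
  move=> y _ /=; rewrite lee_fin ger0_norm ?cube_indicator_ge0//.
  apply: (le_trans _ (ler_norm _)).
  by rewrite mulrC ler_pdivlMr ?divr_gt0// mulrC.
have : f 0 / 2 * \int[mu]_y cube_indicator delta y <= 0.
  rewrite -I0 -RintegralZl//; apply: le_Rintegral => //.
  exact: (integrableZl measurableT (f 0 / 2) icube).
apply/negP; rewrite -ltNge mulr_gt0 ?divr_gt0//.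
rewrite fine_gt0// cube_integral_gt0//=.
by have := integrable_fin_num measurableT icube; rewrite fin_numElt => /andP[].
Qed.

End fourier_injectivity.

Section wigner_nonzero.
Context {R : realType} {d : nat}.

(** Let [phi p != 0]. If the Wigner distribution vanished at all [(p, omega)], then
    so would the Fourier transform of
    [y |-> phi (p + tau y) * conj (phi (p - (1 - tau) y))], although this function
    takes the value [|phi p|^2 > 0] at 0. *)
Lemma wigner_nonzero tau (phi : 'rV[R]_d -> R[i]) :
  nonzero_window phi -> nonzero_window (wigner tau phi phi).
Proof.
move=> [sphi [p phip]]; split; first exact: wigner_schwartz.
apply: contrapT => W0.
have {}W0 u : wigner tau phi phi u = 0.
  by apply/eqP; apply: contra_notT W0 => ?; exists u.
have /schwartzP[uR uI] := wigner_kernel_schwartz tau sphi sphi.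
pose KR u := complex.Re (wigner_kernel tau phi phi u).
pose KI u := complex.Im (wigner_kernel tau phi phi u).
pose F (g : 'rV[R]_(d + d) -> R) c om := pft g c (row_mx p om).
have E om : F KR 0 om + F KI (- (pi / 2)) om = 0 /\
    F KI 0 om + F KR (pi / 2) om = 0.
  have := W0 (row_mx p om); rewrite wigner_pft// => /eqP.
  by rewrite eq_complex/= => /andP[/eqP ? /eqP ?].
have FE g c om : F g c om = \int[lebesgue_rV R d]_y
    (cos (2%:R * pi * dot om y + c) * g (row_mx p y)).
  by rewrite /F /pft row_mxKl row_mxKr.
pose S g om := F g (- (pi / 2)) om.
have SE g om : S g om = \int[lebesgue_rV R d]_y
    (sin (2%:R * pi * dot om y) * g (row_mx p y)).
  by rewrite /S FE; apply: eq_Rintegral => y _; rewrite cosB_pihalf.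
have iS g om : uschwartz (fun _ : unit => g) -> (lebesgue_rV R d).-integrable setT
    (EFin \o (fun y => sin (2%:R * pi * dot om y) * g (row_mx p y))).
  move=> ug; have [_ us] := uschwartz_wave om (fun _ : unit => 0) (uschwartz_restrict p ug).
  have := uschwartz_integrable tt us.
  by under [X in (lebesgue_rV R d).-integrable _ (_ \o X)]eq_fun do rewrite addr0.
have iC g om : uschwartz (fun _ : unit => g) -> (lebesgue_rV R d).-integrable setT
    (EFin \o (fun y => cos (2%:R * pi * dot om y + 0) * g (row_mx p y))).
  move=> ug; have [uc _] := uschwartz_wave om (fun _ : unit => 0) (uschwartz_restrict p ug).
  exact: uschwartz_integrable tt uc.
have SN g om : uschwartz (fun _ : unit => g) -> F g (pi / 2) om = - S g om.
  move=> ug; rewrite FE SE -mulN1r -RintegralZl//; last exact: iS.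
  by apply: eq_Rintegral => y _; rewrite cosD_pihalf mulN1r mulNr.
have dotN (om y : 'rV[R]_d) : 2%:R * pi * dot (- om) y = - (2%:R * pi * dot om y).
  by rewrite -scaleN1r dotZl mulN1r mulrN.
(* The sums in [E] split into their even and odd parts in the frequency. *)
have even g om : F g 0 (- om) = F g 0 om.
  by rewrite !FE; apply: eq_Rintegral => y _; rewrite dotN !addr0 cosN.
have odd g om : uschwartz (fun _ : unit => g) -> S g (- om) = - S g om.
  move=> ug; rewrite !SE -mulN1r -RintegralZl//; last exact: iS.
  by apply: eq_Rintegral => y _; rewrite dotN sinN mulN1r mulNr.
have C0 om : F KR 0 om = 0.
  have [+ _] := E om; have [+ _] := E (- om).
  by rewrite even -!/(S _ _) odd// => + +; lra.
have S0 om : S KR om = 0.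
  have [_ +] := E om; have [_ +] := E (- om).
  by rewrite even !SN// odd// => + +; lra.
have ur := uschwartz_restrict p uR.
have := @fourier_eq0_le0 _ _ _ ur; rewrite leNgt.
have -> : (0 < complex.Re (wigner_kernel tau phi phi (row_mx p 0))) = true.
  rewrite /wigner_kernel row_mxKl row_mxKr !scaler0 subr0 addr0 ReM Re_conjc Im_conjc.
  move: phip; case: (phi p) => x y; rewrite eq_complex/= negb_and => xy.
  rewrite mulrN opprK -!expr2 lt0r addr_ge0 ?sqr_ge0// andbT paddr_eq0 ?sqr_ge0//.
  by rewrite !sqrf_eq0 negb_and.
move=> /(_ _)/negP; apply=> // om b.
transitivity (cos b * F KR 0 om - sin b * S KR om); last first.
  by rewrite C0 S0 !mulr0 subrr.
have j1 := iC KR om uR; have j2 := iS KR om uR.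
rewrite FE SE -!RintegralZl// -RintegralB//; last 2 first.
- exact: (integrableZl measurableT (cos b) j1).
- exact: (integrableZl measurableT (sin b) j2).
by apply: eq_Rintegral => y _; rewrite cosD addr0 /KR; ring.
Qed.

End wigner_nonzero.

(** * The characterization *)

Section characterization.
Context {R : realType} {d : nat}.

(** The bound by [H] holds for all modulations at a given point, as any of them is
    attained. *)
Lemma almost_diagonal_amalgam (v H : 'rV[R]_(d + d) -> R) phi tau sigma :
  admissible v -> tempered sigma -> schwartz phi -> in_L1 v H ->
  (forall w z, Normc.normc (Op_tau tau sigma (tfshift z phi) (tfshift w phi))
     <= H (T_tau tau w z)) ->
  in_amalgam v (wigner tau phi phi) sigma.
Proof.
move=> av ts sphi [mH iH] HH; split=> //; apply: le_lt_trans iH.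
have mv : measurable_fun setT (EFin \o v).
  by apply/measurable_EFinP; apply: continuous_measurable_rV; exact: admissible_cont av.
apply: ge0_le_integral => //.
- move=> u _; apply: mule_ge0; first exact: stft_sup_ge0.
  by rewrite lee_fin (admissible_ge0 av).
- by apply: emeasurable_funM => //; apply: measurable_stft_sup => //; exact: wigner_schwartz.
- apply/measurable_EFinP; apply: measurable_funM; last exact/measurable_EFinP.
  by apply: measurableT_comp.
move=> u _; rewrite EFinM lee_wpmul2r ?lee_fin ?(admissible_ge0 av)//.
apply: ge_ereal_sup => _ [zeta _ <-]; rewrite lee_fin.
have [w [z [<- <-]]] := T_tau_surjective tau u zeta.
by rewrite -normc_Op_tau// (le_trans (HH w z))// ler_norm.
Qed.

(** The best bound is [H = stft_sup (wigner tau phi phi) sigma]. *)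
Lemma amalgam_almost_diagonal (v : 'rV[R]_(d + d) -> R) phi tau sigma :
  admissible v -> window_independent v -> nonzero_window phi ->
  in_amalgam v (wigner tau phi phi) sigma ->
  exists H : 'rV[R]_(d + d) -> R, in_L1 v H /\
    forall w z, Normc.normc (Op_tau tau sigma (tfshift z phi) (tfshift w phi))
      <= H (T_tau tau w z).
Proof.
move=> av wv nphi iW; have [ts iF] := iW.
have [sphi _] := nphi.
have sW := wigner_schwartz tau sphi sphi.
pose F := stft_sup (wigner tau phi phi) sigma.
have F0 u : (0 <= F u)%E by exact: stft_sup_ge0.
have Ffin u : (F u < +oo)%E.
  apply: stft_sup_finite => //.
  exact: (amalgam_integrable av wv (wigner_nonzero tau nphi) iW).
have FE u : (fine (F u))%:E = F u by rewrite fineK// ge0_fin_numE.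
exists (fine \o F); split.
  split.
    apply/measurable_EFinP; rewrite (_ : _ \o _ = F).
      exact: measurable_stft_sup.
    by apply/funext => u /=.
  under eq_integral do rewrite /= ger0_norm ?fine_ge0// EFinM FE.
  exact: iF.
move=> w z; rewrite normc_Op_tau// -lee_fin /= FE.
exact: stft_sup_ub.
Qed.

End characterization.

Theorem theorem4p7 (R : realType) (d : nat) (hd : (0 < d)%N)
    (v : 'rV[R]_(d + d) -> R) (hv : admissible v)
    (hW : window_independent v)
    (G : 'rV[R]_(d + d) -> R[i]) (hG : nonzero_window G)
    (phi : 'rV[R]_d -> R[i]) (hphi : nonzero_window phi)
    (tau : R) (htau : 0 <= tau <= 1)
    (sigma : ('rV[R]_(d + d) -> R[i]) -> R[i]) :
  in_amalgam v G sigma <->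
  (tempered sigma /\
   exists H : 'rV[R]_(d + d) -> R,
     in_L1 v H /\
     forall w z : 'rV[R]_(d + d),
       Normc.normc (Op_tau tau sigma (tfshift z phi) (tfshift w phi))
         <= H (T_tau tau w z)).
Proof.
rewrite (hW _ _ hG (wigner_nonzero tau hphi) sigma).
split=> [iW|[ts [H [LH HH]]]].
  by split; [exact: iW.1|exact: amalgam_almost_diagonal].
exact: almost_diagonal_amalgam hphi.1 LH HH.
Qed.
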